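(* Let $\pi\in\Pi$ be a finitely supported function of type $\mathbf{II}$. If $\mathfrak g_{fin}$ is of type $A_n, D_n, E_6, E_7$ or $E_8$, then $X_\pi^{\mathbf s}\sim X_\pi^{\mathbf r}$ for all $\mathbf r,\mathbf s\in\mathbb Z_0^k$.
   Context: Notation for $\mathfrak g_{fin}$. $\mathfrak g_{fin}$ is a finite-dimensional simple complex Lie algebra of rank $n$ with Cartan subalgebra $\mathfrak h_{fin}$, root system $R_{fin}$, simple roots $\alpha_1,\dots,\alpha_n$, highest root $\theta$. The form $(\cdot|\cdot)$ is normalized so that long roots have square length $2$. Toroidal algebra. For $k\in\mathbb N$, $\mathcal T_k(\mathfrak g)=\mathfrak g_{fin}\otimes\mathbb C[t_1^{\pm1},\dots,t_k^{\pm1}]\oplus\mathcal Z_k\oplus D_k$, where $\mathcal Z_k$ is spanned by symbols $t^{\mathbf m}K_i$ ($\mathbf m\in\mathbb Z^k$, $1\le i\le k$) subject to $\sum_i r_i t^{\mathbf r}K_i=0$ for all $\mathbf r\in\mathbb Z^k$, and $D_k$ is spanned by $d_1,\dots,d_k$. Brackets: $[x\otimes t^{\mathbf m},y\otimes t^{\mathbf s}]=[x,y]\otimes t^{\mathbf m+\mathbf s}+(x|y)\sum_i m_i t^{\mathbf m+\mathbf s}K_i$, $\mathcal Z_k$ commutes with $\mathfrak g_{fin}\otimes\mathbb C[t_1^{\pm1},\dots,t_k^{\pm1}]$ and itself, $[d_i,x\otimes t^{\mathbf m}]=m_i x\otimes t^{\mathbf m}$, $[d_i,t^{\mathbf m}K_j]=m_it^{\mathbf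 m}K_j$, $[d_i,d_j]=0$. Write $K_i=t^{\mathbf 0}K_i$ and $\mathfrak h_{tor}=\mathfrak h_{fin}\oplus\bigoplus_i\mathbb CK_i\oplus D_k$. A module is integrable if it is $\mathfrak h_{tor}$-diagonalizable and all $x_\alpha\otimes t^{\mathbf m}$ ($x_\alpha$ a root vector of $\mathfrak g_{fin}$, $\mathbf m\in\mathbb Z^k$) act locally nilpotently. $\mathbb Z_0^k=\{\mathbf m\in\mathbb Z^k:m_1=0\}$. Category and linkage. Throughout, modules are assumed to have integer eigenvalues for all $d_i$ (so only $\pi$ for which this holds are considered). For $m>0$, $\mathcal J_{int}^m$ is the category of integrable $\mathcal T_k(\mathfrak g)$-modules of finite length with finite-dimensional $\mathfrak h_{tor}$-weight spaces on which $K_1$ acts by $m$ and $K_2,\dots,K_k$ act by $0$; $\mathcal J_{int}^+=\bigoplus_{m>0}\mathcal J_{int}^m$. Two indecomposable objects $U,V$ are linked, $U\sim V$, if there are indecomposable objects $U=U_1,\dots,U_r=V$ of $\mathcal J_{int}^+$ with $\operatorname{Hom}(U_i,U_{i+1})\ne0$ or $\operatorname{Hom}(U_{i+1},U_i)\neq0$ for $1\le i\le r-1$. Affine algebra. $\mathfrak g_{aff}=\mathcal T_1(\mathfrak g)=\mathfrak g_{fin}\otimes\mathbb C[t_1^{\pm1}]\oplus\mathbb CK_1\oplus\mathbb Cd_1$, $\mathfrak h_{aff}=\mathfrak h_{fin}\oplus\mathbb CK_1\oplus\mathbb Cd_1$; fundamental weights $\Lambda_1,\dots,\Lambda_{n+1}$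 ($\Lambda_{n+1}$ attached to the affine node $\alpha_{n+1}=\delta_1-\theta$, $\alpha_{n+1}^\vee=K_1-\theta^\vee$), with $\Lambda_i(\alpha_j^\vee)=\delta_{ij}$, $\Lambda_i(d_1)=0$; $\delta_1$ vanishes on $\mathfrak h_{fin}\oplus\mathbb CK_1$ and $\delta_1(d_1)=1$. $P_{aff}^+=\sum_{i=1}^{n+1}\mathbb Z_+\Lambda_i+\mathbb C\delta_1$. $X(\lambda)$ is the irreducible integrable highest weight $\mathfrak g_{aff}$-module of highest weight $\lambda\in P_{aff}^+$. Simple modules. $\Pi$ is the set of finitely supported functions $\pi:\max\mathbb C[t_2^{\pm1},\dots,t_k^{\pm1}]\to P_{aff}^+$, $\operatorname{supp}(\pi)=\{M:\pi(M)\ne0\}$. For $\pi$ with support $\{M_1,\dots,M_l\}$ put $X_\pi=X(\pi(M_1))\otimes\cdots\otimes X(\pi(M_l))$, on which $Y\otimes f$ ($Y\in\mathfrak g_{fin}\otimes\mathbb C[t_1^{\pm1}]\oplus\mathbb CK_1$, $f\in\mathbb C[t_2^{\pm1},\dots,t_k^{\pm1}]$) acts by $\sum_i \mathrm{ev}_{M_i}(f)\,1\otimes\cdots\otimes Y\otimes\cdots\otimes1$ ($Y$ in position $i$), $\mathrm{ev}_{M}$ being evaluation at the point of $M$, and $d_1$ acts as usual on the tensor product. $L(X_\pi)=X_\pi\otimes\mathbb C[t_2^{\pm1},\dots,t_k^{\pm1}]$ is the $\mathcal T_k(\mathfrak g)$-module with $(Y\otimes f)(w\otimes f')=((Y\otimes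 f)w)\otimes ff'$, $d_1(w\otimes f')=d_1w\otimes f'$, $d_i(w\otimes f')=w\otimes t_i\partial_{t_i}f'$ ($i\ge2$), and $t^{\mathbf r}K_i$ ($i\ge2$, any $\mathbf r$) and $t^{\mathbf r}K_1$ ($r_1\neq0$) acting by $0$. With $v_\pi$ the tensor product of highest weight vectors, $X_\pi^{\mathbf g}=\mathcal U(\mathcal T_k(\mathfrak g))(v_\pi\otimes t^{\mathbf g})$ for $\mathbf g\in\mathbb Z_0^k$; these modules are irreducible. Type. $\pi\in\Pi$ is of type $\mathbf{II}$ if there exists $M\in\operatorname{supp}(\pi)$ with $\pi(M)(K_1)\ge(\theta|\theta)$. *)

(* Defs.v *)
From HB Require Import structures.
From mathcomp Require Import all_boot all_order all_algebra all_fingroup.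
From mathcomp Require Import finmap.
From mathcomp Require Import boolp classical_sets reals.

Set Implicit Arguments.
Unset Strict Implicit.
Unset Printing Implicit Defensive.

Import Order.TTheory GRing.Theory Num.Theory.

Local Open Scope classical_set_scope.
Local Open Scope ring_scope.

HB.mixin Record Vector_isLie (F : fieldType) L of Vector F L := {
  lie : L -> L -> L;
  lie_linearl : forall y, linear (lie^~ y);
  lie_linearr : forall x, linear (lie x);
  lie_xx : forall x, lie x x = 0;
  lie_jacobi : forall x y z,
    lie x (lie y z) + lie y (lie z x) + lie z (lie x y) = 0
}.

#[short(type="finLieType")]
HB.structure Definition FinLie (F : fieldType) :=
  {L of Vector F L & Vector_isLie F L}.

Section LieAlgebra.
Variables (F : fieldType) (g : finLieType F).
Implicit Types U V h : {vspace g}.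

Definition lie_simple : Prop :=
  (exists x y : g, lie x y != 0) /\
  (forall I : {vspace g}, (forall x y, y \in I -> lie x y \in I) ->
     I = 0%VS \/ I = fullv).

Definition lie_vspace U V : {vspace g} :=
  <<[seq lie x y | x <- vbasis U, y <- vbasis V]>>%VS.

(* Nilpotent and equal to its own normalizer; the normalizer condition is
   only needed in one direction, the other being closure under brackets. *)
Definition cartan_subalgebra h : Prop :=
  [/\ (lie_vspace h h <= h)%VS,
      exists N, iter N (lie_vspace h) h = 0%VS &
      forall x, (forall y, y \in h -> lie x y \in h) -> x \in h].

Definition dual h : vectType F := 'Hom(subvs_of h, F^o).

Definition in_root_space h (a : dual h) (x : g) : Prop :=
  forall H : subvs_of h, lie (vsval H) x = (a H : F) *: x.

Definition is_root h (a : dual h) : Prop :=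
  a != 0 /\ exists2 x, x != 0 & in_root_space a x.

Definition invariant_form (B : g -> g -> F) : Prop :=
  [/\ forall x, scalar (B x), forall x y, B x y = B y x,
      forall x y z, B (lie x y) z = B x (lie y z) &
      forall x, (forall y, B x y = 0) -> x = 0].

(* The element t_a of h with B t_a H = a H for all H in h. *)
Definition dual_elt (B : g -> g -> F) h (a : dual h) : subvs_of h :=
  let nu : 'Hom(subvs_of h, dual h) :=
    linfun (fun H : subvs_of h =>
      linfun (fun H' : subvs_of h => B (vsval H) (vsval H') : F^o) : dual h)
  in (nu^-1)%VF a.

Definition dual_form (B : g -> g -> F) h (a b : dual h) : F :=
  B (vsval (dual_elt B a)) (vsval (dual_elt B b)).

Definition form_coroot (B : g -> g -> F) h (a : dual h) : subvs_of h :=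
  (2 / dual_form B a a) *: dual_elt B a.

Definition root_base h n (alpha : 'I_n -> dual h) : Prop :=
  [/\ forall i, is_root (alpha i),
      basis_of fullv [tuple alpha i | i < n] &
      forall b : dual h, is_root b -> exists c : 'I_n -> nat,
        b = \sum_i alpha i *+ c i \/ b = - \sum_i alpha i *+ c i].

Definition highest_root h n (alpha : 'I_n -> dual h) (theta : dual h) : Prop :=
  is_root theta /\
  forall b : dual h, is_root b ->
    exists c : 'I_n -> nat, theta = b + \sum_i alpha i *+ c i.

End LieAlgebra.

(* The third normalization clause says that the largest square length of a
   root is 2, i.e. that the long roots have square length 2. *)
Record simpleLie (F : numClosedFieldType) := SimpleLie {
  gfin :> finLieType F;
  gfin_simple : lie_simple gfin;
  hfin : {vspace gfin};
  hfin_cartan : cartan_subalgebra hfin;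
  rank : nat;
  alpha : 'I_rank -> dual hfin;
  alpha_base : root_base alpha;
  theta : dual hfin;
  theta_highest : highest_root alpha theta;
  form : gfin -> gfin -> F;
  form_invariant : invariant_form form;
  form_normalized :
    (exists2 a : dual hfin, is_root a & dual_form form a a = 2) /\
    (forall a : dual hfin, is_root a -> dual_form form a a <= 2)
}.

Section DynkinType.
Variables (F : numClosedFieldType) (G : simpleLie F).

Definition coroot (a : dual (hfin G)) : subvs_of (hfin G) :=
  form_coroot (@form F G) a.

(* The Cartan matrix of G is, up to a renumbering of the simple roots, that of
   the simply laced diagram whose edges are given by adj on {0, ..., n-1}. *)
Definition has_diagram (adj : rel nat) : Prop :=
  exists s : {perm 'I_(rank G)}, forall i j,
    alpha (s j) (coroot (alpha (s i))) =
      if i == j then 2 else if adj i j || adj j i then -1 else 0.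

(* Bourbaki numbering, shifted to start at 0; each edge is listed once. *)
Definition edge_A : rel nat := fun i j => j == i.+1.
Definition edge_D (n : nat) : rel nat := fun i j =>
  ((j == i.+1) && (j < n.-1)%N) || ((i == n - 3)%N && (j == n.-1)).
Definition edge_E : rel nat := fun i j =>
  [|| (i == 0%N) && (j == 2%N), (i == 1%N) && (j == 3%N)
    | (2 <= i)%N && (j == i.+1)].

Definition type_ADE : Prop :=
  [\/ has_diagram edge_A,
      (4 <= rank G)%N /\ has_diagram (edge_D (rank G)) |
      rank G \in [:: 6; 7; 8]%N /\ has_diagram edge_E].

End DynkinType.

(* The spanning set of the toroidal algebra in k variables:
   Loop x m is x (x) t^m, Central m i is t^m K_i and Deg i is d_i. *)
Variant tor_gen (F : numClosedFieldType) (G : simpleLie F) (k : nat) : Type :=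
  | Loop of G & 'rV[int]_k
  | Central of 'rV[int]_k & 'I_k
  | Deg of 'I_k.
Arguments Central {F G k}.
Arguments Deg {F G k}.

Section ToroidalModule.
Variables (F : numClosedFieldType) (G : simpleLie F) (k : nat).

Definition comm (V : zmodType) (a b : V -> V) (v : V) : V := a (b v) - b (a v).

(* A module over the toroidal algebra, i.e. a linear map rho from the algebra
   to gl(V) compatible with brackets, given by the values of rho on the
   spanning set: the first two clauses are the linear relations that hold
   between the spanning elements, the others are the brackets. *)
Record tor_axioms (V : lmodType F) (act : tor_gen G k -> {linear V -> V}) :
    Prop := TorAxioms {
  act_loop_linear : forall m v, linear (fun x => act (Loop x m) v);
  act_central_rel : forall (r : 'rV[int]_k) v,
    \sum_i (r 0 i)%:~R *: act (Central r i) v = 0;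
  act_loop_loop : forall x y m s v,
    comm (act (Loop x m)) (act (Loop y s)) v =
      act (Loop (lie x y) (m + s)) v
      + form x y *: \sum_i (m 0 i)%:~R *: act (Central (m + s) i) v;
  act_central_loop : forall r i x m v,
    comm (act (Central r i)) (act (Loop x m)) v = 0;
  act_central_central : forall r i s j v,
    comm (act (Central r i)) (act (Central s j)) v = 0;
  act_deg_loop : forall i x (m : 'rV[int]_k) v,
    comm (act (Deg i)) (act (Loop x m)) v =
      (m 0 i)%:~R *: act (Loop x m) v;
  act_deg_central : forall i (m : 'rV[int]_k) j v,
    comm (act (Deg i)) (act (Central m j)) v =
      (m 0 i)%:~R *: act (Central m j) v;
  act_deg_deg : forall i j v, comm (act (Deg i)) (act (Deg j)) v = 0
}.

Record torModule := TorModule {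
  tm_sort :> lmodType F;
  act : tor_gen G k -> {linear tm_sort -> tm_sort};
  actP : tor_axioms act
}.

Arguments act {_} _.
Implicit Types U V : torModule.

Definition submodule V (N : set V) : Prop :=
  [/\ N 0, forall a u v, N u -> N v -> N (a *: u + v) &
      forall y v, N v -> N (act y v)].

Definition irreducible V : Prop :=
  (exists v : V, v != 0) /\
  (forall N : set V, submodule N -> N = [set 0] \/ N = setT).

Definition indecomposable V : Prop :=
  (exists v : V, v != 0) /\
  (forall N1 N2 : set V, submodule N1 -> submodule N2 ->
     N1 `&` N2 = [set 0] ->
     (forall v, exists v1 v2, [/\ N1 v1, N2 v2 & v = v1 + v2]) ->
     N1 = [set 0] \/ N2 = [set 0]).

(* A composition series 0 = N 0 < N 1 < ... < N l = V. *)
Definition finite_length V : Prop :=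
  exists (l : nat) (N : nat -> set V),
    [/\ forall i, submodule (N i), N 0%N = [set 0], N l = setT &
        forall i, (i < l)%N ->
          [/\ N i `<=` N i.+1, N i <> N i.+1 &
              forall N', submodule N' -> N i `<=` N' -> N' `<=` N i.+1 ->
                N' = N i \/ N' = N i.+1]].

Definition is_hom U V (f : {linear U -> V}) : Prop :=
  forall y u, f (act y u) = act y (f u).

Definition hom_nonzero U V : Prop :=
  exists2 f : {linear U -> V}, is_hom f & exists u, f u != 0.

(* h_tor = h_fin + sum_i C K_i + sum_i C d_i *)
Definition htor : vectType F :=
  (subvs_of (hfin G) * 'rV[F]_k * 'rV[F]_k)%type.

Definition hact V (H : htor) (v : V) : V :=
  act (Loop (vsval H.1.1 : G) 0) v
  + \sum_i H.1.2 0 i *: act (Central 0 i) v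
  + \sum_i H.2 0 i *: act (Deg i) v.

Definition weight : vectType F := 'Hom(htor, F^o).

Definition in_weight_space V (mu : weight) (v : V) : Prop :=
  forall H : htor, hact H v = (mu H : F) *: v.

Definition diagonalizable V : Prop :=
  forall v : V, exists2 s : seq V, v = \sum_(w <- s) w &
    forall w, w \in s -> exists mu, in_weight_space mu w.

Definition locally_nilpotent (V : lmodType F) (a : V -> V) : Prop :=
  forall v, exists N, iter N a v = 0.

Definition integrable V : Prop :=
  diagonalizable V /\
  (forall (a : dual (hfin G)) (x : G) (m : 'rV[int]_k),
     is_root a -> in_root_space a x ->
     locally_nilpotent (act (Loop x m) : V -> V)).

Definition finite_weight_spaces V : Prop :=
  forall mu : weight, exists s : seq V, forall v, in_weight_space mu v ->
    exists c : 'I_(size s) -> F, v = \sum_i c i *: s`_i.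

Definition integer_degrees V : Prop :=
  forall (i : 'I_k) (c : F) (v : V),
    v != 0 -> act (Deg i) v = c *: v -> exists n : int, c = n%:~R.

(* U(T_k(g)) v, the smallest submodule containing v *)
Definition cyclic V (v : V) : set V :=
  [set w | forall N : set V, submodule N -> N v -> N w].

Lemma cyclic_submodule V (v : V) : submodule (cyclic v).
Proof.
split=> [N [] //|a u w Hu Hw N HN Nv|y w Hw N HN Nv].
- by case: (HN) => _ clin _; apply: clin; [exact: Hu | exact: Hw].
- by case: (HN) => _ _; apply; exact: Hw.
Qed.

End ToroidalModule.

Arguments act {F G k _} _.

(* The cyclic submodule generated by v, as a module. *)
Section CyclicModule.
Variables (F : numClosedFieldType) (G : simpleLie F) (k : nat).
Variables (V : torModule G k) (v : V).

Definition cyclic_pred : {pred V} := fun w => `[< cyclic v w >].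

Lemma cyclic_closed : submod_closed cyclic_pred.
Proof.
have [c0 clin _] := cyclic_submodule v.
split; first exact/asboolP.
by move=> a u w /asboolP Hu /asboolP Hw; apply/asboolP; exact: clin.
Qed.

HB.instance Definition _ := GRing.isSubmodClosed.Build F V cyclic_pred
  cyclic_closed.

Record cyclic_sort := CyclicElt {
  cyclic_val : V;
  cyclic_valP : cyclic_val \in cyclic_pred
}.

HB.instance Definition _ := [isSub for cyclic_val].
HB.instance Definition _ := [Choice of cyclic_sort by <:].
HB.instance Definition _ := [SubChoice_isSubLmodule of cyclic_sort by <:].

End CyclicModule.

Section CyclicAction.
Variables (F : numClosedFieldType) (G : simpleLie F) (k : nat).
Variables (V : torModule G k) (v : V).

Fact cyclic_act_subproof (y : tor_gen G k) (w : cyclic_sort v) :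
  act y (cyclic_val w) \in cyclic_pred v.
Proof.
have [_ _ cact] := cyclic_submodule v.
by apply/asboolP; apply: cact; apply/asboolP; case: w.
Qed.

Definition cyclic_act_fun (y : tor_gen G k) (w : cyclic_sort v) :
    cyclic_sort v :=
  CyclicElt (cyclic_act_subproof y w).

Lemma cyclic_act_linear y : linear (cyclic_act_fun y).
Proof. by move=> a u w; apply: val_inj; rewrite /= linearP. Qed.

HB.instance Definition _ y := GRing.isLinear.Build F _ _ _
  (cyclic_act_fun y) (cyclic_act_linear y).

Definition cyclic_act (y : tor_gen G k) :
    {linear cyclic_sort v -> cyclic_sort v} := cyclic_act_fun y.

Lemma cyclic_actP : tor_axioms cyclic_act.
Proof.
pose f : {linear cyclic_sort v -> V} := val.
have fE y w : f (cyclic_act y w) = act y (f w) by [].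
have f_inj : injective f by exact: val_inj.
have [aL aR aLL aCL aCC aDL aDC aDD] := actP V.
split.
- by move=> m w a x y; apply: f_inj; rewrite linearP !fE aL.
- move=> r w; apply: f_inj; rewrite linear_sum linear0; apply: etrans (aR r (f w)).
  by apply: eq_bigr => i _; rewrite linearZ.
- move=> x y m s w; apply: f_inj.
  rewrite linearB linearD linearZ linear_sum !fE.
  rewrite [LHS]aLL; congr (_ + _ *: _).
- by move=> *; apply: f_inj; rewrite linearB linear0 !fE; exact: aCL.
- by move=> *; apply: f_inj; rewrite linearB linear0 !fE; exact: aCC.
- by move=> *; apply: f_inj; rewrite linearB linearZ !fE; exact: aDL.
- by move=> *; apply: f_inj; rewrite linearB linearZ !fE; exact: aDC.
- by move=> *; apply: f_inj; rewrite linearB linear0 !fE; exact: aDD.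
Qed.

Definition cyclic_module : torModule G k := TorModule cyclic_actP.

End CyclicAction.

Section Linkage.
Variables (F : numClosedFieldType) (G : simpleLie F) (k : nat).
Implicit Types U V : torModule G k.+1.

(* The objects of J_int^m; the index ord0 stands for the variable t_1. *)
Definition in_Jint (m : nat) V : Prop :=
  [/\ integrable V, finite_length V, finite_weight_spaces V,
      integer_degrees V &
      forall (i : 'I_k.+1) (v : V),
        act (Central 0 i) v = (if i == ord0 then m%:R else 0) *: v].

(* The objects of the direct sum of the categories J_int^m, m > 0. *)
Definition in_Jint_plus V : Prop :=
  exists (l : nat) (m : 'I_l -> nat) (W : 'I_l -> torModule G k.+1)
         (f : forall j, {linear W j -> V}),
    [/\ forall j, (0 < m j)%N /\ in_Jint (m j) (W j),
        forall j, is_hom (f j),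
        forall v, exists w : forall j, W j, v = \sum_j f j (w j) &
        forall w : forall j, W j,
          \sum_j f j (w j) = 0 -> forall j, w j = 0].

Definition linked U V : Prop :=
  exists (r : nat) (W : nat -> torModule G k.+1),
    [/\ W 0%N = U, W r = V,
        forall i, (i <= r)%N -> indecomposable (W i) /\ in_Jint_plus (W i) &
        forall i, (i < r)%N ->
          hom_nonzero (W i) (W i.+1) \/ hom_nonzero (W i.+1) (W i)].

End Linkage.

Section Affine.
Variables (F : numClosedFieldType) (G : simpleLie F).

(* The affine algebra is the toroidal algebra in one variable, so that
   h_aff = htor G 1 = h_fin + C K_1 + C d_1. *)
Definition affweight : vectType F := weight G 1.

Definition hK1 : htor G 1 := (0, const_mx 1, 0).
Definition hd1 : htor G 1 := (0, 0, const_mx 1).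

(* The index ord_max stands for the affine node. *)
Definition aff_coroot (j : 'I_(rank G).+1) : htor G 1 :=
  if unlift ord_max j is Some j' then (coroot (alpha j'), 0, 0)
  else hK1 - (coroot (theta G), 0, 0).

Definition fundamental_weight (i : 'I_(rank G).+1) (L : affweight) : Prop :=
  (forall j, L (aff_coroot j) = (i == j)%:R) /\ L hd1 = 0.

Definition is_delta1 (d : affweight) : Prop :=
  [/\ forall H : subvs_of (hfin G), d (H, 0, 0) = 0, d hK1 = 0 & d hd1 = 1].

Definition Paff_plus (lambda : affweight) : Prop :=
  exists (L : 'I_(rank G).+1 -> affweight) (d : affweight)
         (c : 'I_(rank G).+1 -> nat) (z : F),
    [/\ forall i, fundamental_weight i (L i), is_delta1 d &
        lambda = \sum_i L i *+ c i + z *: d].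

Definition positive_root (b : dual (hfin G)) : Prop :=
  is_root b /\ exists c : 'I_(rank G) -> nat, b = \sum_i alpha i *+ c i.

Definition highest_weight_vector (lambda : affweight) (X : torModule G 1)
    (v : X) : Prop :=
  [/\ v != 0, in_weight_space lambda v,
      forall (x : G) (m : 'rV[int]_1), 0 < m 0 0 -> act (Loop x m) v = 0 &
      forall (b : dual (hfin G)) (x : G),
        positive_root b -> in_root_space b x -> act (Loop x 0) v = 0].

(* X is a copy of X(lambda), with highest weight vector v. *)
Definition is_Xlambda (lambda : affweight) (X : torModule G 1) (v : X) :
    Prop :=
  [/\ irreducible X, integrable X, highest_weight_vector lambda v &
      cyclic v = setT].

End Affine.

Section TensorProduct.
Variables (F : fieldType) (I : finType) (X : I -> lmodType F).

Definition multilinear (U : lmodType F) (b : (forall i, X i) -> U) : Prop :=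
  forall (x : forall i, X i) i, linear (fun y : X i => b (dfwith x y)).

Definition is_tensor_product (W : lmodType F) (t : (forall i, X i) -> W) :
    Prop :=
  multilinear t /\
  forall (U : lmodType F) (b : (forall i, X i) -> U), multilinear b ->
    (exists f : {linear W -> U}, forall x, f (t x) = b x) /\
    (forall f f' : {linear W -> U}, (forall x, f (t x) = b x) ->
       (forall x, f' (t x) = b x) -> f =1 f').

End TensorProduct.

Section SimpleModules.
Variables (F : numClosedFieldType) (G : simpleLie F) (k : nat).

(* By the Nullstellensatz, the maximal ideals of C[t_2^+-1, ..., t_(k+1)^+-1]
   are the points of C^k with nonzero coordinates. *)
Definition torus : Type := {M : 'rV[F]_k | [forall i, M 0 i != 0]}.
HB.instance Definition _ := Choice.on torus.

(* evaluation of t^m at the point M *)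
Definition ev (M : torus) (m : 'rV[int]_k) : F :=
  \prod_i (val M 0 i) ^ (m 0 i).

(* the exponents of t_2, ..., t_(k+1) *)
Definition tail_exp (m : 'rV[int]_k.+1) : 'rV[int]_k :=
  \row_j m 0 (lift ord0 j).

Definition weight_map := {fsfun torus -> affweight G with 0}.

Definition in_Pi (pi : weight_map) : Prop := forall M, Paff_plus (pi M).

Definition typeII (pi : weight_map) : Prop :=
  exists2 M : torus, M \in finsupp pi &
    dual_form (@form F G) (theta G) (theta G) <= pi M (hK1 G).

(* A realization of the modules X_pi and L(X_pi). Its ingredients X(pi(M)),
   tensor product and X_pi (x) C[t_2^+-1, ..., t_(k+1)^+-1] are determined up
   to isomorphism.
   - Xfac M is X(pi(M)), with highest weight vector vfac M;
   - Xtens is the space of X_pi and tens the map sending a family of vectors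
     to its tensor product;
   - xact Y m is the action of Y (x) t^m on X_pi; for Y = d_1, only m = 0 is
     meaningful, as the action of d_1;
   - Lmod is L(X_pi), and mono g w is w (x) t^g. *)
Record realization (pi : weight_map) := Realization {
  Xfac : finsupp pi -> torModule G 1;
  vfac : forall M, Xfac M;
  XfacP : forall M : finsupp pi, is_Xlambda (pi (val M)) (vfac M);
  Xtens : lmodType F;
  tens : (forall M, Xfac M) -> Xtens;
  tensP : is_tensor_product tens;
  xact : tor_gen G 1 -> 'rV[int]_k -> {linear Xtens -> Xtens};
  xactP : forall Y m (x : forall M, Xfac M),
    xact Y m (tens x) =
      \sum_M ev (val M) m *: tens (dfwith x (act Y (x M)));
  Lmod : torModule G k.+1;
  mono : 'rV[int]_k -> {linear Xtens -> Lmod};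
  mono_span : forall y : Lmod, exists (s : seq 'rV[int]_k) (w : 'rV[int]_k -> Xtens),
    y = \sum_(g <- s) mono g (w g);
  mono_free : forall (s : seq 'rV[int]_k) (w : 'rV[int]_k -> Xtens), uniq s ->
    \sum_(g <- s) mono g (w g) = 0 -> forall g, g \in s -> w g = 0;
  Lmod_loop : forall (x : G) (m : 'rV[int]_k.+1) g w,
    act (Loop x m) (mono g w) =
      mono (g + tail_exp m)
           (xact (Loop x (const_mx (m 0 ord0))) (tail_exp m) w);
  Lmod_central1 : forall (m : 'rV[int]_k.+1) g w,
    act (Central m ord0) (mono g w) =
      if m 0 ord0 == 0
      then mono (g + tail_exp m) (xact (Central 0 ord0) (tail_exp m) w) else 0;
  Lmod_central : forall (m : 'rV[int]_k.+1) (i : 'I_k) g w,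
    act (Central m (lift ord0 i)) (mono g w) = 0;
  Lmod_deg1 : forall g w,
    act (Deg ord0) (mono g w) = mono g (xact (Deg ord0) 0 w);
  Lmod_deg : forall (i : 'I_k) (g : 'rV[int]_k) w,
    act (Deg (lift ord0 i)) (mono g w) = (g 0 i)%:~R *: mono g w
}.

(* The module generated by v_pi (x) t^g; g is meant to satisfy g_1 = 0. *)
Definition Xpi (pi : weight_map) (D : realization pi) (g : 'rV[int]_k.+1) :
    torModule G k.+1 :=
  cyclic_module (mono D (tail_exp g) (tens (vfac D))).

End SimpleModules.

(* Main.v *)
From HB Require Import structures.
Require Import Defs.
From mathcomp Require Import all_boot all_order all_algebra.
From mathcomp Require Import perm finmap.
From mathcomp Require Import boolp classical_sets functions reals complex.
From mathcomp Require Import zify ring.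

(* Let [s' = r - s] and let [c(m) = sum_M pi(M)(K_1) M^m] be the scalar by which
   [t^m K_1] maps the line of [v_pi t^g] to that of [v_pi t^(g + m)]. If [c(s')]
   is nonzero, then [X_pi^r] is a submodule of [X_pi^s]. Otherwise deform the
   evaluation point [M_0] of the support at which the level is positive along
   [s'], to first order: over the dual numbers [C[tau]], let [t^m] act on the
   factor of [M_0] by [M_0^m (1 + tau <s', m>)]. In the resulting loop module,
   which contains the undeformed one as the image of [tau], the submodule [V]
   generated by [v_pi t^s] maps onto [X_pi^s] by [tau], and it contains [X_pi^r],
   because [t^(s') K_1] sends [v_pi t^s] to [tau v_pi t^r] times
   [pi(M_0)(K_1) M_0^(s') <s', s'>], which is nonzero. The weight space of the
   generator of [V] is [C[tau]] times that generator, so that [V] is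
   indecomposable. Finite length holds because the lattice of monomials modulo
   the periods of a lowest submodule is finite, and a nonzero submodule of the
   undeformed loop module contains some [v_pi t^g]. *)

Set Implicit Arguments.
Unset Strict Implicit.
Unset Printing Implicit Defensive.

Import Order.TTheory GRing.Theory Num.Theory.

Local Open Scope ring_scope.

(** Structure theory has to be rebuilt from weak definitions: a Cartan subalgebra is only nilpotent
    and self-normalizing, and positivity of the form on roots is not given. Semisimplicity of [hfin]
    on [G] is read off from a diagonalizable module of nonzero level, on which [G] acts faithfully.
    Simply laced type serves to prove (theta|theta) > 0. This turns the type condition into a
    nonzero level at M_0 and, through the sl2-triple of theta, makes every level a natural number,
    so that the levels cannot cancel in c(0). That c(0) is nonzero is used twice: power sums of the
    characters then give periods in every direction, and c(s') = 0 forces s' to be nonzero.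
    Deforming along s' itself makes the first-order term a sum of squares of integers. In place of
    the PBW theorem and of bases of tensor products, the arguments use the grading operator
    [rho_check] + C d_1, whose eigenspaces on [X_pi] are finite-dimensional, the top one being the
    line of the highest weight vector. *)

Lemma linear_pack (F : fieldType) (U V : lmodType F) (f : U -> V) :
  linear f -> {g : {linear U -> V} | f = g}.
Proof.
by move=> lf; exists (HB.pack_for {linear U -> V} f (GRing.isLinear.Build F U V _ f lf)).
Qed.

(** * Subspaces as predicates, spans and joint eigenvector decompositions *)

Section LinClosed.
Variables (F : fieldType) (V : lmodType F).
Implicit Types (N : V -> Prop) (s : seq V).

(** Subspaces are kept as predicates because the ambient spaces are infinite-dimensional; a
    [submodule] gives one by forgetting its last clause. *)
Definition lin_closed N :=
  N 0 /\ forall a u v, N u -> N v -> N (a *: u + v).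

Lemma lin_closedD N u v : lin_closed N -> N u -> N v -> N (u + v).
Proof. by move=> [_ h] Nu Nv; rewrite -[u]scale1r; apply: h. Qed.

Lemma lin_closedZ N a u : lin_closed N -> N u -> N (a *: u).
Proof. by move=> [N0 h] Nu; rewrite -[_ *: u]addr0; apply: h. Qed.

Lemma lin_closedN N u : lin_closed N -> N u -> N (- u).
Proof. by move=> cN Nu; rewrite -scaleN1r; apply: lin_closedZ. Qed.

Lemma lin_closedB N u v : lin_closed N -> N u -> N v -> N (u - v).
Proof. by move=> cN Nu Nv; apply: lin_closedD => //; apply: lin_closedN. Qed.

Lemma lin_closed_sum N (J : eqType) (r : seq J) (P : pred J) (f : J -> V) :
  lin_closed N -> (forall j, j \in r -> P j -> N (f j)) ->
  N (\sum_(j <- r | P j) f j).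
Proof.
move=> cN Nf; rewrite big_seq_cond; elim/big_ind: _ => //.
- by case: cN.
- by move=> u v; apply: lin_closedD.
- by move=> j /andP[jr Pj]; apply: Nf.
Qed.

(** Induction on the list of indices. For k other than the head k0 some [T j] tells k from k0; then
    [T j] minus the scalar [mu k0 j] kills the head summand and multiplies the k-th one by a nonzero
    factor, so the induction hypothesis for the rescaled family gives [N (w k)]. The head is what
    remains after subtraction. This is how submodules are shown to contain the weight components of
    their elements. *)
Lemma eigen_components (K : eqType) (J : Type) (T : J -> V -> V) N
    (r : seq K) (w : K -> V) (mu : K -> J -> F) :
  lin_closed N -> (forall j, linear (T j)) -> (forall j v, N v -> N (T j v)) ->
  uniq r -> (forall k j, k \in r -> T j (w k) = mu k j *: w k) ->
  (forall k k', k \in r -> k' \in r -> k != k' -> exists j, mu k j != mu k' j) ->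
  N (\sum_(k <- r) w k) -> forall k, k \in r -> N (w k).
Proof.
move=> cN linT NT; elim: r w => [//|k0 r IH] w /= /andP[k0r ur] Tw dist Ns.
have Nr k : k \in r -> N (w k).
  move=> kr.
  have [|||j ne] := dist k k0.
  - by rewrite in_cons kr orbT.
  - by rewrite mem_head.
  - by apply: contraNneq k0r => <-.
  suff: N ((mu k j - mu k0 j) *: w k).
    move/(lin_closedZ (mu k j - mu k0 j)^-1 cN).
    by rewrite scalerA mulVf ?scale1r // subr_eq0.
  pose w' l := (mu l j - mu k0 j) *: w l.
  apply: (IH w') => //.
  - move=> l i lr; rewrite /w'; have := Tw l i; have [g ->] := linear_pack (linT i).
    by rewrite in_cons lr orbT linearZ /= => /(_ isT) ->; rewrite !scalerA mulrC.
  - by move=> l l' lr l'r; apply: dist; rewrite in_cons ?lr ?l'r orbT.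
  have := lin_closedB cN (NT j _ Ns) (lin_closedZ (mu k0 j) cN Ns).
  have Twj l : l \in k0 :: r -> T j (w l) = mu l j *: w l by move/Tw.
  have [g gE] := linear_pack (linT j); rewrite gE in Twj *.
  rewrite linear_sum scaler_sumr -sumrB big_cons Twj ?mem_head // subrr add0r.
  rewrite (eq_big_seq w') // => l lr.
  by rewrite Twj ?in_cons ?lr ?orbT // /w' scalerBl.
move=> k; rewrite in_cons => /predU1P[->|]; last exact: Nr.
have := lin_closedB cN Ns (@lin_closed_sum N _ r xpredT w cN (fun j jr _ => Nr j jr)).
by rewrite big_cons addrK.
Qed.

Inductive lspan (B : V -> Prop) : V -> Prop :=
| lspan0 : lspan B 0
| lspanD a u v : B u -> lspan B v -> lspan B (a *: u + v).

Lemma lspan_closed B : lin_closed (lspan B).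
Proof.
split; first exact: lspan0.
move=> a u v; elim=> [|b w u' Bw _ IH] sv; first by rewrite scaler0 add0r.
by rewrite scalerDr -addrA scalerA; apply: lspanD => //; apply: IH.
Qed.

Lemma lspan_in (B : V -> Prop) u : B u -> lspan B u.
Proof.
by move=> Bu; rewrite -[u]addr0 -[u]scale1r; apply: lspanD => //; apply: lspan0.
Qed.

Lemma lspan_min (B N : V -> Prop) : lin_closed N -> (forall u, B u -> N u) ->
  forall u, lspan B u -> N u.
Proof. by move=> [N0 cN] BN u; elim=> // a w v Bw _ Nv; apply: cN => //; apply: BN. Qed.

Lemma lspan_mono (B B' : V -> Prop) u :
  (forall v, B v -> B' v) -> lspan B u -> lspan B' u.
Proof.
move=> BB'; apply: lspan_min; first exact: lspan_closed.
by move=> v /BB' /lspan_in.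
Qed.

Definition spanby s : V -> Prop := lspan (fun v => v \in s).

Lemma spanby_coef s v :
  spanby s v -> exists c : 'I_(size s) -> F, v = \sum_i c i *: s`_i.
Proof.
elim=> [|a u w us _ [c ->]].
  by exists (fun=> 0); rewrite big1 // => i _; rewrite scale0r.
have lt : (index u s < size s)%N by rewrite index_mem.
exists (fun i => (if i == Ordinal lt then a else 0) + c i).
under [RHS]eq_bigr do rewrite scalerDl.
rewrite big_split /=; congr (_ + _).
rewrite (bigD1 (Ordinal lt)) //= eqxx nth_index // big1 ?addr0 // => i /negPf ->.
by rewrite scale0r.
Qed.

Lemma spanby_nil v : spanby [::] v -> v = 0.
Proof. by elim=> // a u w; rewrite in_nil. Qed.

Lemma spanby_cons e s v : spanby (e :: s) v ->
  exists a u, spanby s u /\ v = a *: e + u.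
Proof.
elim=> [|b u w us _ [a [x [sx ->]]]].
  by exists 0, 0; rewrite scale0r addr0; split => //; apply: lspan0.
move: us; rewrite in_cons => /predU1P[->|us].
  by exists (b + a), x; rewrite scalerDl addrA.
exists a, (b *: u + x); split; first exact: lspanD.
by rewrite addrCA.
Qed.

End LinClosed.

Lemma lspan_image (F : fieldType) (U V : lmodType F) (f : {linear U -> V})
    (B : U -> Prop) (B' : V -> Prop) u :
  (forall u, B u -> lspan B' (f u)) -> lspan B u -> lspan B' (f u).
Proof.
move=> h; apply: (lspan_min (N := fun u => lspan B' (f u))) => //.
have [c0 c1] := lspan_closed B'.
split; first by rewrite linear0.
by move=> a x y hx hy; rewrite linearP; apply: c1.
Qed.

(** Elimination along [s]: if the head [e] is needed, some [u0] in [P] has an image with nonzero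
    coefficient on [e], and subtracting multiples of [u0] reduces to the vectors of [P] that are
    mapped into the span of the tail. *)
Lemma spanby_preim (F : fieldType) (U V : lmodType F) (f : {linear U -> V})
    (P : U -> Prop) (s : seq V) :
  injective f -> lin_closed P -> (forall u, P u -> spanby s (f u)) ->
  exists s' : seq U, forall u, P u -> spanby s' u.
Proof.
move=> injf; elim: s P => [|e s IH] P cP Ps.
  exists [::] => u /Ps /spanby_nil; rewrite -[RHS](linear0 f) => /injf ->.
  exact: lspan0.
have [all|nall] := pselect (forall u, P u -> spanby s (f u)); first exact: IH.
have [u0 Pu0 nu0] : exists2 u0, P u0 & ~ spanby s (f u0).
  apply: contrapT => h; apply: nall => u Pu; apply: contrapT => hs.
  by apply: h; exists u.
have [a [x [sx fu0]]] := spanby_cons (Ps _ Pu0).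
have a0 : a != 0 by apply/eqP=> a0; apply: nu0; rewrite fu0 a0 scale0r add0r.
have [||s' hs'] := IH (fun u => P u /\ spanby s (f u)).
- have [c0 c1] := cP; have [d0 d1] := lspan_closed (fun v => v \in s).
  split; first by rewrite linear0.
  by move=> b u v [Pu fu] [Pv fv]; rewrite linearP; split; [apply: c1|apply: d1].
- by move=> u [].
exists (u0 :: s') => u Pu.
have [b [y [sy fu]]] := spanby_cons (Ps _ Pu).
rewrite -[u](subrK ((b / a) *: u0)) addrC; apply: lspanD; first exact: mem_head.
apply: (@lspan_mono _ _ (fun v => v \in s')) => [v vs'|].
  by rewrite in_cons vs' orbT.
apply: hs'; split; first by apply: lin_closedB => //; apply: lin_closedZ.
rewrite linearB linearZ /= fu fu0 scalerDr scalerA divfK //.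
rewrite opprD addrACA subrr add0r.
by apply: lin_closedB => //; first exact: lspan_closed;
  apply: lin_closedZ => //; exact: lspan_closed.
Qed.

(** * Semisimple elements and the invariant form *)

Section GeneralizedEigenvectors.
Variables (F : numClosedFieldType).

Definition shift_op (V : lmodType F) (T : V -> V) (a : F) (y : V) : V :=
  T y - a *: y.

Lemma shift_op_linear (V : lmodType F) (T : {linear V -> V}) a :
  linear (shift_op T a).
Proof.
move=> b u v; rewrite /shift_op linearP scalerDr scalerBr !scalerA (mulrC a b).
by rewrite opprD addrACA.
Qed.

Definition shifts (V : lmodType F) (T : V -> V) : seq F -> V -> V :=
  fix loop s x := if s is a :: s' then loop s' (shift_op T a x) else x.

(** The first dim + 1 iterates of [T] on [x] are linearly dependent, which gives a nonzero
    polynomial p with p(T) x = 0. It splits over the closed field, and [s] lists its roots. *)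
Lemma annihilated (V : vectType F) (T : {linear V -> V}) x :
  exists s : seq F, shifts T s x = 0.
Proof.
(* This is p(T) applied to y. *)
pose ev (p : {poly F}) y := \sum_(i < size p) p`_i *: iter i T y.
have evE n (p : {poly F}) y : (size p <= n)%N -> ev p y = \sum_(i < n) p`_i *: iter i T y.
  move=> le; rewrite /ev (big_ord_widen n (fun i => p`_i *: iter i T y)) //.
  rewrite big_mkcond; apply: eq_bigr => i _; case: ltnP => // h.
  by rewrite nth_default // scale0r.
have evX (q : {poly F}) a y : ev (q * ('X - a%:P)) y = ev q (shift_op T a y).
  have le : (size (q * ('X - a%:P))%R <= (size q).+1)%N.
    apply: leq_trans (size_polyMleq _ _) _.
    by rewrite size_XsubC addn2.
  rewrite (evE _ _ _ le) mulrBr.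
  under eq_bigr do rewrite coefB coefMX coefMC scalerBl.
  rewrite sumrB big_ord_recl /= scale0r add0r [X in _ - X]big_ord_recr /=.
  rewrite [q`_(size q)]nth_default // mul0r scale0r addr0 -sumrB.
  apply: eq_bigr => i _; rewrite add0n -scalerA -scalerBr.
  congr (_ *: _); elim: (nat_of_ord i) => [|m IH] //=.
  by rewrite -IH linearB [T (_ *: _)]linearZ.
pose n := \dim (fullv : {vspace V}).
have nf : ~~ free [tuple iter i T x | i < n.+1].
  apply/negP => fr.
  have := dimvS (subvf <<[tuple iter i T x | i < n.+1]>>%VS).
  by move: fr; rewrite /free => /eqP ->; rewrite size_tuple ltnn.
have [c c0 [i ci]] : exists2 c : 'I_n.+1 -> F,
    \sum_i c i *: iter i T x = 0 & exists i, c i != 0.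
  move/negP: nf => nf; apply: contrapT => h; apply: nf; apply/freeP => c hc i.
  apply/eqP/negPn/negP => ci; apply: h; exists c; last by exists i.
  by rewrite -[RHS]hc; apply: eq_bigr => j _; rewrite -tnth_nth tnth_mktuple.
pose p := \poly_(j < n.+1) c (inord j).
have p0 : p != 0.
  apply/eqP => /(congr1 (fun q : {poly F} => q`_i)); rewrite coef_poly coef0.
  by rewrite ltn_ord inord_val; apply/eqP.
have evp : ev p x = 0.
  rewrite (evE n.+1) ?size_poly // -[RHS]c0; apply: eq_bigr => j _.
  by rewrite coef_poly ltn_ord inord_val.
have [r pr] := closed_field_poly_normal p.
have evr (b : F) : ev (b *: \prod_(z <- r) ('X - z%:P)) x = b *: shifts T r x.
  elim: r x b {pr evp nf c0} => [|a r IH] x b /=.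
    rewrite big_nil (evE 1%N) ?alg_polyC ?size_polyC_leq1 //.
    by rewrite big_ord1 coefC.
  by rewrite big_cons mulrC scalerAl evX IH.
exists r; apply/eqP; move/eqP: evp; rewrite pr evr scaler_eq0 lead_coef_eq0.
by rewrite (negPf p0).
Qed.

Section Decomposition.
Variables (V : lmodType F) (T : {linear V -> V}).

Definition gen_eigen (a : F) (y : V) := exists n, iter n (shift_op T a) y = 0.

Lemma iter_shift_linear n a : linear (iter n (shift_op T a)).
Proof.
elim: n => [|n IH] b u v //=.
by rewrite IH; have [g ->] := linear_pack (shift_op_linear T a); rewrite linearP.
Qed.

Lemma iter_shift0 n a : iter n (shift_op T a) 0 = 0.
Proof. by have [g ->] := linear_pack (iter_shift_linear n a); rewrite linear0. Qed.

Lemma gen_eigen_closed a : lin_closed (gen_eigen a).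
Proof.
split; first by exists 0%N.
move=> b u v [n hn] [m hm]; exists (n + m)%N.
rewrite iter_shift_linear [in X in X + _]addnC !iterD hn hm !iter_shift0.
by rewrite scaler0 addr0.
Qed.

Lemma shift_op_closed (S : V -> Prop) a y : lin_closed S ->
  (forall y, S y -> S (T y)) -> S y -> S (shift_op T a y).
Proof. by move=> cS ST Sy; apply: lin_closedB; auto; apply: lin_closedZ. Qed.

(** T - a is onto the generalized b-eigenspace. If (T - b) y = (T - a) z by induction, then (T - a)
    (y - z) = (T - a) y - (T - b) y = (b - a) y, so (y - z) / (b - a) is the preimage. *)
Lemma gen_eigen_inv (S : V -> Prop) a b y : lin_closed S ->
  (forall y, S y -> S (T y)) -> a != b -> S y -> gen_eigen b y ->
  exists z, [/\ S z, gen_eigen b z & y = shift_op T a z].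
Proof.
move=> cS ST ab + [n]; elim: n y => [|n IH] y Sy.
  move=> /= ->; exists 0; split; [by case: cS | by exists 0%N |].
  by rewrite /shift_op linear0 scaler0 subr0.
rewrite iterSr => hn.
have [z [Sz gz zE]] := IH _ (shift_op_closed b cS ST Sy) hn.
have gy : gen_eigen b y by exists n.+1; rewrite iterSr.
have cb : lin_closed (gen_eigen b) := gen_eigen_closed b.
exists ((b - a)^-1 *: (y - z)); split.
- by apply: lin_closedZ => //; apply: lin_closedB.
- by apply: lin_closedZ => //; apply: lin_closedB.
have [g gE] := linear_pack (shift_op_linear T a); rewrite gE in zE *.
rewrite linearZ linearB /= -zE -gE /shift_op opprB [X in _ *: X]addrC subrKA.
rewrite -scalerBl scalerA mulVf ?scale1r //.
by rewrite subr_eq0 eq_sym.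
Qed.

(** Decompose (T - a) x by induction. Its parts with eigenvalue other than a are images under T - a
    of generalized eigenvectors; once these are subtracted from x, the remainder is sent by T - a
    into the generalized a-eigenspace and therefore lies in it. *)
Lemma gen_eigen_decomposition (S : V -> Prop) (s : seq F) x : lin_closed S ->
  (forall y, S y -> S (T y)) -> S x -> shifts T s x = 0 ->
  exists2 ps : seq (F * V), x = \sum_(p <- ps) p.2 &
    forall p, p \in ps -> S p.2 /\ gen_eigen p.1 p.2.
Proof.
move=> cS ST; elim: s x => [|a s IH] x Sx /=.
  by move=> ->; exists [::]; rewrite ?big_nil.
move=> /IH[|ps xE psP]; first exact: shift_op_closed.
have [g gE] := linear_pack (shift_op_linear T a).
have [qs qE qsP] : exists2 qs : seq (F * V),
    shift_op T a (\sum_(p <- qs) p.2) = \sum_(p <- ps | p.1 != a) p.2 &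
    forall p, p \in qs -> S p.2 /\ gen_eigen p.1 p.2.
  elim: ps {xE} psP => [|[b y] ps IHps] psP.
    by exists [::]; rewrite ?big_nil // gE linear0.
  have [|qs qE qsP] := IHps; first by move=> p pps; apply: psP; rewrite in_cons pps orbT.
  rewrite big_cons /=; have [_|ba] := eqVneq b a; first by exists qs.
  have [Sy gy] := psP _ (mem_head _ _).
  have [|z [Sz gz yE]] := gen_eigen_inv cS ST _ Sy gy (a := a).
    by rewrite eq_sym.
  exists ((b, z) :: qs); first by rewrite big_cons -qE gE linearD -gE /= -yE.
  by move=> p; rewrite in_cons => /predU1P[->|/qsP].
pose z := x - \sum_(p <- qs) p.2.
exists ((a, z) :: qs); first by rewrite big_cons /= /z subrK.
move=> p; rewrite in_cons => /predU1P[-> /=|/qsP //]; split.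
  apply: lin_closedB => //.
  by apply: lin_closed_sum => // q /qsP[].
have : gen_eigen a (shift_op T a z).
  rewrite /z gE linearB -gE qE xE.
  rewrite [X in X - _](bigID (fun p => p.1 == a)) /= addrK.
  apply: lin_closed_sum; first exact: gen_eigen_closed.
  by move=> q /psP[_ +] /eqP <-.
by case=> n hn; exists n.+1; rewrite iterSr.
Qed.

Lemma gen_eigen_last a (S : V -> Prop) y : lin_closed S ->
  (forall y, S y -> S (T y)) -> S y -> gen_eigen a y -> y != 0 ->
  exists z, [/\ S z, z != 0 & T z = a *: z].
Proof.
move=> cS ST + [n]; elim: n y => [|n IH] y Sy.
  by move=> /= ->; rewrite eqxx.
rewrite iterSr; have [e|ne] := eqVneq (shift_op T a y) 0.
  by move=> _ y0; exists y; split=> //; apply/eqP; rewrite -subr_eq0; apply/eqP.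
by move=> hn _; apply: (IH _ (shift_op_closed a cS ST Sy)).
Qed.

Lemma gen_eigen_strict a y :
  (forall z, shift_op T a (shift_op T a z) = 0 -> shift_op T a z = 0) ->
  gen_eigen a y -> T y = a *: y.
Proof.
move=> h [n hn]; apply/eqP; rewrite -subr_eq0; apply/eqP; rewrite -/(shift_op T a y).
elim: n y hn => [|n IH] y /=; first by move=> ->; apply: h; rewrite /=
  -[LHS]/(iter 2 (shift_op T a) 0) iter_shift0.
by rewrite -iterS iterSr => /IH /h.
Qed.

End Decomposition.

Lemma gen_eigen_decompositionV (V : vectType F) (T : {linear V -> V})
    (S : V -> Prop) x : lin_closed S -> (forall y, S y -> S (T y)) -> S x ->
  exists2 ps : seq (F * V), x = \sum_(p <- ps) p.2 &
    forall p, p \in ps -> S p.2 /\ gen_eigen T p.1 p.2.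
Proof.
move=> cS ST Sx; have [s hs] := annihilated T x.
exact: gen_eigen_decomposition hs.
Qed.

End GeneralizedEigenvectors.

(** * Brackets, simple roots and heights *)

Section LieBasics.
Variables (F : fieldType) (L : finLieType F).
Implicit Types x y z : L.

HB.instance Definition _ x := GRing.isLinear.Build F L L _ (lie x) (lie_linearr x).

Lemma lieDl x y z : lie (x + y) z = lie x z + lie y z.
Proof. by have [g gE] := linear_pack (lie_linearl z);
  rewrite -[LHS]/((lie^~ z) (x + y)) gE linearD -gE. Qed.

Lemma lieZl a x z : lie (a *: x) z = a *: lie x z.
Proof. by have [g gE] := linear_pack (lie_linearl z);
  rewrite -[LHS]/((lie^~ z) (a *: x)) gE linearZ -gE. Qed.

Lemma lie0l z : lie 0 z = 0.
Proof. by rewrite -[0 in LHS](scale0r 0) lieZl scale0r. Qed.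

Lemma lieC x y : lie x y = - lie y x.
Proof.
apply/eqP; rewrite -addr_eq0; apply/eqP.
have := lie_xx (x + y); rewrite lieDl !linearD /= !lie_xx add0r addr0.
by [].
Qed.

Lemma lie_derivation x y z : lie x (lie y z) = lie (lie x y) z + lie y (lie x z).
Proof.
have := lie_jacobi x y z; rewrite (lieC z x) linearN /= (lieC z (lie x y)).
by move/eqP; rewrite -addrA -opprD subr_eq0 addrC => /eqP.
Qed.

Lemma mem_lie_vspace (U W : {vspace L}) x y :
  x \in U -> y \in W -> lie x y \in lie_vspace U W.
Proof.
move=> xU yW; rewrite (coord_vbasis xU) (coord_vbasis yW).
have [g gE] := linear_pack (lie_linearl
  (\sum_(i < \dim W) coord (vbasis W) i y *: (vbasis W)`_i)).
rewrite -[lie _ _]/((lie^~ _) _) gE linear_sum; apply: memv_suml => i _.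
rewrite linearZ /= -gE linear_sum; apply/memvZ/memv_suml => j _.
rewrite linearZ; apply/memvZ/memv_span/allpairsP.
by exists ((vbasis U)`_i, (vbasis W)`_j); rewrite /= !mem_nth ?size_tuple.
Qed.

End LieBasics.

Lemma dual_separates (F : fieldType) (L : finLieType F) (h : {vspace L})
  (K : subvs_of h) : (forall a : dual h, a K = 0) -> K = 0.
Proof.
move=> h0; rewrite (coord_vbasis (memvf K)) big1 // => i _.
pose f (X : subvs_of h) : F^o := coord (vbasis (fullv : {vspace subvs_of h})) i X.
have lf : linear f by move=> a u v; rewrite /f linearP.
have [g gE] := linear_pack lf.
by have := h0 (linfun g); rewrite lfunE -gE /f => ->; rewrite scale0r.
Qed.

Section Structure.
Variables (F : numClosedFieldType) (G : simpleLie F).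
Local Notation h := (hfin G).
Local Notation B := (@Defs.form F G).

Lemma alpha_separates (K : subvs_of h) : (forall i, alpha i K = 0) -> K = 0.
Proof.
have [_ /andP[/eqP sp _] _] := alpha_base G => hK; apply: dual_separates => a.
have : a \in fullv by rewrite memvf.
rewrite -sp => /coord_span ->; rewrite sum_lfunE big1 // => i _.
by rewrite scale_lfunE -tnth_nth tnth_mktuple hK scaler0.
Qed.

(** The bracket of H and K lies in [h] and acts on a root vector of a simple root as the commutator
    of two scalars, hence by 0. All simple roots vanish on it, and they separate the points of
    [h]. *)
Lemma hfin_abelian (H K : subvs_of h) : lie (vsval H) (vsval K) = 0.
Proof.
have [sub _ _] := hfin_cartan G.
have HKh : lie (vsval H) (vsval K) \in h.
  by apply: (subvP sub); apply: mem_lie_vspace; apply: subvsP.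
have -> : lie (vsval H) (vsval K) = vsval (vsproj h (lie (vsval H) (vsval K))).
  by rewrite vsprojK.
have -> : vsproj h (lie (vsval H) (vsval K)) = 0; last by rewrite linear0.
apply: alpha_separates => i; have [rt _ _] := alpha_base G.
have [_ [x x0 xa]] := rt i; have := xa (vsproj h (lie (vsval H) (vsval K))).
rewrite vsprojK // => e.
have := lie_derivation (vsval H) (vsval K) x.
rewrite e !xa !linearZ /= !xa !scalerA mulrC -[X in X = _]add0r => /addIr/esym/eqP.
by rewrite scaler_eq0 (negPf x0) orbF => /eqP.
Qed.

Lemma hfin_abelian_in x y : x \in h -> y \in h -> lie x y = 0.
Proof.
by move=> xh yh; rewrite -(vsprojK xh) -(vsprojK yh) hfin_abelian.
Qed.

(** The simple roots form a basis of the dual, so evaluating them embeds [h] into the row vectors;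
    equality of dimensions makes this map onto. *)
Lemma hfin_coweight (c : 'I_(rank G) -> F) :
  exists H : subvs_of h, forall i, alpha i H = c i.
Proof.
pose f (K : subvs_of h) : 'rV[F]_(rank G) := \row_i alpha i K.
have lf : linear f by move=> a u v; apply/rowP => i; rewrite !mxE linearP.
have [g gE] := linear_pack lf.
have injg : lker (linfun g) == 0%VS.
  apply/lker0P => u v; rewrite !lfunE -gE => /rowP e.
  apply/eqP; rewrite -subr_eq0; apply/eqP/alpha_separates => i.
  by have := e i; rewrite !mxE linearB /= => ->; rewrite subrr.
have [_ bas _] := alpha_base G.
have sz : \dim (fullv : {vspace dual h}) = rank G.
  exact: (size_basis bas).
have dh : \dim (fullv : {vspace subvs_of h}) = rank G.
  by move: sz; rewrite !dimvf /dim /= muln1.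
have : (limg (linfun g) == fullv)%VS.
  rewrite eqEdim subvf /= limg_dim_eq; last by rewrite (eqP injg) capv0.
  by rewrite dh dimvf /dim /= mul1n.
move/eqP => im; have : \row_i c i \in limg (linfun g) by rewrite im memvf.
case/memv_imgP => K _; rewrite lfunE -gE => /rowP e; exists K => i.
by have := e i; rewrite !mxE.
Qed.

(** The sum of the fundamental coweights. Its value at a root is the height, a nonzero integer whose
    sign decides positivity, so that one element of [h] separates the zero weight from all roots. *)
Definition rho_check : subvs_of h := projT1 (cid (hfin_coweight (fun=> 1))).

Lemma alpha_rho_check i : alpha i rho_check = 1.
Proof. by rewrite /rho_check; case: cid => /=. Qed.

Lemma sum_alpha_rho (c : 'I_(rank G) -> nat) :
  (\sum_i alpha i *+ c i) rho_check = (\sum_i c i)%:R.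
Proof.
rewrite sum_lfunE natr_sum; apply: eq_bigr => i _.
by rewrite -scaler_nat scale_lfunE alpha_rho_check /GRing.scale /= mulr1.
Qed.

Lemma root_height (b : dual h) : is_root b ->
  exists2 e : int, b rho_check = e%:~R & e != 0 /\ (0 < e -> positive_root b).
Proof.
move=> rb; have [_ _ /(_ b rb) [c bE]] := alpha_base G; have [b0 _] := rb.
have cn0 : b rho_check != 0.
  have nz : (\sum_i c i)%N != 0%N.
    apply: contraNneq b0 => /eqP; rewrite sum_nat_eq0 => /forallP h0.
    have s0 : \sum_i alpha i *+ c i = 0 :> dual h.
      by rewrite big1 // => i _; have := h0 i => /= /eqP ->.
    by case: bE => ->; rewrite s0 ?oppr0.
  by case: bE => ->; rewrite ?opp_lfunE ?oppr_eq0 sum_alpha_rho pnatr_eq0.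
case: bE => bE.
  exists (\sum_i c i)%N; first by rewrite bE sum_alpha_rho.
  split; last by move=> _; split=> //; exists c.
  by apply: contraNneq cn0 => e; rewrite bE sum_alpha_rho pmulrn e.
exists (- (\sum_i c i)%N%:Z); first by rewrite bE opp_lfunE sum_alpha_rho rmorphN.
split; last by move=> h0; exfalso; lia.
by apply: contraNneq cn0 => e; rewrite bE opp_lfunE sum_alpha_rho pmulrn -mulrNz e.
Qed.

End Structure.

(** * Positivity of the highest root *)

Section CartanForm.
Variables (F : numClosedFieldType) (G : simpleLie F).
Local Notation h := (hfin G).
Local Notation B := (@Defs.form F G).

Lemma lie_comm_hfin x y z : x \in h -> y \in h ->
  lie x (lie y z) = lie y (lie x z :> G).
Proof. by move=> xh yh; rewrite lie_derivation (hfin_abelian_in xh yh) lie0l add0r. Qed.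

Definition hfin_stable (S : G -> Prop) := forall H x, H \in h -> S x -> S (lie H x).

Lemma eigenspace_closed (S : G -> Prop) H a : lin_closed S ->
  lin_closed (fun z => S z /\ lie H z = a *: z).
Proof.
move=> [S0 Sl]; split; first by rewrite linear0 scaler0.
move=> b u v [Su eu] [Sv ev]; split; first exact: Sl.
by rewrite linearP /= eu ev scalerDr !scalerA mulrC.
Qed.

Lemma eigenspace_stable (S : G -> Prop) H a : hfin_stable S -> H \in h ->
  hfin_stable (fun z => S z /\ lie H z = a *: z).
Proof.
move=> Sh Hh K x Kh [Sx ex]; split; first exact: Sh.
by rewrite lie_comm_hfin // ex linearZ.
Qed.

Lemma joint_eigen_dual y : y != 0 ->
  (forall H, H \in (vbasis h : seq G) -> exists c, lie H y = c *: y) ->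
  exists a : dual h, in_root_space a y.
Proof.
move=> y0 hy.
have hyh (H : subvs_of h) : exists c, lie (vsval H) y = c *: y.
  pose P K := exists c, lie K y = c *: y.
  have cP : lin_closed P.
    split; first by exists 0; rewrite lie0l scale0r.
    move=> b u v [c hc] [d hd]; exists (b * c + d).
    by rewrite lieDl lieZl hc hd scalerDl scalerA.
  rewrite -/(P _) (coord_vbasis (subvsP H)).
  apply: lin_closed_sum => // i _ _; apply: lin_closedZ => //; apply: hy.
  by rewrite mem_nth // size_tuple.
pose c H := projT1 (cid (hyh H)).
have cE H : lie (vsval H) y = c H *: y by rewrite /c; case: cid.
have lc : linear (c : subvs_of h -> F^o).
  move=> a u v; apply/eqP; rewrite -subr_eq0; apply/eqP.
  have : (c (a *: u + v) - (a *: (c u : F^o) + c v)) *: y = 0.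
    rewrite scalerBl -cE scalerDl -[a *: (c u : F^o)]/(a * c u) -scalerA -!cE.
    by rewrite linearP /= lieDl lieZl subrr.
  by move/eqP; rewrite scaler_eq0 (negPf y0) orbF => /eqP.
have [g gE] := linear_pack lc; exists (linfun g) => H.
by rewrite lfunE -gE cE.
Qed.

(** Elements of [h] commute, so an eigenspace of one of them inside [S] is stable under the others;
    the induction runs over a basis of [h]. *)
Lemma common_eigenvector (S : G -> Prop) x : lin_closed S -> hfin_stable S ->
  S x -> x != 0 ->
  exists2 y, S y /\ y != 0 & exists a : dual h, in_root_space a y.
Proof.
move=> cS Sh Sx x0.
have [y [Sy y0 hy]] : exists y, [/\ S y, y != 0 &
    forall H, H \in (vbasis h : seq G) -> exists c, lie H y = c *: y].
  have : {subset (vbasis h : seq G) <= h} by move=> z /vbasis_mem.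
  elim: (vbasis h : seq G) S x cS Sh Sx x0 => [|H l IH] S x cS Sh Sx x0 lh.
    by exists x.
  have Hh : H \in h by apply: lh; rewrite mem_head.
  have [ps xE psP] := gen_eigen_decompositionV (T := lie H) cS (fun y => Sh _ _ Hh) Sx.
  have [p pps p0] : exists2 p, p \in ps & p.2 != 0.
    apply: contrapT => hn; case/eqP: x0; rewrite xE big1_seq // => p /andP[_ pps].
    by apply/eqP/negPn/negP => p0; apply: hn; exists p.
  have [Sp gp] := psP _ pps.
  have [z [Sz z0 ez]] := gen_eigen_last cS (fun y => Sh _ _ Hh) Sp gp p0.
  have [||||y [[Sy ey] y0 hy]] := IH _ z (eigenspace_closed H p.1 cS).
  - exact: eigenspace_stable.
  - by [].
  - by [].
  - by move=> K Kl; apply: lh; rewrite in_cons Kl orbT.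
  by exists y; split=> // K; rewrite in_cons => /predU1P[->|/hy //]; exists p.1.
exists y => //; exact: joint_eigen_dual.
Qed.

(** Before semisimplicity is known, the generalized null space of [rho_check] stands in for the zero
    weight space. It reduces to [h] because [h] acts on it by nilpotent operators and is its own
    normalizer. *)
Lemma zero_gen_eigen_hfin x : gen_eigen (lie (vsval (rho_check G))) 0 x -> x \in h.
Proof.
pose T := lie (vsval (rho_check G)).
have rh : vsval (rho_check G) \in h by apply: subvsP.
pose S := gen_eigen T 0.
have cS : lin_closed S by apply: gen_eigen_closed.
have Sh : hfin_stable S.
  move=> H y Hh [n hn]; exists n.
  have -> : iter n (shift_op T 0) (lie H y) = lie H (iter n (shift_op T 0) y).
    elim: n {hn} => //= n ->; rewrite /shift_op !scale0r !subr0.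
    exact: lie_comm_hfin.
  by rewrite hn linear0.
(* If H had a nonzero eigenvalue on [S], a joint eigenvector there would have a nonzero weight b,
   hence be a root vector; [rho_check] would act on it by the nonzero height of b, against
   membership in [S]. *)
have nil H y : H \in h -> S y -> gen_eigen (lie H) 0 y.
  move=> Hh Sy; have cH := gen_eigen_closed (lie H) 0.
  have [ps -> psP] := gen_eigen_decompositionV (T := lie H) cS (fun y => Sh _ _ Hh) Sy.
  apply: lin_closed_sum => // p /psP[Sp gp] _.
  have [<- //|p1] := eqVneq p.1 0.
  have [->|p2] := eqVneq p.2 0; first by case: cH.
  have [z [Sz z0 ez]] := gen_eigen_last cS (fun y => Sh _ _ Hh) Sp gp p2.
  have [||u [[Su eu] u0] [b bu]] := common_eigenvector (eigenspace_closed H p.1 cS) _ _ z0.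
  - exact: eigenspace_stable.
  - by split.
  have bH : b (vsproj h H) = p.1.
    have := bu (vsproj h H); rewrite vsprojK // eu => /eqP.
    by rewrite -subr_eq0 -scalerBl scaler_eq0 (negPf u0) orbF subr_eq0 => /eqP.
  have b0 : b != 0.
    by apply: contraNneq p1 => b0; rewrite -bH b0 lfunE.
  have [|e be [e0 _]] := root_height (b := b); first by split=> //; exists u.
  case: Su => n.
  have -> : iter n (shift_op T 0) u = b (rho_check G) ^+ n *: u.
    elim: n => [|n IH] /=; first by rewrite expr0 scale1r.
    by rewrite IH /shift_op scale0r subr0 /T linearZ /= bu scalerA exprSr.
  move/eqP; rewrite scaler_eq0 (negPf u0) orbF expf_eq0 be intr_eq0 (negPf e0).
  by rewrite andbF.
move=> Sx; apply: contrapT => xh.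
have [_ _ norm] := hfin_cartan G.
(* Engel's argument: starting outside [h] and applying nilpotent elements of [h] as long as the
   result stays outside leads to a [z] outside [h] that [h] brackets into [h]. Self-normalization
   then gives the contradiction. *)
have [z [Sz zh hz]] : exists z, [/\ S z, z \notin h &
    forall H, H \in (vbasis h : seq G) -> lie H z \in h].
  have : {subset (vbasis h : seq G) <= h} by move=> z /vbasis_mem.
  elim: (vbasis h : seq G) => [|H l IH] lh.
    by exists x; split=> //; apply/negP.
  have [|z [Sz zh hz]] := IH.
    by move=> K Kl; apply: lh; rewrite in_cons Kl orbT.
  have Hh : H \in h by apply: lh; rewrite mem_head.
  have [n hn] := nil H z Hh Sz.
  elim: n z Sz zh hz hn => [|n IHn] z Sz zh hz.
    by move=> /= z0; move: zh; rewrite z0 mem0v.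
  rewrite iterSr => hn.
  have [Hz|Hz] := boolP (lie H z \in h).
    by exists z; split=> // K; rewrite in_cons => /predU1P[->|/hz].
  apply: (IHn (lie H z)) => //; first exact: Sh.
    move=> K Kl; rewrite lie_comm_hfin //; last by apply: lh; rewrite in_cons Kl orbT.
    by rewrite hfin_abelian_in ?mem0v // hz.
  by move: hn; rewrite {2}/shift_op scale0r subr0.
case/negP: zh; apply: norm => y yh; rewrite lieC memvN.
rewrite (coord_vbasis yh).
have [g gE] := linear_pack (lie_linearl z).
rewrite -[lie _ _]/((lie^~ _) _) gE linear_sum; apply: memv_suml => i _.
by rewrite linearZ /= -gE; apply/memvZ/hz; rewrite mem_nth // size_tuple.
Qed.

Lemma formDZr a x y z : B x (a *: y + z) = a * B x y + B x z.
Proof. by have [h1 _ _ _] := Defs.form_invariant G; apply: h1. Qed.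

Lemma formDr x y z : B x (y + z) = B x y + B x z.
Proof. by rewrite -[y]scale1r formDZr mul1r scale1r. Qed.

Lemma form0r x : B x 0 = 0.
Proof. by apply: (addrI (B x 0)); rewrite -formDr !addr0. Qed.

Lemma formZr a x y : B x (a *: y) = a * B x y.
Proof. by rewrite -[_ *: _]addr0 formDZr form0r addr0. Qed.

Lemma formC x y : B x y = B y x.
Proof. by have [_ h2 _ _] := Defs.form_invariant G; apply: h2. Qed.

Lemma form_lie x y z : B (lie x y) z = B x (lie y z).
Proof. by have [_ _ h3 _] := Defs.form_invariant G; apply: h3. Qed.

Lemma form_nondegenerate x : (forall y, B x y = 0) -> x = 0.
Proof. by have [_ _ _ h4] := Defs.form_invariant G; apply: h4. Qed.

(** A generalized eigenvector of [rho_check] with nonzero eigenvalue is a bracket with [rho_check],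
    hence orthogonal to [h] by invariance and commutativity; the eigenvalue 0 contributes only [h].
    A vector of [h] orthogonal to [h] is thus orthogonal to all of [G]. *)
Lemma hfin_form_nondegenerate x : x \in h -> (forall y, y \in h -> B x y = 0) -> x = 0.
Proof.
move=> xh x0; apply: form_nondegenerate => y.
pose T := lie (vsval (rho_check G)).
pose N y := B x y = 0.
have cN : lin_closed N.
  by split; [exact: form0r | move=> a u v; rewrite /N formDZr => -> ->; rewrite mulr0 addr0].
have cT : lin_closed (fun _ : G => True) by [].
have [ps -> psP] := gen_eigen_decompositionV (T := T) cT (fun _ _ => I) (I : (fun=> True) y).
apply: (lin_closed_sum cN) => p /psP[_ gp] _.
have [p0|p0] := eqVneq p.1 0.
  by apply: x0; apply: zero_gen_eigen_hfin; rewrite -p0.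
have p0' : 0 != p.1 by rewrite eq_sym.
have [z [_ _ ->]] := gen_eigen_inv (T := T) cT (fun _ _ => I) p0' I gp.
rewrite /N /shift_op scale0r subr0 -form_lie hfin_abelian_in ?subvsP //.
by rewrite formC form0r.
Qed.

Definition t_ (a : dual h) : G := vsval (dual_elt B a).

(** [dual_elt] is given by a pseudo-inverse, so this property needs the map from [h] to its dual to
    be onto: it is injective by nondegeneracy on [h], and the dimensions agree. *)
Lemma t_P (a : dual h) (H : subvs_of h) : B (t_ a) (vsval H) = a H.
Proof.
pose f1 (K : subvs_of h) (H' : subvs_of h) : F^o := B (vsval K) (vsval H').
have lf1 K : linear (f1 K) by move=> b u v; rewrite /f1 linearP formDZr.
pose f2 (K : subvs_of h) : dual h := linfun (f1 K).
have f2E K H' : f2 K H' = f1 K H'.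
  by rewrite /f2; have [g ->] := linear_pack (lf1 K); rewrite lfunE.
have lf2 : linear f2.
  move=> b u v; apply/lfunP => K; rewrite add_lfunE scale_lfunE !f2E /f1 linearP /=.
  by rewrite formC formDZr !(formC (vsval K)).
have [g gE] := linear_pack lf2.
have nuE : dual_elt B a = ((linfun f2)^-1)%VF a by [].
have injg : lker (linfun g) == 0%VS.
  apply/lker0P => u v; rewrite !lfunE -gE => e.
  apply/eqP; rewrite -subr_eq0; apply/eqP; apply: subvs_inj; rewrite [RHS]linear0.
  apply: hfin_form_nondegenerate; first exact: subvsP.
  move=> y yh; rewrite -(vsprojK yh) linearB /= formC formDr -scaleN1r formZr.
  have := congr1 (fun f : dual h => f (vsproj h y)) e; rewrite !f2E /f1.
  by rewrite !(formC (vsval (vsproj h y))) => ->; rewrite mulN1r subrr.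
have im : limg (linfun g) = fullv.
  apply/eqP; rewrite eqEdim subvf /= limg_dim_eq; last by rewrite (eqP injg) capv0.
  by rewrite !dimvf /dim /= muln1.
have : linfun g (dual_elt B a) = a.
  by rewrite nuE gE limg_lfunVK // im memvf.
by move/(congr1 (fun f : dual h => f H)); rewrite lfunE -gE f2E /f1.
Qed.

Lemma dual_form_eval (a b : dual h) : dual_form B a b = a (dual_elt B b).
Proof. exact: t_P. Qed.

Lemma dual_formC (a b : dual h) : dual_form B a b = dual_form B b a.
Proof. exact: formC. Qed.

Lemma dual_form_suml (J : finType) (a : J -> dual h) (c : J -> F) b :
  dual_form B (\sum_j c j *: a j) b = \sum_j c j * dual_form B (a j) b.
Proof.
rewrite dual_form_eval sum_lfunE; apply: eq_bigr => j _.
by rewrite scale_lfunE dual_form_eval.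
Qed.

End CartanForm.

Section DiagramPositivity.
Variables (F : numClosedFieldType).

(* Vinberg's criterion: a positive vector [d] with [A d >= 0] makes the
   symmetric matrix [A] positive semidefinite. *)
Lemma superharmonic_form_ge (n : nat) (A : 'I_n -> 'I_n -> F) (d x : 'I_n -> F) :
  (forall i j, A i j = A j i) -> (forall i j, i != j -> A i j <= 0) ->
  (forall i, 0 < d i) -> (forall i, x i \is Num.real) ->
  \sum_i (\sum_j A i j * d j) * (x i ^+ 2 / d i) <= \sum_i \sum_j A i j * (x i * x j).
Proof.
move=> symA offA d0 xr; set Q := leLHS; set S := leRHS.
suff : 0 <= 2 * (S - Q) by rewrite pmulr_rge0 // subr_ge0.
have QE : Q = \sum_i \sum_j A i j * d j * (x i ^+ 2 / d i).
  by apply: eq_bigr => i _; rewrite mulr_suml.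
have QE' : Q = \sum_i \sum_j A i j * d i * (x j ^+ 2 / d j).
  by rewrite QE exchange_big; apply: eq_bigr => i _; apply: eq_bigr => j _; rewrite symA.
(* The two expressions of Q complete the products to squares. Diagonal terms vanish, and off the
   diagonal each square carries the nonnegative coefficient - [A i j * d i * d j]. *)
have -> : 2 * (S - Q) =
    \sum_i \sum_j - (A i j * (d i * d j * (x i / d i - x j / d j) ^+ 2)).
  have -> : 2 * (S - Q) = S + S - Q - Q by ring.
  rewrite {1}QE QE' /S -!big_split -!sumrB; apply: eq_bigr => i _.
  rewrite -!big_split -!sumrB; apply: eq_bigr => j _ /=.
  by field; rewrite !gt_eqF.
apply: sumr_ge0 => i _; apply: sumr_ge0 => j _.
have [->|ij] := eqVneq i j; first by rewrite subrr expr0n mulr0 mulr0 oppr0.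
rewrite -mulNr mulr_ge0 ?oppr_ge0 ?offA // mulr_ge0 //.
  by rewrite mulr_ge0 // ltW.
rewrite real_exprn_even_ge0 // realB // realM // realV gtr0_real //.
Qed.

End DiagramPositivity.

Section ThetaPositive.
Variables (F : numClosedFieldType) (G : simpleLie F).
Local Notation h := (hfin G).
Local Notation B := (@Defs.form F G).
Local Notation n := (rank G).

(** In simple root coordinates the form is c / 2 times the quadratic form of the Cartan matrix, c
    being the common square length of the simple roots. The weights [d], with their slack at [i0],
    bound that quadratic form from below by the square of the coordinate at [i0] over [d i0]; a root
    of square length 2 forces c > 0; and theta has a positive coordinate at [i0]. Connectedness of
    the diagram is encoded by asking that functions constant along edges be constant. *)
Lemma diagram_theta_gt0 (adj : rel nat) (d : nat -> nat) (i0 : nat) :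
  has_diagram G adj -> (i0 < n)%N ->
  (forall f : nat -> F, (forall i j, (i < n)%N -> (j < n)%N -> adj i j -> f i = f j) ->
     forall i, (i < n)%N -> f i = f i0) ->
  (forall i, (i < n)%N -> (0 < d i)%N) ->
  (forall i : 'I_n,
     (\sum_(j < n | (i != j) && (adj i j || adj j i)) d j + (i == i0 :> nat) <= 2 * d i)%N) ->
  0 < dual_form B (theta G) (theta G).
Proof.
move=> [s sP] i0n conn dpos dsup.
pose a i := alpha (s i); pose c i := dual_form B (a i) (a i).
pose A (i j : 'I_n) : F := if i == j then 2 else if adj i j || adj j i then -1 else 0.
have AE i j : A i j = 2 / c i * dual_form B (a i) (a j).
  rewrite /A -sP /coroot /form_coroot linearZ /= -dual_form_eval dual_formC.
  by [].
have symA i j : A i j = A j i by rewrite /A eq_sym orbC.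
(* Otherwise the diagonal entry 2, a multiple of the square length, would vanish. *)
have c0 i : c i != 0.
  apply/eqP => ci0; have := AE i i; rewrite -/(c i) ci0 mulr0 /A eqxx => /eqP.
  by rewrite pnatr_eq0.
pose I0 := Ordinal i0n.
(* Along an edge the entries A k l and A l k are equal and nonzero, and they are twice the same form
   value divided by [c k] and by [c l]. *)
have cE i : c i = c I0.
  pose f k := if insub k is Some i then c i else 0.
  have fE (i' : 'I_n) : f i' = c i' by rewrite /f valK.
  rewrite -!fE; apply: conn => // k l kn ln kl.
  pose k' := Ordinal kn; pose l' := Ordinal ln.
  rewrite -[k]/(k' : nat) -[l]/(l' : nat) !fE.
  have [-> //|kl'] := eqVneq k' l'.
  have Akl : A k' l' = -1 by rewrite /A (negPf kl') kl.
  have e : 2 / c k' * dual_form B (a k') (a l') = 2 / c l' * dual_form B (a k') (a l').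
    by rewrite -AE dual_formC -AE symA.
  have kl0 : dual_form B (a k') (a l') != 0.
    by apply/eqP => z; move/eqP: Akl; rewrite AE z mulr0 eq_sym oppr_eq0 oner_eq0.
  by apply: invr_inj; apply: (@mulfI _ 2); [rewrite pnatr_eq0 | exact: mulIf kl0 _ _ e].
pose S (x : 'I_n -> F) := \sum_i \sum_j A i j * (x i * x j).
have formE (x : 'I_n -> F) (b : dual h) : b = \sum_i x i *: a i ->
    dual_form B b b = c I0 / 2 * S x.
  move=> bE; rewrite {1}bE dual_form_suml /S mulr_sumr; apply: eq_bigr => i _.
  rewrite dual_formC bE dual_form_suml !mulr_sumr; apply: eq_bigr => j _.
  rewrite AE cE dual_formC; field; exact: c0.
pose D (i : 'I_n) : F := (d i)%:R.
have D0 i : 0 < D i by rewrite ltr0n dpos.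
have offA i j : i != j -> A i j <= 0.
  by rewrite /A => /negPf ->; case: ifP => _; rewrite ?lerN10.
have AD (i : 'I_n) : (i == i0 :> nat)%:R <= \sum_j A i j * D j.
  rewrite (bigD1 i) //= {1}/A eqxx (eq_bigr (fun j : 'I_n =>
    - (if adj i j || adj j i then D j else 0))); last first.
    by move=> j ji; rewrite /A eq_sym (negPf ji); case: ifP; rewrite ?mulN1r ?mul0r ?oppr0.
  rewrite sumrN -big_mkcondr /= lerBrDr addrC.
  rewrite (eq_bigl (fun j : 'I_n => (i != j) && (adj i j || adj j i))); last first.
    by move=> j; rewrite eq_sym.
  by rewrite -natr_sum -natrD -natrM ler_nat.
have Sge (x : 'I_n -> F) : (forall i, x i \is Num.real) ->
    x I0 ^+ 2 / D I0 <= S x /\ 0 <= S x.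
  move=> xr.
  have sq i : 0 <= x i ^+ 2 / D i.
    by rewrite divr_ge0 ?(ltW (D0 i)) // real_exprn_even_ge0.
  have := superharmonic_form_ge symA offA D0 xr; rewrite -/(S x) => le.
  have le' : x I0 ^+ 2 / D I0 <= \sum_i (\sum_j A i j * D j) * (x i ^+ 2 / D i).
    rewrite (bigD1 I0) //= -[leLHS]addr0; apply: lerD.
      rewrite -[leLHS]mul1r ler_wpM2r //.
      by have := AD I0; rewrite eqxx.
    apply: sumr_ge0 => i _; apply: mulr_ge0 => //.
    by apply: le_trans (AD i); rewrite ler0n.
  by have := le_trans le' le; split=> //; apply: le_trans (sq I0) _.
have natE (m : 'I_n -> nat) : \sum_i alpha i *+ m i = \sum_i (m (s i))%:R *: a i.
  rewrite (reindex_inj (h := s)) /=; last exact: perm.perm_inj.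
  by apply: eq_bigr => i _; rewrite scaler_nat.
(* A root of square length 2 gives 2 = c / 2 * S x with [S x] nonnegative, so [S x] is positive and
   c = 4 / S x. *)
have cpos : 0 < c I0.
  have [[b rb b2] _] := form_normalized G.
  have [_ _ /(_ b rb) [m bE]] := alpha_base G.
  have [x [xr bx]] : exists x : 'I_n -> F, (forall i, x i \is Num.real) /\
      b = \sum_i x i *: a i.
    case: bE => ->; rewrite natE; first by exists (fun i => (m (s i))%:R).
    exists (fun i => - (m (s i))%:R); split; first by move=> i; rewrite realN.
    by rewrite -sumrN; apply: eq_bigr => i _; rewrite scaleNr.
  have [_ S0] := Sge x xr.
  have := formE x b bx; rewrite b2 => e.
  have Sn0 : S x != 0.
    by apply/eqP => z; move/eqP: e; rewrite z mulr0 pnatr_eq0.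
  have Sp : 0 < S x by rewrite lt_def Sn0.
  have -> : c I0 = 4 / S x.
    apply: (mulIf Sn0); rewrite divfK //.
    have -> : c I0 * S x = 2 * (c I0 / 2 * S x) by field.
    by rewrite -e -natrM.
  by rewrite divr_gt0.
(* Theta minus the simple root at [i0] is a nonnegative combination of simple roots, so the
   coordinate of theta there is at least 1. *)
have [_ /(_ (a I0))] := theta_highest G; have [ra _ _] := alpha_base G.
move=> /(_ (ra _))[m thE].
pose x i : F := (i == I0)%:R + (m (s i))%:R.
have thx : theta G = \sum_i x i *: a i.
  rewrite thE natE /x; under [RHS]eq_bigr do rewrite scalerDl.
  rewrite big_split /=; congr (_ + _).
  rewrite (bigD1 I0) //= eqxx scale1r big1 ?addr0 // => i /negPf ->.
  by rewrite scale0r.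
have [|Sx _] := Sge x; first by move=> i; rewrite /x realD.
rewrite (formE x) //; apply: mulr_gt0; first by rewrite divr_gt0.
apply: lt_le_trans Sx; rewrite divr_gt0 // exprn_gt0 // /x eqxx.
by rewrite -natrD ltr0n.
Qed.

Lemma sum_neighbours (i : nat) (P : rel nat) (d : nat -> nat) (l : seq nat) :
  (forall j : 'I_n, P i j -> val j \in l) ->
  (\sum_(j < n | P i j) d j <= \sum_(j <- l) d j)%N.
Proof.
move=> Pl.
have -> : (\sum_(j < n | P i j) d j = \sum_(j <-
  [seq val j | j <- [seq j : 'I_n <- enum 'I_n | P i j]]) d j)%N.
  by rewrite big_map big_filter big_enum_cond.
apply: leq_trans (_ : \sum_(j <- undup l) d j <= _)%N; last first.
  elim: l {Pl} => //= y l IH; rewrite big_cons; case: ifP => _.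
    by apply: leq_trans IH _; apply: leq_addl.
  by rewrite big_cons leq_add2l.
set l1 := [seq _ | _ <- _].
have u1 : uniq l1.
  by rewrite map_inj_uniq; [apply: filter_uniq; apply: enum_uniq | exact: val_inj].
have s1 : {subset l1 <= undup l}.
  move=> y /mapP[j]; rewrite mem_filter => /andP[Pj _] ->; rewrite mem_undup.
  exact: Pl.
have pe : perm_eq l1 [seq y <- undup l | y \in l1].
  apply: uniq_perm => //; first by apply: filter_uniq; apply: undup_uniq.
  move=> y; rewrite mem_filter; apply/idP/idP; last by case/andP.
  by move=> yl; rewrite yl s1.
rewrite (perm_big _ pe) big_filter [leqRHS](bigID (fun y => y \in l1)) /=.
exact: leq_addr.
Qed.

(* [d] is superharmonic on the diagram, strictly so at [i0]; for type E it lists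
   the coefficients of the highest root. *)
Lemma theta_form_gt0 : type_ADE G -> 0 < dual_form B (theta G) (theta G).
Proof.
have n0 : (0 < n)%N.
  have [[th0 _] _] := theta_highest G.
  rewrite lt0n; apply/eqP => nz.
  have [_ bas _] := alpha_base G.
  have : \dim (fullv : {vspace dual h}) = 0%N by rewrite (size_basis bas) nz.
  move/eqP; rewrite dimv_eq0 => /eqP f0.
  by case/eqP: th0; apply/eqP; rewrite -memv0 -f0 memvf.
have nbP adj d i0 (nb : nat -> seq nat) :
    (forall i j, (i < n)%N -> (j < n)%N -> adj i j || adj j i -> j \in nb i) ->
    (forall i, (i < n)%N -> (\sum_(j <- nb i) d j + (i == i0) <= 2 * d i)%N) ->
    forall i : 'I_n,
     (\sum_(j < n | (i != j) && (adj i j || adj j i)) d j + (i == i0 :> nat) <= 2 * d i)%N.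
  move=> nbE dE i; apply: leq_trans (dE i (ltn_ord i)); rewrite leq_add2r.
  apply: (@sum_neighbours i (fun i j => (i != j) && (adj i j || adj j i))) => j /andP[_].
  exact: nbE.
case=> [hd|[n4 hd]|[n678 hd]].
- apply: (diagram_theta_gt0 (d := fun=> 1%N) (i0 := 0%N) hd) => //.
    move=> f fE; elim=> // i IH lt; rewrite -IH ?(ltnW lt) //.
    by apply/esym/fE; rewrite ?(ltnW lt) // /edge_A.
  apply: (nbP edge_A (fun=> 1%N) 0%N (fun i => if i is k.+1 then [:: k; k.+2] else [:: 1%N])).
    by move=> [|i] [|j] _ _; rewrite /edge_A !inE //; lia.
  by move=> [|i] _; rewrite ?big_cons big_nil.
(* The coefficients of the highest root, except at the end node 0, where 2 replaces 1 and thereby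
   moves the strict inequality to that node. *)
- pose d j := if (j < n - 2)%N then 2%N else 1%N.
  apply: (diagram_theta_gt0 (d := d) (i0 := 0%N) hd) => //.
  + move=> f fE.
    have chain i : (i < n.-1)%N -> f i = f 0%N.
      elim: i => // i IH lt; rewrite -IH; last by lia.
      by apply/esym/fE; rewrite /edge_D; lia.
    move=> i lt; have [lt'|ge] := ltnP i n.-1; first exact: chain.
    by rewrite -(chain (n - 3)%N); [apply/esym/fE; rewrite /edge_D; lia | lia].
  + by move=> i _; rewrite /d; case: ifP.
  apply: (nbP (edge_D n) d 0%N (fun i => if i == 0%N then [:: 1%N] else
     if (i < n - 3)%N then [:: i.-1; i.+1] else
     if i == (n - 3)%N then [:: i.-1; n.-2; n.-1] else [:: (n - 3)%N])).
    move=> i j lti ltj; rewrite /edge_D => e.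
    by repeat case: ifP => ?; rewrite !inE; lia.
  move=> i lti; repeat case: ifP => ?; rewrite ?big_cons big_nil /d;
    repeat case: ifP => ?; lia.
- have n678' : [|| n == 6, n == 7 | n == 8]%N by move: n678; rewrite !inE.
  pose th : seq nat := if n == 6%N then [:: 1; 2; 2; 3; 2; 1]%N else
     if n == 7%N then [:: 2; 2; 3; 4; 3; 2; 1]%N else [:: 2; 3; 4; 6; 5; 4; 3; 2]%N.
  (* The node to which the affine node is attached: the only simple root that is not orthogonal to
     the highest root. *)
  pose k := if n == 6%N then 1%N else if n == 7%N then 0%N else 7%N.
  pose nb (i : nat) := [seq j <- iota 0 n | edge_E i j || edge_E j i].
  apply: (diagram_theta_gt0 (d := nth 1%N th) (i0 := k) hd).
  + by rewrite /k; case/or3P: n678' => /eqP ->.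
  + move=> f fE.
    have n6 : (6 <= n)%N by case/or3P: n678' => /eqP ->.
    have e02 : f 0%N = f 2%N by apply: fE => //; lia.
    have e13 : f 1%N = f 3%N by apply: fE => //; lia.
    have chain i : (i.+2 < n)%N -> f i.+2 = f 2%N.
      elim: i => // i IH lt; rewrite -IH; last by lia.
      by apply/esym/fE; rewrite /edge_E; lia.
    have all2 i : (i < n)%N -> f i = f 2%N.
      case: i => [|[|i]] lt //; last exact: chain.
      by rewrite e13; apply: chain; lia.
    move=> i lt; rewrite !all2 //.
    by rewrite /k; case/or3P: n678' => /eqP ->.
  + move=> i lt; rewrite /th; case/or3P: n678' lt => /eqP ->;
      by do 8?[case: i => [|i] //].
  apply: (nbP edge_E (nth 1%N th) k nb).
    by move=> i j _ lt e; rewrite mem_filter e mem_iota.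
  move=> i lt; rewrite /nb /th /k; case/or3P: n678' lt => /eqP ->;
    by do 8?[case: i => [|i]; first by rewrite unlock].
Qed.

End ThetaPositive.

(** * Semisimplicity of the Cartan action and homogeneous vectors *)

Section GradedDecomposition.
Variables (F : fieldType) (V : lmodType F).

Lemma graded_decomposition (K : eqType) (E : K -> V -> Prop) x :
  (forall k, lin_closed (E k)) -> lspan (fun u => exists k, E k u) x ->
  exists r w, [/\ uniq r, forall k, E k (w k) & x = \sum_(k <- r) w k].
Proof.
move=> cE; elim=> [|a u y [k Eu] _ [r [w [ur wE ->]]]].
  exists [::], (fun=> 0); rewrite big_nil; split=> // k; by case: (cE k).
pose w' l := (if l == k then a *: u else 0) + (if l \in r then w l else 0).
exists (undup (k :: r)), w'; split; first exact: undup_uniq.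
  move=> l; rewrite /w'; have [E0 _] := cE l; apply: lin_closedD => //.
    by case: eqP => // ->; apply: lin_closedZ.
  by case: ifP.
rewrite /w' big_split /=; congr (_ + _); last first.
  case: ifP => kr; first by rewrite undup_id //; apply: eq_big_seq => l ->.
  rewrite big_cons kr add0r undup_id //; apply: eq_big_seq => l ->.
  by [].
rewrite -big_mkcond /= -/(undup (k :: r)) (big_rem k) ?mem_undup ?mem_head //= eqxx.
rewrite big_seq_cond big1 ?addr0 // => l /andP[+ /eqP lk]; rewrite lk.
by rewrite mem_rem_uniqF //; apply: (undup_uniq (k :: r)).
Qed.

(** On the component of eigenvalue k the operators are the scalars (k - e)^2 and k - e, which vanish
    together. *)
Lemma diagonal_op_square (A : V -> V) (e : F) y : linear A ->
  lspan (fun u => exists c, A u = c *: u) y ->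
  A (A y - e *: y) - e *: (A y - e *: y) = 0 -> A y - e *: y = 0.
Proof.
move=> lA; have [g gE] := linear_pack lA; rewrite gE => sp.
have cE (c : F) : lin_closed (fun u => g u = c *: u).
  split; first by rewrite linear0 scaler0.
  by move=> a u v hu hv; rewrite linearP hu hv scalerDr !scalerA mulrC.
have [r [w [ur wE ->]]] := graded_decomposition cE sp.
have sE (f : F -> F) : g (\sum_(k <- r) f k *: w k) - e *: (\sum_(k <- r) f k *: w k)
    = \sum_(k <- r) (f k * (k - e)) *: w k.
  rewrite linear_sum scaler_sumr -sumrB; apply: eq_bigr => k _.
  by rewrite linearZ /= wE !scalerA -scalerBl; congr (_ *: _); ring.
have -> : \sum_(k <- r) w k = \sum_(k <- r) 1 *: w k.
  by apply: eq_bigr => k _; rewrite scale1r.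
rewrite !sE => s0; apply: big1_seq => k /andP[_ kr].
have := @eigen_components F V F unit (fun _ => g) (fun u => u = 0) r
  (fun k => (1 * (k - e) * (k - e)) *: w k) (fun k _ => k).
move=> H; have {H}: (1 * (k - e) * (k - e)) *: w k = 0.
  apply: H => //.
  - by split=> // a u v -> ->; rewrite scaler0 addr0.
  - by move=> _ a u v; rewrite linearP.
  - by move=> _ v ->; rewrite linear0.
  - by move=> l _ _; rewrite linearZ /= wE !scalerA mulrC.
move/eqP; rewrite scaler_eq0 mulf_eq0 -orbA => /or3P[/eqP ->|/eqP ->|/eqP ->].
- by rewrite scale0r.
- by rewrite mulr0 scale0r.
- by rewrite scaler0.
Qed.

End GradedDecomposition.

Lemma lin_closed_vspace (F : fieldType) (V : vectType F) (N : V -> Prop) :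
  lin_closed N -> exists U : {vspace V}, forall x, x \in U <-> N x.
Proof.
move=> cN.
suff ext m (U : {vspace V}) : (forall x, x \in U -> N x) ->
    (\dim (fullv : {vspace V}) - \dim U <= m)%N ->
    exists U : {vspace V}, forall x, x \in U <-> N x.
  apply: (ext _ 0%VS _ (leqnn _)) => x; rewrite memv0 => /eqP ->.
  by case: cN.
elim: m U => [|m IH] U UN le.
  exists U => x; split; first exact: UN.
  have -> : U = fullv.
    by apply/eqP; rewrite eqEdim subvf -subn_eq0 -leqn0.
  by rewrite memvf.
have [all|] := pselect (forall x, N x -> x \in U).
  by exists U => x; split; [apply: UN | apply: all].
move=> /existsNP[x /not_implyP[Nx /negP xU]].
apply: (IH (U + <[x]>)%VS) => [y /memv_addP[u uU [z /vlineP[a ->] ->]]|].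
  by apply: lin_closedD => //; [exact: UN | exact: lin_closedZ].
have lt : (\dim U < \dim (U + <[x]>)%VS)%N.
  rewrite ltn_neqAle dimvS ?addvSl // andbT; apply: contra xU => /eqP e.
  have /eqP -> : U == (U + <[x]>)%VS by rewrite eqEdim addvSl e leqnn.
  by apply: subvP (addvSr _ _) _ (memv_line x).
have := dimvS (subvf (U + <[x]>)%VS); lia.
Qed.

Section HomogeneousVectors.
Variables (F : numClosedFieldType) (G : simpleLie F).
Local Notation h := (hfin G).

(** A weight vector recorded with the height [e] of its weight, since later arguments compare only
    integers. The last two clauses recover from the sign of [e] what is needed to act on a highest
    weight vector. *)
Definition homogeneous (b : G) (e : int) := exists a : dual h,
  [/\ in_root_space a b, a (rho_check G) = e%:~R,
      (e == 0 -> a = 0 /\ b \in h) & (0 < e -> positive_root a)].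

Definition homogeneous_spanning (q : seq (G * int)) :=
  (forall p, p \in q -> homogeneous p.1 p.2) /\
  (forall x : G, lspan (fun b => exists2 p, p \in q & b = p.1) x).

Lemma commutant_hfin y : (forall H, H \in h -> lie H y = 0) -> y \in h.
Proof.
have [_ _ norm] := hfin_cartan G => hy; apply: norm => z zh.
by rewrite lieC hy // oppr0 mem0v.
Qed.

(** The hypothesis says that [h] acts semisimply; [affine_semisimple] supplies it. Simultaneous
    diagonalization along a basis of [h] then writes each element as a sum of weight vectors: those
    of weight 0 commute with [h] and so lie in it, the others are root vectors. *)
Lemma homogeneous_exists :
  (forall H z (a : F), H \in h ->
     shift_op (lie H) a (shift_op (lie H) a z) = 0 -> shift_op (lie H) a z = 0 :> G) ->
  exists q, homogeneous_spanning q.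
Proof.
move=> semis.
have simult (l : seq G) : {subset l <= h} -> forall x : G, exists2 s : seq G,
    x = \sum_(y <- s) y & forall y, y \in s -> forall H, H \in l -> exists c, lie H y = c *: y.
  elim: l => [|H l IH] lh x; first by exists [:: x]; rewrite ?big_seq1.
  have Hh : H \in h by apply: lh; rewrite mem_head.
  have [|s -> sP] := IH _ x; first by move=> K Kl; apply: lh; rewrite in_cons Kl orbT.
  elim: s sP => [|y s IHs] sP; first by exists [::].
  have [|s' s'E s'P] := IHs; first by move=> z zs; apply: sP; rewrite in_cons zs orbT.
  pose S z := forall K, K \in l -> forall c, lie K y = c *: y -> lie K z = c *: z.
  have cS : lin_closed S.
    split; first by move=> K _ c _; rewrite linear0 scaler0.
    move=> a u v Su Sv K Kl c Kc; rewrite linearP /= (Su K Kl c) // (Sv K Kl c) //.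
    by rewrite scalerDr !scalerA mulrC.
  have St z : S z -> S (lie H z).
    move=> Sz K Kl c Kc; rewrite lie_comm_hfin ?(Sz K Kl c) ?linearZ //.
    by apply: lh; rewrite in_cons Kl orbT.
  have [//|ps yE psP] := gen_eigen_decompositionV (T := lie H) cS St (x := y).
  exists ([seq p.2 | p <- ps] ++ s').
    by rewrite big_cons s'E yE big_cat big_map.
  move=> z; rewrite mem_cat => /orP[/mapP[p pps ->] K|zs' K Kl]; last exact: s'P Kl.
  have [Sp gp] := psP _ pps.
  rewrite in_cons => /predU1P[->|Kl].
    by exists p.1; apply: gen_eigen_strict gp => u; apply: semis.
  have [c hc] := sP _ (mem_head _ _) K Kl.
  by exists c; apply: Sp.
suff ext (l : seq G) : exists2 q : seq (G * int), forall p, p \in q -> homogeneous p.1 p.2 &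
    forall x, x \in l -> lspan (fun b => exists2 p, p \in q & b = p.1) x.
  have [q qh ql] := ext (vbasis (fullv : {vspace G})).
  exists q; split=> // x; rewrite (coord_vbasis (memvf x)).
  apply: lin_closed_sum; first exact: lspan_closed.
  move=> i _ _; apply: lin_closedZ; first exact: lspan_closed.
  by apply: ql; rewrite mem_nth // size_tuple.
elim: l => [|x l [q qh ql]]; first by exists [::].
have [|s xE sP] := simult (vbasis h) _ x; first by move=> z /vbasis_mem.
have [q' q'h q's] : exists2 q' : seq (G * int), forall p, p \in q' -> homogeneous p.1 p.2 &
    lspan (fun b => exists2 p, p \in q' & b = p.1) x.
  rewrite xE; elim: s sP {xE} => [|y s IH] sP.
    by exists [::] => //; rewrite big_nil; apply: lspan0.
  have [|q' q'h q's] := IH; first by move=> z zs; apply: sP; rewrite in_cons zs orbT.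
  rewrite big_cons; have [->|y0] := eqVneq y 0; first by exists q'; rewrite ?add0r.
  have [a ay] := joint_eigen_dual y0 (sP y (mem_head _ _)).
  have [e ye] : exists e, homogeneous y e.
    have [a0|a0] := eqVneq a 0.
      exists 0, a; split=> //; first by rewrite a0 lfunE.
      move=> _; split=> //; apply: commutant_hfin => H Hh.
      by rewrite -(vsprojK Hh) ay a0 lfunE /= scale0r.
    have ra : is_root a by split=> //; exists y.
    have [e ae [e0 ep]] := root_height ra.
    by exists e, a; split=> //; rewrite (negPf e0).
  exists ((y, e) :: q'); first by move=> p; rewrite in_cons => /predU1P[->|/q'h].
  apply: lin_closedD; first exact: lspan_closed.
    by apply: lspan_in; exists (y, e); rewrite ?mem_head.
  apply: lspan_mono q's => z [p pq ->]; exists p => //; by rewrite in_cons pq orbT.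
exists (q' ++ q); first by move=> p; rewrite mem_cat => /orP[/q'h|/qh].
move=> z; rewrite in_cons => /predU1P[->|/ql].
  by apply: lspan_mono q's => u [p pq ->]; exists p => //; rewrite mem_cat pq.
by apply: lspan_mono => u [p pq ->]; exists p => //; rewrite mem_cat pq orbT.
Qed.

End HomogeneousVectors.

(** * Integrable modules of the affine algebra *)

Section LinearFunctions.
Variables (F : fieldType) (U V : lmodType F).

Lemma linear_funD (f g : U -> V) : linear f -> linear g -> linear (fun u => f u + g u).
Proof. by move=> lf lg a u v; rewrite lf lg scalerDr addrACA. Qed.

Lemma linear_funZ (f : U -> V) c : linear f -> linear (fun u => c *: f u).
Proof. by move=> lf a u v; rewrite lf scalerDr !scalerA mulrC. Qed.

Lemma linear_fun_sum (J : Type) (r : seq J) (f : J -> U -> V) :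
  (forall j, linear (f j)) -> linear (fun u => \sum_(j <- r) f j u).
Proof.
move=> lf a u v; rewrite scaler_sumr -big_split /=; apply: eq_bigr => j _.
exact: lf.
Qed.

Lemma linear_eta (f : {linear U -> V}) : linear (fun u => f u).
Proof. by move=> a u v; rewrite linearP. Qed.

End LinearFunctions.

Section TorModuleBasics.
Variables (F : numClosedFieldType) (G : simpleLie F) (k : nat) (X : torModule G k).
Implicit Types (v w : X) (m s : 'rV[int]_k) (x y : G).
Local Notation B := (@Defs.form F G).

Lemma submodule_lin_closed (N : set X) : submodule N -> lin_closed N.
Proof. by case. Qed.

Lemma loop_linear m v : linear (fun x => @act F G k X (Loop x m) v).
Proof. exact: act_loop_linear (actP X) m v. Qed.

Lemma loop_span (N : X -> Prop) (Q : G -> Prop) m v x : lin_closed N ->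
  lspan Q x -> (forall b, Q b -> N (act (Loop b m) v)) -> N (act (Loop x m) v).
Proof.
move=> cN sx QN; have [g gE] := linear_pack (loop_linear m v).
have gE' y : act (Loop y m) v = g y by rewrite -gE.
rewrite gE'; elim: sx => [|a b u Qb _ Nu]; first by rewrite linear0; case: cN.
by rewrite linearP -gE'; case: cN => _; apply=> //; apply: QN.
Qed.

Lemma loop0 m v : act (Loop 0 m) v = 0.
Proof.
have [g gE] := linear_pack (loop_linear m v).
by rewrite -[LHS]/((fun x => @act F G k X (Loop x m) v) 0) gE linear0.
Qed.

Lemma loopZ a x m v : act (Loop (a *: x) m) v = a *: act (Loop x m) v.
Proof.
have [g gE] := linear_pack (loop_linear m v).
by rewrite -[LHS]/((fun x => @act F G k X (Loop x m) v) (a *: x)) gE linearZ -gE.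
Qed.

Lemma loopB x y m v : act (Loop (x - y) m) v = act (Loop x m) v - act (Loop y m) v.
Proof.
have [g gE] := linear_pack (loop_linear m v).
by rewrite -[LHS]/((fun x => @act F G k X (Loop x m) v) (x - y)) gE linearB -gE.
Qed.

Lemma loop_loop x y m s v :
  act (Loop x m) (act (Loop y s) v) = act (Loop y s) (act (Loop x m) v) +
    (act (Loop (lie x y) (m + s)) v
     + B x y *: \sum_i (m 0 i)%:~R *: act (Central (m + s) i) v).
Proof.
rewrite -(act_loop_loop (actP X)) /comm addrC.
by rewrite subrK.
Qed.

Lemma central_comm r i z v : (forall j, z <> Deg j) ->
  act (Central r i) (act z v) = act z (act (Central r i) v) :> X.
Proof.
move=> nd; apply/eqP; rewrite -subr_eq0; apply/eqP.
case: z nd => [x m|s j|j] nd.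
- exact: act_central_loop (actP X) _ _ _ _ _.
- exact: act_central_central (actP X) _ _ _ _ _.
- by case: (nd j).
Qed.

Lemma deg_loop i x m v : act (Deg i) (act (Loop x m) v) =
  act (Loop x m) (act (Deg i) v) + (m 0 i)%:~R *: act (Loop x m) v.
Proof. by rewrite -(act_deg_loop (actP X)) /comm addrC subrK. Qed.

Lemma deg_central i m j v : act (Deg i) (act (Central m j) v) =
  act (Central m j) (act (Deg i) v) + (m 0 i)%:~R *: act (Central m j) v.
Proof. by rewrite -(act_deg_central (actP X)) /comm addrC subrK. Qed.

Lemma loop0_loop x y s v :
  act (Loop x 0) (act (Loop y s) v) = act (Loop y s) (act (Loop x 0) v) +
    act (Loop (lie x y) s) v.
Proof.
rewrite loop_loop add0r; congr (_ + _).
by rewrite big1 ?scaler0 ?addr0 // => i _; rewrite mxE scale0r.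
Qed.

Lemma deg0_central i j v : act (Deg i) (act (Central 0 j) v) =
  act (Central 0 j) (act (Deg i) v).
Proof. by rewrite deg_central mxE scale0r addr0. Qed.

Lemma central0_comm i z v :
  act (Central 0 i) (act z v) = act z (act (Central 0 i) v) :> X.
Proof.
case: z => [x m|s j|j]; first exact: central_comm.
  exact: central_comm.
by rewrite deg0_central.
Qed.

Lemma hact_linear (H : htor G k) : linear (@hact F G k X H).
Proof.
apply: linear_funD; first (apply: linear_funD; first exact: linear_eta).
  by apply: linear_fun_sum => i; apply: linear_funZ; exact: linear_eta.
by apply: linear_fun_sum => i; apply: linear_funZ; exact: linear_eta.
Qed.

Lemma hact_submodule (N : set X) H v : submodule N -> N v -> N (hact H v).
Proof.
move=> sN Nv; have [N0 _ Nact] := sN; have cN := submodule_lin_closed sN.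
apply: lin_closedD => //; first apply: lin_closedD => //; first exact: Nact.
  by apply: lin_closed_sum => // i _ _; apply: lin_closedZ => //; apply: Nact.
by apply: lin_closed_sum => // i _ _; apply: lin_closedZ => //; apply: Nact.
Qed.

Lemma hact_hfin (H : subvs_of (hfin G)) v : hact (H, 0, 0) v = act (Loop (vsval H) 0) v.
Proof.
rewrite /hact /= big1 ?addr0; last by move=> i _; rewrite mxE scale0r.
by rewrite big1 ?addr0 // => i _; rewrite mxE scale0r.
Qed.

Lemma diagonalizable_lspan : Defs.diagonalizable X ->
  forall v, lspan (fun u => exists mu, in_weight_space mu u) v.
Proof.
move=> dX v; have [s -> sP] := dX v; apply: lin_closed_sum; first exact: lspan_closed.
by move=> w /sP hw _; apply: lspan_in.
Qed.

Lemma cyclic_id v : cyclic v v.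
Proof. by []. Qed.

Lemma cyclic_min v (N : set X) : submodule N -> N v -> forall u, cyclic v u -> N u.
Proof. by move=> sN Nv u; apply. Qed.

End TorModuleBasics.

Section AffineFaithful.
Variables (F : numClosedFieldType) (G : simpleLie F) (X : torModule G 1).
Implicit Types (v w : X) (x y : G).
Local Notation h := (hfin G).
Local Notation B := (@Defs.form F G).
Local Notation K := (act (Central 0 ord0)).

Lemma const_mx1 (m : 'rV[int]_1) : m = const_mx (m 0 0).
Proof. by apply/rowP => i; rewrite !mxE ord1. Qed.

Lemma affine_central_eq0 (m : 'rV[int]_1) i v : m != 0 -> act (Central m i) v = 0.
Proof.
move=> m0; have := act_central_rel (actP X) m v; rewrite big_ord1 (ord1 i) => /eqP.
rewrite scaler_eq0 intr_eq0 => /orP[/eqP e|/eqP ->] //.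
by case/eqP: m0; apply/rowP => j; rewrite ord1 mxE.
Qed.

(** The kernel is an ideal. If it were [G], all brackets would act by 0 at every power of t_1; such
    elements form a nonzero ideal, so all loops would act by 0, and the bracket of y t_1 with z /
    t_1, where (y|z) is nonzero, would force K_1 to vanish. *)
Lemma affine_faithful v0 : K v0 != 0 ->
  forall x, (forall v, act (Loop x 0) v = 0) -> x = 0.
Proof.
move=> Kv0 x xX.
have [[x0 [y0 xy0]] ideal] := gfin_simple G.
pose N x := forall v, act (Loop x 0) v = 0.
have cN : lin_closed N.
  split; first by move=> v; rewrite loop0.
  move=> a u w Nu Nw v.
  by rewrite (loop_linear 0 v a u w) Nu Nw scaler0 addr0.
have [U UN] := lin_closed_vspace cN.
have [|U0|UT] := ideal U.
- move=> y z zU; apply/UN => v; move/UN: zU => zN.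
  by have := loop0_loop y z 0 v; rewrite !zN linear0 add0r => <-.
- have : x \in U by apply/UN.
  by rewrite U0 memv0 => /eqP.
have N1 y : N y by apply/UN; rewrite UT memvf.
have NB y z m v : act (Loop (lie y z) m) v = 0.
  by have := loop0_loop y z m v; rewrite !N1 linear0 add0r => <-.
pose D x := forall m v, act (Loop x m) v = 0.
have cD : lin_closed D.
  split; first by move=> m v; rewrite loop0.
  by move=> a u w Du Dw m v; rewrite (loop_linear m v a u w) Du Dw scaler0 addr0.
have [U' U'D] := lin_closed_vspace cD.
have [|U0'|UT'] := ideal U'.
- by move=> y z _; apply/U'D => m v; apply: NB.
- have : lie x0 y0 \in U' by apply/U'D => m v; apply: NB.
  by rewrite U0' memv0 (negPf xy0).
have D1 y m v : act (Loop y m) v = 0.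
  by have /U'D : y \in U' by rewrite UT' memvf.
have [y [z yz]] : exists y z, B y z != 0.
  apply: contrapT => hn; case/eqP: xy0; apply: form_nondegenerate => u.
  by apply/eqP/negPn/negP => hu; apply: hn; exists (lie x0 y0), u.
have := loop_loop y z (const_mx 1) (- const_mx 1) v0.
rewrite !D1 !add0r big_ord1 mxE scale1r subrr => /esym/eqP.
by rewrite scaler_eq0 (negPf yz) (negPf Kv0).
Qed.

(** On an eigenvector of H with eigenvalue e, the element (ad H - a) y acts as (H - e - a) applied
    to the action of y. Since H is diagonalizable on the module, a square-zero relation there is
    already a relation, and faithfulness transports it to [G]. *)
Lemma affine_semisimple v0 : Defs.diagonalizable X -> K v0 != 0 ->
  forall H z (a : F), H \in h ->
     shift_op (lie H) a (shift_op (lie H) a z) = 0 -> shift_op (lie H) a z = 0 :> G.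
Proof.
move=> dX Kv0 H z a Hh hz; apply: (affine_faithful Kv0) => v.
pose A := @act F G 1 X (Loop H 0).
have lA : linear A by exact: linear_eta.
have AE y u e : A u = e *: u -> act (Loop (shift_op (lie H) a y) 0) u =
   A (act (Loop y 0) u) - (e + a) *: act (Loop y 0) u.
  move=> Au; rewrite /A loop0_loop -/A -[act (Loop H 0) u]/(A u) Au linearZ /=.
  by rewrite scalerDl opprD addrACA subrr add0r /shift_op loopB loopZ.
have dA u : lspan (fun u => exists c, A u = c *: u) u.
  apply: lspan_mono (diagonalizable_lspan dX u) => w [mu hw].
  exists (mu (vsproj h H, 0, 0)); have := hw (vsproj h H, 0, 0).
  by rewrite hact_hfin vsprojK.
elim: (dA v) => [|c u w [e Au] _ IH]; first by rewrite linear0.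
rewrite linearP IH addr0 /= (AE _ _ _ Au).
rewrite (diagonal_op_square lA (dA _)) ?scaler0 //.
by rewrite -(AE z u e Au) -(AE _ u e Au) hz loop0.
Qed.

End AffineFaithful.

(** * Modules graded by depth below a highest weight vector *)

Section DepthGraded.
Variables (F : numClosedFieldType) (W : lmodType F) (P : W -> W) (Lam : F).
Hypothesis lP : linear P.

Definition depth_comp (U : nat -> seq W) (n : nat) (u : W) :=
  P u = (Lam - n%:R) *: u /\ spanby (U n) u.

(* [P] is diagonalizable with eigenvalues in [Lam - nat] and finite-dimensional
   eigenspaces, the top one being spanned by [v]. *)
Definition depth_graded (v : W) := exists2 U : nat -> seq W,
  (forall u, spanby (U 0%N) u -> exists c, u = c *: v) &
  forall x, lspan (fun u => exists n, depth_comp U n u) x.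

Lemma eigen_closed (e : F) : lin_closed (fun u => P u = e *: u).
Proof.
have [g gE] := linear_pack lP; split; first by rewrite gE linear0 scaler0.
by move=> a u w hu hw; rewrite lP hu hw scalerDr !scalerA mulrC.
Qed.

Lemma depth_comp_closed U n : lin_closed (depth_comp U n).
Proof.
have [e0 e1] := eigen_closed (Lam - n%:R).
have [s0 s1] := lspan_closed (fun w => w \in U n).
by split=> // a u w [pu su] [pw sw]; split; [apply: e1 | apply: s1].
Qed.

Lemma depth_shift_inj (m n : nat) : Lam - m%:R = Lam - n%:R -> m = n.
Proof. by move/addrI/oppr_inj/eqP; rewrite eqr_nat => /eqP. Qed.

Lemma depth_components (N : W -> Prop) (r : seq nat) (w : nat -> W) :
  lin_closed N -> (forall u, N u -> N (P u)) -> uniq r ->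
  (forall n, n \in r -> P (w n) = (Lam - n%:R) *: w n) ->
  N (\sum_(n <- r) w n) -> forall n, n \in r -> N (w n).
Proof.
move=> cN NP ur Pw; apply: (@eigen_components _ _ _ unit (fun=> P) N r w
  (fun n _ => Lam - n%:R)) => //; first by move=> n _; apply: Pw.
move=> m n _ _ mn; exists tt; apply: contra mn => /eqP e.
by apply/eqP; apply: depth_shift_inj.
Qed.

Lemma depth_eigen U e u : (forall x, lspan (fun u => exists n, depth_comp U n u) x) ->
  P u = e *: u -> u != 0 -> exists2 n : nat, e = Lam - n%:R & spanby (U n) u.
Proof.
move=> sp Pu u0.
have [r [w [ur wE uE]]] := graded_decomposition (depth_comp_closed U) (sp u).
have we n : n \in r -> P (w n) = e *: w n.
  apply: (depth_components (N := fun x => P x = e *: x)) => //.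
  - exact: eigen_closed.
  - by move=> x; have [g ->] := linear_pack lP; move=> {1}->; rewrite linearZ.
  - by move=> m _; have [] := wE m.
  - by rewrite -uE.
have wn n : n \in r -> w n = 0 \/ e = Lam - n%:R.
  move=> nr; have := we n nr; have [-> _] := wE n => /eqP.
  rewrite -subr_eq0 -scalerBl scaler_eq0 => /orP[|/eqP ->]; last by left.
  by rewrite subr_eq0 => /eqP ->; right.
have [n nr wn0] : exists2 n, n \in r & w n != 0.
  apply: contrapT => hn; case/eqP: u0; rewrite uE big1_seq // => n /andP[_ nr].
  by apply/eqP/negPn/negP => p; apply: hn; exists n.
have en : e = Lam - n%:R by case: (wn n nr) => // z; rewrite z eqxx in wn0.
exists n => //; have [_ +] := wE n.
suff -> : u = w n by [].
rewrite uE (big_rem n) //= big1_seq ?addr0 // => m /andP[_ mr].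
have mr' := mem_rem mr; case: (wn m mr') => // em.
have mn : m = n by apply: depth_shift_inj; rewrite -em.
by move: mr; rewrite mn mem_rem_uniqF.
Qed.

Lemma depth_top v u : depth_graded v -> P u = Lam *: u -> exists c, u = c *: v.
Proof.
move=> [U U0 sp] Pu; have [->|u0] := eqVneq u 0; first by exists 0; rewrite scale0r.
have [n en su] := depth_eigen sp Pu u0.
suff n0 : n = 0%N by apply: U0; rewrite -n0.
by apply: depth_shift_inj; rewrite -en subr0.
Qed.

End DepthGraded.

Section GradedAffineModule.
Variables (F : numClosedFieldType) (G : simpleLie F).
Variables (q : seq (G * int)) (C : nat).
Hypothesis q_span : homogeneous_spanning q.
Hypothesis C_bound : forall p : G * int, p \in q -> `|p.2| < C%:Z.
Local Notation h := (hfin G).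

(** The degree of a letter times t_1^a. As [C] exceeds all heights in absolute value, its sign is
    lexicographic: that of a first, then that of the height. *)
Definition letter_degree (p : G * int) (a : int) : int := C%:Z * a + p.2.

Lemma letter_degree_gt0 (p : G * int) a : p \in q -> 0 < letter_degree p a -> 0 <= a.
Proof.
move=> /C_bound; rewrite ltr_norml /letter_degree => /andP[_ lt] d0.
case: (lerP 0 a) => // a0.
have : 0 <= C%:Z * (- a - 1) by apply: mulr_ge0; lia.
by rewrite mulrBr mulr1 mulrN; lia.
Qed.

(** The second bound is what makes the words of a given depth finite in number: a lowering letter
    cannot have an exponent larger than its cost in depth. *)
Lemma letter_degree_lt0 (p : G * int) a : p \in q -> letter_degree p a < 0 ->
  a <= 0 /\ - a <= - letter_degree p a.
Proof.
move=> /C_bound; rewrite ltr_norml /letter_degree => /andP[lt gt] d0.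
have a0 : a <= 0.
  case: (lerP a 0) => // a0.
  have : 0 <= C%:Z * (a - 1) by apply: mulr_ge0; lia.
  by rewrite mulrBr mulr1; lia.
split=> //; have [az|/eqP an0] := eqVneq a 0.
  by move: d0; rewrite az mulr0; lia.
have a1 : 0 <= - a - 1 by lia.
have C1 : 0 <= C%:Z - 1 by lia.
have := mulr_ge0 C1 a1.
by rewrite mulrBl mul1r mulrBr mulr1 mulrN; lia.
Qed.

Lemma letter_degree0 (p : G * int) a : p \in q -> letter_degree p a = 0 -> a = 0 /\ p.2 = 0.
Proof.
move=> /C_bound; rewrite ltr_norml /letter_degree => /andP[lt gt] e.
have a0 : a = 0.
  case: (ltrgt0P a) => // a0.
    have : 0 <= C%:Z * (a - 1) by apply: mulr_ge0; lia.
    by rewrite mulrBr mulr1; lia.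
  have : 0 <= C%:Z * (- a - 1) by apply: mulr_ge0; lia.
  by rewrite mulrBr mulr1 mulrN; lia.
by move: e; rewrite a0 mulr0 add0r.
Qed.

Section Operators.
Variable X : torModule G 1.
Implicit Types (u v w : X).

Definition letter_act (p : G * int) (a : int) : X -> X :=
  @act F G 1 X (Loop p.1 (const_mx a)).

(** The element [rho_check] + C d_1, whose bracket with a letter is [letter_degree] times that
    letter. *)
Definition grading_op (v : X) : X :=
  act (Loop (vsval (rho_check G)) 0) v + C%:R *: act (Deg ord0) v.

Lemma grading_op_linear : linear grading_op.
Proof.
apply: linear_funD; first exact: linear_eta.
by apply: linear_funZ; exact: linear_eta.
Qed.

Lemma grading_op_letter (p : G * int) a v : p \in q ->
  grading_op (letter_act p a v) = letter_act p a (grading_op v) +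
    (letter_degree p a)%:~R *: letter_act p a v.
Proof.
move=> pq; have [/(_ p pq) [b [bp be _ _]] _] := q_span.
rewrite /grading_op /letter_act loop0_loop deg_loop mxE (bp (rho_check G)) be loopZ.
rewrite [in RHS]linearD [act _ (C%:R *: _)]linearZ /= scalerDr scalerA.
rewrite /letter_degree rmorphD rmorphM /= scalerDl -!addrA; congr (_ + _).
by rewrite addrC -!addrA.
Qed.

Definition singular v := forall p a, p \in q -> 0 < letter_degree p a -> letter_act p a v = 0.

Lemma singular_closed : lin_closed singular.
Proof.
split; first by move=> p a _ _; rewrite /letter_act linear0.
move=> c u v su sv p a pq pa.
by rewrite /letter_act linearP -/(letter_act p a _) su // -/(letter_act p a _) sv // scaler0 addr0.
Qed.

Inductive low_closure (D : X -> Prop) : X -> Prop :=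
| low_closure0 : low_closure D 0
| low_closure_gen c u v : D u -> low_closure D v -> low_closure D (c *: u + v)
| low_closure_low p a c u v : p \in q -> letter_degree p a < 0 ->
    low_closure D u -> low_closure D v -> low_closure D (c *: letter_act p a u + v).

Lemma low_closure_closed D : lin_closed (low_closure D).
Proof.
split; first exact: low_closure0.
move=> c u v; elim=> [|b x y Dx _ IH|p a b x y pq pa Lx _ _ IH] Dv.
- by rewrite scaler0 add0r.
- by rewrite scalerDr scalerA -addrA; apply: low_closure_gen => //; apply: IH.
- by rewrite scalerDr scalerA -addrA; apply: low_closure_low => //; apply: IH.
Qed.

Lemma low_closure_in (D : X -> Prop) u : D u -> low_closure D u.
Proof.
move=> Du; rewrite -[u]addr0 -[u]scale1r; apply: low_closure_gen => //.
exact: low_closure0.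
Qed.

Lemma low_closure_min (D N : X -> Prop) : lin_closed N -> (forall u, D u -> N u) ->
  (forall p a u, p \in q -> letter_degree p a < 0 -> N u -> N (letter_act p a u)) ->
  forall u, low_closure D u -> N u.
Proof.
move=> [N0 cN] DN Nlow u; elim=> // [c x y Dx _ Ny|p a c x y pq pa _ Nx _ Ny].
  by apply: cN => //; apply: DN.
by apply: cN => //; apply: Nlow.
Qed.

Lemma act_letters (N : X -> Prop) v : lin_closed N ->
  (forall p a, p \in q -> N (letter_act p a v)) ->
  forall x m, N (act (Loop x m) v).
Proof.
move=> cN Nl x m; have [_ sp] := q_span; apply: (loop_span cN (sp x)).
by move=> _ [p pq ->]; rewrite (const_mx1 m); apply: Nl.
Qed.

(* The induction on lowering words proves stability under all generators at
   once, since the bracket of a generator with a letter is again a combination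
   of generators; no ordering of the words is involved. *)
Lemma low_closure_submodule (D : X -> Prop) :
  (forall u, D u -> singular u) ->
  (forall u H, D u -> H \in h -> low_closure D (act (Loop H 0) u)) ->
  (forall u, D u -> low_closure D (act (Deg ord0) u)) ->
  (forall u, D u -> low_closure D (act (Central 0 ord0) u)) ->
  submodule (low_closure D).
Proof.
move=> Dsing Dh Ddeg Dcen; have cL := low_closure_closed D.
have [L0 Lc] := cL; split=> // z v Lv.
have Ll p a u : p \in q -> letter_degree p a < 0 -> low_closure D u ->
    low_closure D (letter_act p a u).
  move=> pq pa Du; rewrite -[letter_act p a u]addr0 -[letter_act p a u]scale1r.
  exact: low_closure_low.
suff [_ /(_ z)] : low_closure D v /\ forall z, low_closure D (act z v) by [].
apply: (low_closure_min (N := fun v => _ /\ forall z, low_closure D (act z v))) Lv.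
- split; first by split=> // y; rewrite linear0.
  move=> a u w [Lu hu] [Lw hw]; split=> [|y]; first exact: Lc.
  by rewrite linearP; apply: Lc.
- move=> u Du; split=> [|[x m|m i|i]]; first exact: low_closure_in.
  + apply: act_letters => // p a pq.
    case: (ltrgt0P (letter_degree p a)) => pa.
    * by rewrite Dsing.
    * by apply: Ll => //; exact: low_closure_in.
    have [a0 p0] := letter_degree0 pq pa.
    have [/(_ p pq) [b [_ _ hb _]] _] := q_span.
    have [|_ ph] := hb; first by rewrite p0.
    rewrite /letter_act a0; have -> : const_mx 0 = 0 :> 'rV[int]_1.
      by apply/rowP => i; rewrite !mxE.
    exact: Dh.
  + have [->|m0] := eqVneq m 0; first by rewrite (ord1 i); apply: Dcen.
    by rewrite affine_central_eq0.
  + by rewrite (ord1 i); apply: Ddeg.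
move=> p a u pq pa [Lu IH]; split=> [|[x m|m i|i]]; first exact: Ll.
- rewrite /letter_act loop_loop; apply: lin_closedD => //; first exact: Ll.
  apply: lin_closedD => //; apply: lin_closedZ => //.
  by apply: lin_closed_sum => // j _ _; apply: lin_closedZ.
- by rewrite /letter_act central_comm //; apply: Ll.
by rewrite /letter_act deg_loop; apply: lin_closedD; rewrite ?mxE //;
  [exact: Ll | apply: lin_closedZ => //; exact: Ll].
Qed.

Lemma singular_loop0 u H : singular u -> H \in h -> singular (act (Loop H 0) u).
Proof.
move=> su Hh p a pq pa; have e : act (Loop p.1 (const_mx a)) u = 0 by exact: su.
have [/(_ p pq) [b [bp _ _ _]] _] := q_span.
have := loop0_loop H p.1 (const_mx a) u; rewrite e linear0 /letter_act.
rewrite -(vsprojK Hh) bp loopZ e scaler0 addr0 => <-.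
by [].
Qed.

Lemma singular_deg u : singular u -> singular (act (Deg ord0) u).
Proof.
move=> su p a pq pa; have e : act (Loop p.1 (const_mx a)) u = 0 by exact: su.
have := deg_loop ord0 p.1 (const_mx a) u.
by rewrite e linear0 scaler0 addr0 => /esym.
Qed.

Lemma singular_central u : singular u -> singular (act (Central 0 ord0) u).
Proof.
move=> su p a pq pa; have e : act (Loop p.1 (const_mx a)) u = 0 by exact: su.
by have := central0_comm ord0 (Loop p.1 (const_mx a)) u; rewrite e linear0 => /esym.
Qed.

Lemma grading_op_hfin u H : H \in h ->
  grading_op (act (Loop H 0) u) = act (Loop H 0) (grading_op u).
Proof.
move=> Hh; rewrite /grading_op loop0_loop hfin_abelian_in ?subvsP // loop0 addr0.
by rewrite deg_loop mxE scale0r addr0 [in RHS]linearD [in RHS]linearZ.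
Qed.

Lemma grading_op_deg u : grading_op (act (Deg ord0) u) = act (Deg ord0) (grading_op u).
Proof.
rewrite /grading_op [in RHS]linearD [in RHS]linearZ deg_loop mxE scale0r addr0.
by [].
Qed.

Lemma grading_op_central u :
  grading_op (act (Central 0 ord0) u) = act (Central 0 ord0) (grading_op u).
Proof.
by rewrite /grading_op [in RHS]linearD [in RHS]linearZ -!central0_comm.
Qed.

End Operators.

Section HighestWeight.
Variables (X : torModule G 1) (lam : affweight G) (v : X).
Hypothesis Xv : is_Xlambda lam v.
Local Notation P := (@grading_op X).

Lemma highest_neq0 : v != 0. Proof. by have [_ _ [v0 _ _ _] _] := Xv. Qed.

Lemma highest_loop0 (H : subvs_of h) : act (Loop (vsval H) 0) v = lam (H, 0, 0) *: v.
Proof. by have [_ _ [_ wv _ _] _] := Xv; rewrite -(wv (H, 0, 0)) hact_hfin. Qed.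

Lemma highest_central : act (Central 0 ord0) v = lam (hK1 G) *: v.
Proof.
have [_ _ [_ wv _ _] _] := Xv; rewrite -wv /hact /= loop0 add0r !big_ord1 !mxE.
by rewrite scale1r scale0r addr0.
Qed.

Lemma highest_deg : act (Deg ord0) v = lam (hd1 G) *: v.
Proof.
have [_ _ [_ wv _ _] _] := Xv; rewrite -wv /hact /= loop0 add0r !big_ord1 !mxE.
by rewrite scale1r scale0r add0r.
Qed.

Lemma highest_singular : singular v.
Proof.
move=> p a pq pa; have [_ _ [_ _ v1 v2] _] := Xv.
have a0 := letter_degree_gt0 pq pa.
have [a1|a1] := ltrP 0 a; first by rewrite /letter_act v1 // mxE.
have az : a = 0 by apply/eqP; rewrite eq_le a1.
have [/(_ p pq) [b [bp _ _ hp]] _] := q_span.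
rewrite /letter_act az; have -> : const_mx 0 = 0 :> 'rV[int]_1.
  by apply/rowP => i; rewrite !mxE.
apply: v2 bp; apply: hp.
by move: pa; rewrite /letter_degree az mulr0 add0r.
Qed.

Definition top_weight : F := lam (rho_check G, 0, 0) + C%:R * lam (hd1 G).

Lemma grading_op_highest : P v = top_weight *: v.
Proof. by rewrite /grading_op highest_loop0 highest_deg scalerA -scalerDl. Qed.

Lemma highest_generates (u : X) : low_closure (fun w => w = v) u.
Proof.
have sub : submodule (low_closure (fun w => w = v)).
  have Dv : low_closure (fun w => w = v) v by exact: low_closure_in.
  have cL := low_closure_closed (fun w => w = v).
  apply: low_closure_submodule => [w -> | w H -> Hh | w -> | w ->].
  - exact: highest_singular.
  - by rewrite -(vsprojK Hh) highest_loop0; apply: lin_closedZ.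
  - by rewrite highest_deg; apply: lin_closedZ.
  - by rewrite highest_central; apply: lin_closedZ.
have [_ _ _ cv] := Xv; have : (cyclic v) u by rewrite cv.
by apply; [exact: sub | exact: low_closure_in].
Qed.

Lemma level_scalar (u : X) : act (Central 0 ord0) u = lam (hK1 G) *: u.
Proof.
have [_ _ _ cv] := Xv; have : (cyclic v) u by rewrite cv.
apply: (cyclic_min (N := fun u => act (Central 0 ord0) u = lam (hK1 G) *: u));
  last exact: highest_central.
split; first by rewrite linear0 scaler0.
  by move=> a x y hx hy; rewrite linearP hx hy scalerDr !scalerA mulrC.
by move=> z x hx; rewrite central0_comm hx linearZ.
Qed.

(** Products of at most [len] letters with exponents between - [N] and 0. A lowering letter costs
    depth at least 1 and has exponent at most its cost in absolute value, so [words n n] spans the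
    vectors of depth n. *)
Fixpoint words (N len : nat) : seq X :=
  if len is len'.+1 then words N len' ++
    [seq letter_act l.1 (- l.2%:Z) u |
       l <- [seq (p, a) | p <- q, a <- iota 0 N.+1], u <- words N len']
  else [:: v].

Lemma words_letter N len (p : G * int) (a : nat) (u : X) :
  p \in q -> (a <= N)%N -> u \in words N len ->
  letter_act p (- a%:Z) u \in words N len.+1.
Proof.
move=> pq aN us; rewrite mem_cat; apply/orP; right.
apply: (allpairs_f (fun l w => letter_act l.1 (- l.2%:Z) w) _ us (x := (p, a))).
by apply: (allpairs_f (fun p a => (p, a)) pq); rewrite mem_iota.
Qed.

Lemma words_mono N N' len len' (u : X) : (N <= N')%N -> (len <= len')%N ->
  u \in words N len -> u \in words N' len'.
Proof.
move=> NN'; elim: len' len u => [|len' IH] [|len] u //.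
  by move=> _ us; rewrite mem_cat (IH 0%N).
rewrite ltnS => le; rewrite mem_cat => /orP[us|/allpairsP[[l w] [lN ws ->]]].
  by rewrite mem_cat (IH len).
have /allpairsP[[p a] [pq aN ->]] := lN.
apply: words_letter => //; last exact: IH ws.
by move: aN; rewrite mem_iota /= add0n ltnS => aN; apply: leq_trans NN'.
Qed.

Lemma affine_depth_graded : depth_graded P top_weight v.
Proof.
have lP := grading_op_linear (X := X).
exists (fun n => words n n) => [u|x].
  move=> /spanby_cons[c [w [/spanby_nil ->]]] ->; exists c.
  by rewrite addr0.
have cD := @depth_comp_closed F X P top_weight lP (fun n => words n n).
apply: (low_closure_min (N := lspan _) _ _ _ (highest_generates x)) => [|_ ->|p a u pq pa].
- exact: lspan_closed.
- apply: lspan_in; exists 0%N; split; first by rewrite subr0 grading_op_highest.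
  by apply: lspan_in; rewrite /= mem_head.
pose Tl : {linear X -> X} := @act F G 1 X (Loop p.1 (const_mx a)).
apply: (lspan_image (f := Tl)) => {}u [n [Pu su]].
have [a0 ad] := letter_degree_lt0 pq pa.
pose d := absz (letter_degree p a).
have dE : letter_degree p a = - d%:Z by rewrite /d; lia.
apply: lspan_in; exists (n + d)%N; split.
  rewrite -[Tl u]/(letter_act p a u) grading_op_letter // Pu /letter_act linearZ /=.
  by rewrite -scalerDl dE mulrNz natrD opprD addrA.
apply: (lspan_image (f := Tl)) su => w wn; apply: lspan_in.
have d1 : (0 < d)%N by rewrite /d; lia.
apply: (@words_mono (n + d) _ n.+1) => //; first by lia.
have -> : Tl w = letter_act p (- (absz a)%:Z) w.
  by rewrite /letter_act; congr (@act F G 1 X (Loop _ (const_mx _)) _); lia.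
apply: words_letter => //; first by lia.
by apply: words_mono wn => //; lia.
Qed.

Lemma highest_top (u : X) : P u = top_weight *: u -> exists c, u = c *: v.
Proof.
exact: (depth_top (grading_op_linear (X := X)) affine_depth_graded).
Qed.

(** The homogeneous components of a singular vector are singular. A nonzero one of depth n > 0 would
    generate, by lowering operators only, a submodule living in depths at least n; irreducibility
    would put the highest weight vector, of depth 0, into it. *)
Lemma singular_highest (u : X) : singular u -> exists c, u = c *: v.
Proof.
move=> su; have lP := grading_op_linear (X := X).
have [U U0 sp] := affine_depth_graded.
have [r [w [ur wE uE]]] := graded_decomposition (depth_comp_closed top_weight lP U) (sp u).
have Psing x : singular x -> singular (P x).
  move=> sx p a pq pa; have := grading_op_letter a x pq; rewrite sx //.
  have [g ->] := linear_pack lP; rewrite linear0 scaler0 addr0.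
  by move=> <-.
have sw : forall n, n \in r -> singular (w n).
  apply: (@depth_components F X P top_weight lP (@singular X) r w (@singular_closed X)) => //.
    by move=> m _; have [] := wE m.
  by rewrite -uE.
have w0 n : n \in r -> (0 < n)%N -> w n = 0.
  move=> nr n0; apply/eqP/negPn/negP => wn0.
  (* All singular vectors of this degree are taken rather than the line of [w n], because [D] must
     be stable under [h], and [w n] is only known to be an eigenvector of the grading. *)
  pose D x := singular x /\ P x = (top_weight - n%:R) *: x.
  have Din x : D x -> low_closure D x by exact: low_closure_in.
  have PZ c x : P (c *: x) = c *: P x by have [g ->] := linear_pack lP; rewrite linearZ.
  have sub : submodule (low_closure D).
    apply: low_closure_submodule => [x []//|x H [sx Px] Hh|x [sx Px]|x [sx Px]]; apply: Din.
    - by split; [exact: singular_loop0 | rewrite grading_op_hfin // Px linearZ].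
    - by split; [exact: singular_deg | rewrite grading_op_deg // Px linearZ].
    - by split; [exact: singular_central | rewrite grading_op_central // Px linearZ].
  have [[_ irr] _ _ _] := Xv.
  have Dw : low_closure D (w n) by apply: Din; split; [exact: sw | have [] := wE n].
  have [z|top] := irr _ sub.
    by move: wn0; rewrite (_ : w n = 0) ?eqxx //; have : low_closure D (w n) by []; rewrite z.
  have Lv : low_closure D v by rewrite top.
  pose E (m : nat) x := P x = (top_weight - m%:R) *: x /\ ((n <= m)%N \/ x = 0).
  have cE m : lin_closed (E m).
    have [e0 e1] := eigen_closed lP (top_weight - m%:R).
    split; first by split=> //; right.
    move=> c x y [Px nx] [Py ny]; split; first exact: e1.
    by case: nx => [|->]; [left|case: ny => [|->]; [left|right; rewrite scaler0 addr0]].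
  have [r' [w' [ur' w'E vE]]] : exists r w, [/\ uniq r, forall k, E k (w k) &
      v = \sum_(k <- r) w k].
    apply: graded_decomposition cE _.
    apply: (low_closure_min (N := lspan _) _ _ _ Lv) => [|x [sx Px]|p a x pq pa].
    - exact: lspan_closed.
    - by apply: lspan_in; exists n; split=> //; left.
    pose Tl : {linear X -> X} := @act F G 1 X (Loop p.1 (const_mx a)).
    apply: (lspan_image (f := Tl)) => {}x [m [Px nx]].
    pose d := absz (letter_degree p a).
    have dE : letter_degree p a = - d%:Z by rewrite /d; lia.
    apply: lspan_in; exists (m + d)%N; split.
      rewrite -[Tl x]/(letter_act p a x) grading_op_letter // Px /letter_act linearZ /=.
      by rewrite -scalerDl dE mulrNz natrD opprD addrA.
    by case: nx => [le|->]; [left; lia | right; rewrite linear0].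
  have w'0 k : k \in r' -> w' k = 0.
    move=> kr'; have [Pk [nk|//]] := w'E k.
    have cN := eigen_closed lP top_weight.
    have : P (w' k) = top_weight *: w' k.
      apply: (@depth_components F X P top_weight lP _ r' w' cN _ ur' _ _ k kr').
      - by move=> x Nx; rewrite Nx PZ Nx.
      - by move=> m _; have [] := w'E m.
      - by rewrite -vE; exact: grading_op_highest.
    rewrite Pk => /eqP; rewrite -subr_eq0 -scalerBl addrAC subrr add0r.
    rewrite scaler_eq0 oppr_eq0 pnatr_eq0 => /orP[/eqP k0|/eqP //].
    by move: nk; rewrite k0 leqn0 => /eqP nz; rewrite nz in n0.
  case/eqP: highest_neq0; rewrite vE big1_seq // => k /andP[_]; exact: w'0.
apply: highest_top; rewrite uE.
have [g gE] := linear_pack lP; rewrite gE linear_sum scaler_sumr -gE.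
apply: eq_big_seq => n nr; case: (posnP n) => [->|n0].
  by have [-> _] := wE 0%N; rewrite subr0.
by rewrite w0 // gE linear0 scaler0.
Qed.

End HighestWeight.
End GradedAffineModule.

(** * Levels are natural numbers *)

Section Levels.
Variables (F : numClosedFieldType) (G : simpleLie F).
Local Notation h := (hfin G).
Local Notation B := (@Defs.form F G).

(** With w n the n-th image of v under y, x sends w (n+1) to (n+1) (mu - n) w n; at the first n with
    w (n+1) = 0 this forces mu = n. *)
Lemma sl2_highest_weight_nat k (X : torModule G k) (x y H : G) (v : X) (mu : F) :
  lie x y = H -> lie H y = - 2 *: y -> v != 0 ->
  act (Loop x 0) v = 0 -> act (Loop H 0) v = mu *: v ->
  locally_nilpotent (@act F G k X (Loop y 0)) -> exists n : nat, mu = n%:R.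
Proof.
move=> xyH Hy v0 xv Hv nil.
set f := @act F G k X (Loop y 0) in nil *.
pose w n := iter n f v.
have wS n : w n.+1 = act (Loop y 0) (w n) by [].
have Hw n : act (Loop H 0) (w n) = (mu - 2 * n%:R) *: w n.
  elim: n => [|n IH]; first by rewrite mulr0 subr0.
  rewrite wS loop0_loop Hy loopZ IH linearZ /= -scalerDl.
  by congr (_ *: _); rewrite -[n.+1]addn1 natrD; ring.
have xw n : act (Loop x 0) (w n.+1) = (n.+1%:R * (mu - n%:R)) *: w n.
  elim: n => [|n IH].
    by rewrite wS loop0_loop xv linear0 add0r xyH Hv mul1r subr0.
  rewrite wS loop0_loop xyH IH linearZ /= -wS Hw -scalerDl.
  by congr (_ *: _); rewrite -[n.+2]addn1 -[n.+1]addn1 !natrD; ring.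
have [N wN] := nil v; rewrite -/(w N) in wN.
elim: N wN => [|N IH] wN; first by case/eqP: v0.
have [/IH //|wN0] := eqVneq (w N) 0.
have := xw N; rewrite wN linear0 => /esym/eqP.
rewrite scaler_eq0 (negPf wN0) orbF mulf_eq0 pnatr_eq0 /= subr_eq0 => /eqP ->.
by exists N.
Qed.

(** Nondegeneracy gives a homogeneous b with (x|b) nonzero, and invariance forces its weight to be -
    theta. Then [x, b] lies in [h] and equals (x|b) times the element representing theta; the scalar
    [c] below rescales it to the coroot. *)
Lemma theta_sl2 (q : seq (G * int)) : homogeneous_spanning q ->
  dual_form B (theta G) (theta G) != 0 ->
  exists x y : G, [/\ in_root_space (theta G) x, in_root_space (- theta G) y,
    y != 0, lie x y = vsval (coroot (theta G)) &
    lie (vsval (coroot (theta G))) y = - 2 *: y].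
Proof.
move=> [qh qs] tt0; have [[th0 [x x0 xth]] _] := theta_highest G.
have [b [bq xb]] : exists b, (exists2 p, p \in q & b = p.1) /\ B x b != 0.
  apply: contrapT => hn; case/eqP: x0; apply: form_nondegenerate => z.
  have cN : lin_closed (fun z => B x z = 0).
    split; first exact: form0r.
    by move=> a u w hu hw; rewrite formDZr hu hw mulr0 addr0.
  apply: (lspan_min cN _ (qs z)) => u uq; apply/eqP/negPn/negP => xu.
  by apply: hn; exists u.
have [p pq bp] := bq; have [a [ba _ _ _]] := qh p pq; rewrite -bp in ba.
have aE : a = - theta G.
  apply/lfunP => H; rewrite opp_lfunE; apply/eqP; rewrite -addr_eq0; apply/eqP.
  have e : a H * B x b = - (theta G H * B x b).
    by rewrite -formZr -ba -form_lie lieC xth -scaleNr formC formZr formC mulNr.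
  by apply: (mulIf xb); rewrite mul0r mulrDl e addNr.
have xbh : lie x b \in h.
  apply: commutant_hfin => H Hh; rewrite -(vsprojK Hh) lie_derivation xth ba aE.
  by rewrite lieZl linearZ /= opp_lfunE -scalerDl addrN scale0r.
have xbE : lie x b = B x b *: t_ (theta G).
  apply/eqP; rewrite -subr_eq0; apply/eqP; apply: hfin_form_nondegenerate.
    by apply: memvB => //; apply: memvZ; apply: subvsP.
  move=> z zh; rewrite formC formDr -scaleN1r !formZr -(formC _ z) -(formC _ z).
  rewrite form_lie -(vsprojK zh) t_P lieC ba aE opp_lfunE scaleNr opprK formZr.
  by rewrite mulN1r mulrC subrr.
pose c := 2 / dual_form B (theta G) (theta G) / B x b.
have coE : vsval (coroot (theta G)) = (2 / dual_form B (theta G) (theta G)) *: t_ (theta G).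
  by rewrite /coroot /form_coroot linearZ.
have cby : in_root_space (- theta G) (c *: b).
  by move=> H; rewrite linearZ /= ba aE !scalerA mulrC.
exists x, (c *: b); split=> //.
- rewrite scaler_eq0 negb_or /c !mulf_neq0 ?invr_neq0 ?pnatr_eq0 //.
  by apply: contraNneq xb => ->; rewrite form0r.
- by apply: etrans (esym coE); rewrite linearZ /= xbE scalerA /c divfK.
- apply: etrans (cby _) _; rewrite opp_lfunE; congr (- _ *: _).
  by rewrite /coroot /form_coroot linearZ /= -dual_form_eval /GRing.scale /= divfK.
Qed.

(** K_1 is the affine simple coroot plus the coroot of theta. The first has a natural value because
    [lam] is dominant; the second because of the sl2-triple of theta, without expanding that coroot
    in simple coroots. *)
Lemma level_nat (q : seq (G * int)) (lam : affweight G) (X : torModule G 1) (v : X) :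
  homogeneous_spanning q -> dual_form B (theta G) (theta G) != 0 ->
  Paff_plus lam -> is_Xlambda lam v -> exists n : nat, lam (hK1 G) = n%:R.
Proof.
move=> qs tt0 [L [d [c [z [Lf [d1 d2 d3] lamE]]]]] Xv.
have [x [y [xth yth y0 xyE Hy]]] := theta_sl2 qs tt0.
have [_ [_ nilX] [v0 wv _ v2] _] := Xv.
have [rth thh] := theta_highest G.
have pth : positive_root (theta G).
  split=> //; have [ra _ roots] := alpha_base G.
  have [i _] : exists i : 'I_(rank G), true.
    apply: contrapT => hn; have [th0 _] := rth; case/eqP: th0.
    have [m mE] := roots _ rth.
    have s0 : \sum_i alpha i *+ m i = 0 :> dual h.
      by rewrite big1 // => i _; case: hn; exists i.
    by case: mE => ->; rewrite s0 ?oppr0.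
  have [m ->] := thh _ (ra i); exists (fun j => (i == j) + m j)%N.
  under [RHS]eq_bigr do rewrite mulrnDr.
  rewrite big_split /=; congr (_ + _); rewrite (bigD1 i) //= eqxx big1 ?addr0 //.
  by move=> j /negPf; rewrite eq_sym => ->.
have [rmth] : is_root (- theta G).
  by have [th0 _] := rth; split; [rewrite oppr_eq0 | exists y].
move=> _.
have Hv : act (Loop (vsval (coroot (theta G))) 0) v = lam (coroot (theta G), 0, 0) *: v.
  by rewrite -(wv (coroot (theta G), 0, 0)) hact_hfin.
have rm : is_root (- theta G) by split=> //; exists y.
have [n nE] := sl2_highest_weight_nat xyE Hy v0 (v2 _ _ pth xth) Hv (nilX _ _ 0 rm yth).
have co : lam (aff_coroot ord_max) = (c ord_max)%:R.
  have dco : d (aff_coroot ord_max) = 0.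
    by rewrite /aff_coroot unlift_none linearB /= d2 d1 subrr.
  rewrite lamE add_lfunE scale_lfunE dco scaler0 addr0 sum_lfunE (bigD1 ord_max) //=.
  have Lc i : (L i *+ c i) (aff_coroot ord_max) = (c i)%:R * (i == ord_max)%:R.
    rewrite -scaler_nat scale_lfunE; have [-> _] := Lf i.
    by rewrite /GRing.scale.
  by rewrite Lc eqxx mulr1 big1 ?addr0 // => i /negPf ni; rewrite Lc ni mulr0.
exists (c ord_max + n)%N; rewrite natrD -co -nE -linearD /aff_coroot unlift_none.
by rewrite subrK.
Qed.

End Levels.

(** * Tensor products *)

Section LinearClosedPredicates.
Variables (F : fieldType) (U V : lmodType F).

Lemma eq_linear_closed (f g : U -> V) : linear f -> linear g ->
  lin_closed (fun u => f u = g u).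
Proof.
move=> lf lg; have [f' ->] := linear_pack lf; have [g' ->] := linear_pack lg.
by split=> [|a u v hu hv]; rewrite ?linear0 // !linearP hu hv.
Qed.

Lemma linear_comp (W : lmodType F) (f : V -> W) (g : U -> V) :
  linear f -> linear g -> linear (fun u => f (g u)).
Proof. by move=> lf lg a u v; rewrite lg lf. Qed.

Lemma linear_funN (f : U -> V) : linear f -> linear (fun u => - f u).
Proof. by move=> lf a u v; rewrite lf opprD scalerN. Qed.

Lemma linear_funB (f g : U -> V) : linear f -> linear g -> linear (fun u => f u - g u).
Proof. by move=> lf lg; apply: linear_funD => //; apply: linear_funN. Qed.

Lemma linear_fun0 : linear (fun _ : U => 0 : V).
Proof. by move=> a u v; rewrite scaler0 addr0. Qed.

Lemma lspan_indexed (J : Type) (P : J -> Prop) (B : J -> V) u :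
  lspan (fun w => exists2 j, P j & w = B j) u ->
  u = 0 \/ exists n (j : nat -> J) (c : nat -> F),
    (forall i, P (j i)) /\ u = \sum_(i < n) c i *: B (j i).
Proof.
elim=> [|a _ w [j Pj ->] _ IH]; first by left.
right; have [n [j' [c [Pj' ->]]]] : exists n (j : nat -> J) (c : nat -> F),
    (forall i, P (j i)) /\ w = \sum_(i < n) c i *: B (j i).
  by case: IH => // ->; exists 0%N, (fun=> j), (fun=> 0); rewrite big_ord0.
exists n.+1, (fun i => if i is i'.+1 then j' i' else j),
  (fun i => if i is i'.+1 then c i' else a); split; first by case.
by rewrite big_ord_recl.
Qed.

End LinearClosedPredicates.

Section SubspaceType.
Variables (F : fieldType) (V : lmodType F) (N : V -> Prop).

Definition subspace_pred of lin_closed N : {pred V} := fun w => `[< N w >].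

Variable cN : lin_closed N.

Lemma subspace_pred_closed : submod_closed (subspace_pred cN).
Proof.
have [c0 c1] := cN; split; first exact/asboolP.
by move=> a u w /asboolP Nu /asboolP Nw; apply/asboolP; exact: c1.
Qed.

HB.instance Definition _ := GRing.isSubmodClosed.Build F V (subspace_pred cN)
  subspace_pred_closed.

Record subspace_sort := SubspaceElt {
  subspace_val : V;
  subspace_valP : subspace_val \in subspace_pred cN
}.

HB.instance Definition _ := [isSub for subspace_val].
HB.instance Definition _ := [Choice of subspace_sort by <:].
HB.instance Definition _ := [SubChoice_isSubLmodule of subspace_sort by <:].

Definition subspace_incl : {linear subspace_sort -> V} := val.

End SubspaceType.

Section Tensor.
Variables (F : fieldType) (I : finType) (X : I -> lmodType F).
Variables (W : lmodType F) (t : (forall i, X i) -> W).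
Hypothesis tP : is_tensor_product t.
Implicit Types (x : forall i, X i).

Lemma tens_linear x i : linear (fun y : X i => t (dfwith x y)).
Proof. by have [ml _] := tP; apply: ml. Qed.

Lemma dfwith_same x i (y z : X i) : dfwith (dfwith x y) z = dfwith x z.
Proof.
apply: functional_extensionality_dep => j; case: (eqVneq i j) => [ij|ij].
  by case: j / ij; rewrite !dfwith_in.
by rewrite !dfwith_out.
Qed.

Lemma dfwith_swap x i j (y : X i) (z : X j) : i != j ->
  dfwith (dfwith x y) z = dfwith (dfwith x z) y.
Proof.
move=> ij; apply: functional_extensionality_dep => l.
case: (eqVneq i l) => [il|il].
  by case: l / il; rewrite dfwith_in dfwith_out ?dfwith_in // eq_sym.
case: (eqVneq j l) => [jl|jl].
  by case: l / jl il => il; rewrite dfwith_in dfwith_out // dfwith_in.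
by rewrite !dfwith_out.
Qed.

Lemma dfwith_id x i : dfwith x (x i) = x.
Proof.
apply: functional_extensionality_dep => j; case: (eqVneq i j) => [ij|ij].
  by case: j / ij; rewrite dfwith_in.
by rewrite dfwith_out.
Qed.

(** Only the universal property is available. Corestricting [t] to the subspace [N] yields a linear
    map from [W] to [N]; followed by the inclusion it agrees with the identity on pure tensors,
    hence everywhere by uniqueness. *)
Lemma tens_ind (N : W -> Prop) : lin_closed N -> (forall x, N (t x)) -> forall w, N w.
Proof.
move=> cN Nt w; have [_ univ] := tP.
pose b x : subspace_sort cN := SubspaceElt (introT (asboolP _) (Nt x) : t x \in subspace_pred cN).
have mb : multilinear b.
  move=> x i a u v; apply: val_inj; rewrite linearP /=.
  exact: tens_linear.
have [[f fE] _] := univ _ _ mb.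
have [mt _] := tP; have [_ uniq] := univ _ _ mt.
have e : subspace_incl cN (f w) = w.
  pose g : W -> W := fun w => subspace_incl cN (f w).
  have lg : linear g by move=> a u v; rewrite /g !linearP.
  have [g' gE] := linear_pack lg.
  have := uniq g' idfun; rewrite -gE; apply=> // x.
  by rewrite /g fE.
by rewrite -e; have /asboolP := subspace_valP (f w).
Qed.

Lemma tens_lspan (Q : forall i, X i -> Prop) (N : W -> Prop) x : lin_closed N ->
  (forall i, lspan (@Q i) (x i)) -> (forall y, (forall i, Q i (y i)) -> N (t y)) -> N (t x).
Proof.
move=> cN Qx Nt.
suff ext (l : seq I) x' : (forall i, lspan (@Q i) (x' i)) ->
    (forall i, i \notin l -> Q i (x' i)) -> N (t x').
  by apply: (ext (enum I)) => // i; rewrite mem_enum.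
elim: l x' => [|i l IH] x' Qx' xl; first by apply: Nt => i; apply: xl.
rewrite -(dfwith_id x' i).
have [g gE] := linear_pack (@tens_linear x' i).
rewrite -[t _]/((fun y => t (dfwith x' y)) (x' i)) gE.
apply: (lspan_min (N := fun y => N (g y))) (Qx' i).
  have [N0 N1] := cN; split=> [|a u v Nu Nv]; first by rewrite linear0.
  by rewrite linearP; apply: N1.
move=> u Qu; rewrite -gE; apply: IH => j.
  by case: (eqVneq i j) => [ij|ij]; [case: j / ij; rewrite dfwith_in; apply: lspan_in
    | rewrite dfwith_out].
move=> jl; case: (eqVneq i j) => [ij|ij]; first by case: j / ij jl; rewrite dfwith_in.
by rewrite dfwith_out //; apply: xl; rewrite in_cons negb_or jl eq_sym ij.
Qed.

Lemma tens_span_ind (Q : forall i, X i -> Prop) (N : W -> Prop) : lin_closed N ->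
  (forall i (u : X i), lspan (@Q i) u) ->
  (forall y, (forall i, Q i (y i)) -> N (t y)) -> forall w, N w.
Proof. by move=> cN Qs Nt; apply: tens_ind => // x; apply: tens_lspan Nt. Qed.

Lemma tens_eq (V : lmodType F) (f g : W -> V) : linear f -> linear g ->
  (forall x, f (t x) = g (t x)) -> forall w, f w = g w.
Proof. by move=> lf lg; apply: tens_ind; apply: eq_linear_closed. Qed.

Lemma factor_exists i (T : {linear X i -> X i}) :
  {f : {linear W -> W} | forall x, f (t x) = t (dfwith x (T (x i)))}.
Proof.
apply: cid; have [_ univ] := tP.
pose b x := t (dfwith x (T (x i))).
have mb : multilinear b; last by have [] := univ _ _ mb.
move=> x j; rewrite /b; case: (eqVneq i j) => [ij|ij].
  case: j / ij => a u v; rewrite !dfwith_in !dfwith_same linearP.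
  exact: tens_linear.
have ji : j != i by rewrite eq_sym.
have e (y : X j) : dfwith (dfwith x y) (T (dfwith x y i)) = dfwith (dfwith x (T (x i))) y.
  by rewrite dfwith_out // dfwith_swap.
by move=> a u v; rewrite !e; exact: tens_linear.
Qed.

Definition factor_op i (T : {linear X i -> X i}) : {linear W -> W} :=
  projT1 (factor_exists T).

Lemma factor_opE i (T : {linear X i -> X i}) x :
  factor_op T (t x) = t (dfwith x (T (x i))).
Proof. by rewrite /factor_op; case: factor_exists. Qed.

Lemma factor_op_dfwith i (T : {linear X i -> X i}) x (y : X i) :
  factor_op T (t (dfwith x y)) = t (dfwith x (T y)).
Proof. by rewrite factor_opE dfwith_in dfwith_same. Qed.

Lemma factor_op_comm i j (T : {linear X i -> X i}) (S : {linear X j -> X j}) w :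
  i != j -> factor_op T (factor_op S w) = factor_op S (factor_op T w).
Proof.
move=> ij; move: w; apply: tens_eq => [||x].
- by apply: linear_comp; exact: linear_eta.
- by apply: linear_comp; exact: linear_eta.
have ji : j != i by rewrite eq_sym.
by rewrite !factor_opE (dfwith_out _ _ ji) (dfwith_out _ _ ij) dfwith_swap.
Qed.

End Tensor.

Section ImagesOfModules.
Variables (F : numClosedFieldType) (G : simpleLie F) (k : nat).

(** Each axiom is an equality of linear maps in the vector, so it may be tested on a family of
    equivariant images of genuine modules that spans [W]. *)
Lemma tor_axioms_images (W : lmodType F) (op : tor_gen G k -> {linear W -> W}) :
  (forall N : W -> Prop, lin_closed N ->
     (forall (X : torModule G k) (L : {linear X -> W}),
        (forall z x, op z (L x) = L (act z x)) -> forall x, N (L x)) ->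
     forall w, N w) ->
  tor_axioms op.
Proof.
move=> sp.
have eqs (f g : W -> W) : linear f -> linear g ->
    (forall (X : torModule G k) (L : {linear X -> W}),
        (forall z x, op z (L x) = L (act z x)) -> forall x, f (L x) = g (L x)) ->
    forall w, f w = g w.
  by move=> lf lg; apply: sp; apply: eq_linear_closed.
have lop z : linear (fun v => op z v) by exact: linear_eta.
have lcomm z z' : linear (comm (op z) (op z')).
  by apply: linear_funB; apply: linear_comp.
have lsum (r : 'rV[int]_k) m : linear (fun v => \sum_i (r 0 i)%:~R *: op (Central m i) v).
  by apply: linear_fun_sum => i; apply: linear_funZ.
split.
- move=> m v a x y; move: v; apply: eqs => [||X L LE v] //.
    by apply: linear_funD => //; apply: linear_funZ.
  by rewrite !LE (loop_linear m v a x y) linearP.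
- move=> r; apply: eqs => [||X L LE v] //; first exact: linear_fun0.
  under eq_bigr do rewrite LE -linearZ.
  by rewrite -linear_sum (act_central_rel (actP X)) linear0.
- move=> x y m s; apply: eqs => [||X L LE v] //.
    by apply: linear_funD => //; apply: linear_funZ.
  rewrite /comm !LE -linearB -/(comm _ _ _) (act_loop_loop (actP X)) linearD linearZ.
  rewrite linear_sum; congr (_ + _ *: _); apply: eq_bigr => i _.
  by rewrite LE linearZ.
- move=> r i x m; apply: eqs => [||X L LE v] //; first exact: linear_fun0.
  by rewrite /comm !LE -linearB -/(comm _ _ _) (act_central_loop (actP X)) linear0.
- move=> r i s j; apply: eqs => [||X L LE v] //; first exact: linear_fun0.
  by rewrite /comm !LE -linearB -/(comm _ _ _) (act_central_central (actP X)) linear0.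
- move=> i x m; apply: eqs => [||X L LE v] //; first exact: linear_funZ.
  by rewrite /comm !LE -linearB -/(comm _ _ _) (act_deg_loop (actP X)) linearZ.
- move=> i m j; apply: eqs => [||X L LE v] //; first exact: linear_funZ.
  by rewrite /comm !LE -linearB -/(comm _ _ _) (act_deg_central (actP X)) linearZ.
- move=> i j; apply: eqs => [||X L LE v] //; first exact: linear_fun0.
  by rewrite /comm !LE -linearB -/(comm _ _ _) (act_deg_deg (actP X)) linear0.
Qed.

(** Replaces linear independence of the coefficients. The vectors [y] with [f n y] in the sum of the
    earlier images form a submodule. If it is everything, the last term is absorbed into the others;
    if it is 0, each operator in [Z] must kill [x n], which is then a multiple of [v]. *)
Lemma singular_sum (X : torModule G k) (P : lmodType F) (op : tor_gen G k -> P -> P)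
    (Z : tor_gen G k -> Prop) (v : X) (n : nat) (f : nat -> {linear X -> P}) (x : nat -> X) :
  irreducible X -> (forall u : X, (forall z, Z z -> act z u = 0) -> exists c, u = c *: v) ->
  (forall z, linear (op z)) -> (forall j z y, f j (act z y) = op z (f j y)) ->
  (forall z, Z z -> op z (\sum_(j < n) f j (x j)) = 0) ->
  lspan (fun w => exists j, w = f j v) (\sum_(j < n) f j (x j)).
Proof.
move=> [_ irr] sing lop fop; elim: n x => [|n IH] x hs.
  by rewrite big_ord0; apply: lspan0.
pose S (y : X) := exists y' : nat -> X, f n y = \sum_(j < n) f j (y' j).
have sumop z y' : op z (\sum_(j < n) f j (y' j)) = \sum_(j < n) f j (act z (y' j)).
  have [g gE] := linear_pack (lop z); rewrite gE linear_sum -gE.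
  by apply: eq_bigr => j _; rewrite fop.
have Ssub : submodule S.
  split.
  - by exists (fun=> 0); rewrite linear0 big1 // => j _; rewrite linear0.
  - move=> a y w [y' yE] [w' wE]; exists (fun j => a *: y' j + w' j).
    rewrite linearP /= yE wE scaler_sumr -big_split; apply: eq_bigr => j _.
    by rewrite linearP.
  - by move=> z y [y' yE]; exists (fun j => act z (y' j)); rewrite fop yE sumop.
have [S0|ST] := irr _ Ssub; last first.
  have [y' yE] : S (x n) by rewrite ST.
  have e : \sum_(j < n.+1) f j (x j) = \sum_(j < n) f j (x j + y' j).
    by rewrite big_ord_recr /= yE -big_split; apply: eq_bigr => j _; rewrite linearD.
  by rewrite e; apply: (IH (fun j => x j + y' j)) => z Zz; rewrite -e; apply: hs.
have xn0 z : Z z -> act z (x n) = 0.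
  move=> Zz; suff : S (act z (x n)) by rewrite S0.
  exists (fun j => - act z (x j)); have := hs z Zz.
  rewrite big_ord_recr /=; have [g gE] := linear_pack (lop z).
  rewrite gE linearD -gE -fop sumop addrC => /eqP; rewrite addr_eq0 => /eqP ->.
  by rewrite -sumrN; apply: eq_bigr => j _; rewrite linearN.
have [c xnE] := sing _ xn0.
rewrite big_ord_recr /=; apply: lin_closedD; first exact: lspan_closed.
  apply: (IH x) => z Zz; have := hs z Zz; rewrite big_ord_recr /=.
  have [g gE] := linear_pack (lop z).
  by rewrite gE linearD -gE -fop xn0 // linear0 addr0.
rewrite xnE linearZ; apply: lin_closedZ; first exact: lspan_closed.
by apply: lspan_in; exists n.
Qed.

End ImagesOfModules.

Section TopFunctional.
Variables (F : numClosedFieldType) (W : lmodType F) (P : W -> W) (Lam : F) (v : W).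
Hypotheses (lP : linear P) (gv : depth_graded P Lam v) (Pv : P v = Lam *: v) (v0 : v != 0).

Let E (n : nat) (u : W) := P u = (Lam - n%:R) *: u.
Let N := lspan (fun u => exists n, E n.+1 u).

Let N_top c : N (c *: v) -> c = 0.
Proof.
move=> Ncv; have cE n : lin_closed (E n.+1) by exact: eigen_closed.
have [r [w [ur wE cvE]]] := graded_decomposition cE Ncv.
have wE' n : n \in [seq i.+1 | i <- r] -> P (w n.-1) = (Lam - n%:R) *: w n.-1.
  by move=> /mapP[m _ ->]; apply: wE.
have cvE' : c *: v = \sum_(n <- [seq i.+1 | i <- r]) w n.-1 by rewrite big_map.
have [g gE] := linear_pack lP.
have PZ a x : P (a *: x) = a *: P x by rewrite gE linearZ.
have H n : n \in [seq i.+1 | i <- r] -> P (w n.-1) = Lam *: w n.-1.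
  apply: (@depth_components F W P Lam lP (fun x => P x = Lam *: x)
    [seq i.+1 | i <- r] (fun n => w n.-1) (eigen_closed lP Lam)) => //.
  - by move=> x Px; rewrite Px PZ Px.
  - by rewrite map_inj_uniq // => i j [].
  - by rewrite -cvE' PZ Pv !scalerA mulrC.
have w0 n : n \in r -> w n = 0.
  move=> nr; have nr' : n.+1 \in [seq i.+1 | i <- r] by apply: map_f.
  have := H _ nr'; rewrite (wE' _ nr') /= => /eqP.
  rewrite -subr_eq0 -scalerBl addrAC subrr add0r scaler_eq0 oppr_eq0 pnatr_eq0.
  by move/eqP.
have : c *: v = 0 by rewrite cvE big1_seq // => n /andP[_]; apply: w0.
by move/eqP; rewrite scaler_eq0 (negPf v0) orbF => /eqP.
Qed.

(** The projection to the line of [v] along [N], the span of the eigenvectors of positive depth. *)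
Lemma top_functional : exists phi : {linear W -> F^o}, phi v = 1.
Proof.
have cN : lin_closed N by exact: lspan_closed.
have ex u : exists c : F, N (u - c *: v).
  have [U U0 sp] := gv.
  elim: (sp u) => [|a x y [n [Px sx]] _ [c Nc]].
    by exists 0; rewrite scale0r subr0; case: cN.
  case: n Px sx => [|n] Px sx.
    have [b bE] := U0 _ sx; exists (a * b + c).
    by rewrite bE scalerDl scalerA opprD addrACA subrr add0r.
  exists c; rewrite -addrA; apply: lin_closedD => //; apply: lin_closedZ => //.
  by apply: lspan_in; exists n.
pose phi u := projT1 (cid (ex u)).
have phiP u : N (u - phi u *: v) by rewrite /phi; case: cid.
have phi_uniq u c : N (u - c *: v) -> phi u = c.
  move=> Nc; have := lin_closedB cN Nc (phiP u); rewrite opprB addrC subrKA -scalerBl.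
  by move/N_top/eqP; rewrite subr_eq0 => /eqP.
have lphi : linear (phi : W -> F^o).
  move=> a x y; apply: phi_uniq; rewrite scalerDl -[a *: (phi x : F^o)]/(a * phi x).
  rewrite -scalerA opprD addrACA -scalerBr.
  by apply: lin_closedD => //; apply: lin_closedZ.
have [g gE] := linear_pack lphi; exists g.
by rewrite -gE; apply: phi_uniq; rewrite scale1r subrr; case: cN.
Qed.

End TopFunctional.

Section FactorModules.
Variables (F : numClosedFieldType) (G : simpleLie F).
Variables (I : finType) (X : I -> torModule G 1) (W : lmodType F).
Variables (t : (forall i, X i) -> W) (tP : is_tensor_product t).

(** Acting in a single position makes all of [W] an affine module, so that results on affine modules
    apply to [W] one position at a time. *)
Definition factor_act (i : I) (z : tor_gen G 1) : {linear W -> W} :=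
  factor_op tP (@act F G 1 (X i) z).

Definition slot (x : forall i, X i) i : {linear X i -> W} :=
  projT1 (linear_pack (@tens_linear F I X W t tP x i)).

Lemma slotE x i y : slot x i y = t (dfwith x y).
Proof. by rewrite /slot; case: linear_pack => /= g <-. Qed.

Lemma factor_act_slot i z x (y : X i) : factor_act i z (slot x i y) = slot x i (act z y).
Proof. by rewrite !slotE; exact: factor_op_dfwith. Qed.

Lemma factor_act_tens i z x : factor_act i z (t x) = slot x i (act z (x i)).
Proof. by rewrite slotE; exact: factor_opE. Qed.

Lemma slot_id x i : slot x i (x i) = t x.
Proof. by rewrite slotE dfwith_id. Qed.

Lemma factor_actP i : tor_axioms (factor_act i).
Proof.
apply: tor_axioms_images => N cN NL; apply: (tens_ind tP cN) => x.
by rewrite -(slot_id x i); apply: NL => z y; apply: factor_act_slot.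
Qed.

Definition factor_module i : torModule G 1 := TorModule (factor_actP i).

Lemma factor_act_comm i j z z' w : i != j ->
  factor_act i z (factor_act j z' w) = factor_act j z' (factor_act i z w).
Proof. exact: factor_op_comm. Qed.

Lemma factor_nilpotent i z : locally_nilpotent (@act F G 1 (X i) z) ->
  locally_nilpotent (factor_act i z).
Proof.
move=> nil; have it0 n : iter n (factor_act i z) 0 = 0.
  by elim: n => //= n ->; rewrite linear0.
have itD n : linear (iter n (factor_act i z)).
  by elim: n => [|n IH] // a u w /=; rewrite IH linearP.
apply: (tens_ind tP).
  split; first by exists 0%N.
  move=> a u w [n hn] [m hm]; exists (n + m)%N.
  by rewrite itD [in X in X + _]addnC !iterD hn hm !it0 scaler0 addr0.
move=> x; have [n hn] := nil (x i); exists n.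
rewrite -(slot_id x i); have -> : iter n (factor_act i z) (slot x i (x i)) =
    slot x i (iter n (act z) (x i)).
  by elim: n {hn} => //= n ->; rewrite factor_act_slot.
by rewrite hn linear0.
Qed.

Lemma tens_weight (mu : I -> affweight G) (y : forall i, X i) :
  (forall i, in_weight_space (mu i) (y i)) ->
  forall i, in_weight_space (V := factor_module i) (mu i) (t y).
Proof.
move=> yw i H; rewrite -(slot_id y i) -linearZ /= -(yw i H) /hact /=.
rewrite !factor_act_slot !linearD !linear_sum; congr (_ + _ + _);
  by apply: eq_bigr => j _; rewrite linearZ /= factor_act_slot.
Qed.

Lemma factor_weights : (forall i, Defs.diagonalizable (X i)) ->
  forall w, lspan (fun u => exists mu : I -> affweight G,
     forall i, in_weight_space (V := factor_module i) (mu i) u) w.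
Proof.
move=> dX; apply: (tens_span_ind tP (lspan_closed _)
  (fun i u => diagonalizable_lspan (dX i) u)) => y yw.
apply: lspan_in; exists (fun i => projT1 (cid (yw i))); apply: tens_weight => i.
by case: cid.
Qed.

Section HighestWeightFactors.
Variables (q : seq (G * int)) (C : nat).
Hypothesis q_span : homogeneous_spanning q.
Hypothesis C_bound : forall p : G * int, p \in q -> `|p.2| < C%:Z.
Variables (lam : I -> affweight G) (v : forall i, X i).
Hypothesis Xv : forall i, is_Xlambda (lam i) (v i).

Lemma factor_level i w : factor_act i (Central 0 ord0) w = lam i (hK1 G) *: w.
Proof.
move: w; apply: (tens_eq tP) => [||x]; first exact: linear_eta.
  exact: linear_funZ.
by rewrite factor_act_tens (level_scalar (Xv i)) linearZ /= slot_id.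
Qed.

Lemma factor_generate (N : W -> Prop) : lin_closed N -> N (t v) ->
  (forall i x m u, N u -> N (factor_act i (Loop x m) u)) -> forall w, N w.
Proof.
move=> cN Nv Nact; apply: (tens_ind tP cN) => x.
suff ext (l : seq I) x' : (forall i, i \notin l -> x' i = v i) -> N (t x').
  by apply: (ext (enum I)) => i; rewrite mem_enum.
elim: l x' => [|i l IH] x' xl.
  by have -> : x' = v by apply: functional_extensionality_dep => i; apply: xl.
rewrite -(slot_id x' i); have [N0 N1] := cN.
apply: (low_closure_min (N := fun y => N (slot x' i y)) _ _ _
  (highest_generates q_span C_bound (Xv i) (x' i))) => [|_ ->|p a u _ _ Nu].
- split; first by rewrite linear0.
  by move=> a y z Ny Nz; rewrite linearP; apply: N1.
- rewrite slotE; apply: IH => j jl.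
  case: (eqVneq i j) => [ij|ij]; first by case: j / ij jl; rewrite dfwith_in.
  by rewrite dfwith_out // xl // in_cons negb_or eq_sym ij.
by rewrite /letter_act -factor_act_slot; apply: Nact.
Qed.

Definition total_grading (w : W) : W :=
  \sum_i (@grading_op F G C (factor_module i) w : W).

Definition total_weight : F := \sum_i top_weight C (lam i).

Lemma total_grading_linear : linear total_grading.
Proof. by apply: linear_fun_sum => i; exact: (@grading_op_linear F G C (factor_module i)). Qed.

Lemma total_depth_graded : depth_graded total_grading total_weight (t v).
Proof.
have gX i := affine_depth_graded q_span C_bound (Xv i).
pose U i := projT1 (cid2 (gX i)).
have U0 i u : spanby (U i 0%N) u -> exists c, u = c *: v i.
  by rewrite /U; case: cid2 => /= U' h1 _; apply: h1.
have Us i u : lspan (fun u => exists n, depth_comp (@grading_op F G C (X i))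
   (top_weight C (lam i)) (U i) n u) u.
  by rewrite /U; case: cid2 => /= U' _ h2; apply: h2.
pose SS n i : seq (X i) := flatten [seq U i m | m <- iota 0 n.+1].
(* Larger than every list [SS n i], so that one finite function type indexes all choices; an index
   beyond the list of position i produces the default 0. *)
pose K n := (\sum_i size (SS n i)).+1.
pose T n : seq W := [seq t (fun i => (SS n i)`_(f i)) | f : {ffun I -> 'I_(K n)}].
have TSS n y : (forall i, y i \in SS n i) -> t y \in T n.
  move=> yS; have lt i : (index (y i) (SS n i) < K n)%N.
    rewrite ltnS; apply: leq_trans (_ : size (SS n i) <= _)%N; first by rewrite index_size.
    by rewrite (bigD1 i) //= leq_addr.
  rewrite /T; apply/mapP; exists [ffun i => Ordinal (lt i)]; rewrite ?mem_enum //; congr t.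
  by apply: functional_extensionality_dep => i; rewrite ffunE /= nth_index.
exists T.
  move=> u; apply: (lspan_min (N := fun u => exists c, u = c *: t v)).
    split; first by exists 0; rewrite scale0r.
    by move=> a x y [c ->] [d ->]; exists (a * c + d); rewrite scalerDl scalerA.
  move=> x /mapP[f _ ->].
  apply: (tens_lspan tP (Q := fun i y => y = v i) (N := fun u => exists c, u = c *: t v)).
  - split; first by exists 0; rewrite scale0r.
    by move=> a x' y [c ->] [d ->]; exists (a * c + d); rewrite scalerDl scalerA.
  - move=> i; have : spanby (U i 0%N) (SS 0%N i)`_(f i).
      have [lt|ge] := ltnP (f i) (size (SS 0%N i)).
        by apply: lspan_in; have := mem_nth 0 lt; rewrite {2}/SS /= cats0.
      by rewrite nth_default //; apply: lspan0.
    move/U0 => [c ->]; apply: lin_closedZ; first exact: lspan_closed.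
    exact: lspan_in.
  move=> y yv; have -> : y = v by apply: functional_extensionality_dep.
  by exists 1; rewrite scale1r.
apply: (tens_span_ind tP (lspan_closed _) Us) => y yE.
pose n i := projT1 (cid (yE i)).
have nE i : depth_comp (@grading_op F G C (X i)) (top_weight C (lam i)) (U i) (n i) (y i).
  by rewrite /n; case: cid.
apply: lspan_in; exists (\sum_i n i)%N; split.
  rewrite /total_weight natr_sum -sumrB scaler_suml; apply: eq_bigr => i _.
  rewrite /grading_op /= !factor_act_tens -linearZ -linearD /= -/(grading_op C (y i)).
  by have [-> _] := nE i; rewrite linearZ /= slot_id.
apply: (tens_lspan tP (Q := fun i u => u \in SS (\sum_i n i)%N i)).
- exact: lspan_closed.
- move=> i; have [_ +] := nE i; apply: lspan_mono => u us.
  apply/flatten_mapP; exists (n i) => //.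
  by rewrite mem_iota /= add0n ltnS (bigD1 i) //= leq_addr.
by move=> z zS; apply: lspan_in; apply: TSS.
Qed.

(** The product of the functionals of [top_functional] is multilinear and takes the value 1 at [v],
    so it factors through [t v]. *)
Lemma tens_highest_neq0 : t v != 0.
Proof.
have phiP i := top_functional (@grading_op_linear F G C (X i))
  (affine_depth_graded q_span C_bound (Xv i)) (grading_op_highest C (Xv i)) (highest_neq0 (Xv i)).
pose phi i : {linear X i -> F^o} := projT1 (cid (phiP i)).
have phi1 i : phi i (v i) = 1 by rewrite /phi; case: cid.
pose b x : F^o := \prod_i (phi i (x i) : F).
have mb : multilinear b.
  move=> x i a y z; rewrite /b.
  have bE u : \prod_j (phi j (dfwith x u j) : F) =
      (phi i u : F) * \prod_(j | j != i) (phi j (x j) : F).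
    rewrite (bigD1 i) //= dfwith_in; congr (_ * _); apply: eq_bigr => j ji.
    by rewrite dfwith_out // eq_sym.
  by rewrite !bE linearP /= mulrDl -[a *: (_ * _ : F^o)]/(a * (_ * _)) mulrA.
have [_ univ] := tP; have [[f fE] _] := univ _ _ mb.
apply/eqP => tv0; have := fE v; rewrite tv0 linear0 /b big1; last by move=> i _; rewrite phi1.
by move/esym/eqP; rewrite oner_eq0.
Qed.

(** Positions are treated one by one: [singular_sum] for position i rewrites [w] as a combination of
    tensors whose i-th entry is the highest weight vector, and keeps the entries already treated. *)
Lemma joint_singular w :
  (forall i, @singular F G q C (factor_module i) w) -> exists c, w = c *: t v.
Proof.
move=> sw.
suff ext (l : seq I) : lspan (fun u => exists2 x, (forall i, i \in l -> x i = v i) & u = t x) w.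
  elim: (ext (enum I)) => [|a _ u [x xv ->] _ [c ->]]; first by exists 0; rewrite scale0r.
  have -> : x = v by apply: functional_extensionality_dep => i; rewrite xv // mem_enum.
  by exists (a + c); rewrite scalerDl.
elim: l => [|i l IH].
  apply: (tens_ind tP) => [|x]; first exact: lspan_closed.
  by apply: lspan_in; exists x.
have [->|[n [xs [c [xsl wE]]]]] := lspan_indexed IH; first exact: lspan0.
have wE' : w = \sum_(j < n) slot (xs j) i (c j *: xs j i).
  by rewrite wE; apply: eq_bigr => j _; rewrite linearZ /= slot_id.
have [irr _ _ _] := Xv i.
have := @singular_sum F G 1 (X i) W (factor_act i)
  (fun z => exists p a, [/\ p \in q, 0 < letter_degree C p a & z = Loop p.1 (const_mx a)])
  (v i) n (fun j => slot (xs j) i) (fun j => c j *: xs j i) irr.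
rewrite -wE' => H; apply: (lspan_mono (B := fun u => exists j, u = slot (xs j) i (v i))).
  move=> u [j ->]; rewrite slotE; exists (dfwith (xs j) (v i)) => // k.
  rewrite in_cons => kl; case: (eqVneq i k) => [ik|ik].
    by case: k / ik kl; rewrite dfwith_in.
  by rewrite dfwith_out // xsl //; move: kl; rewrite eq_sym (negPf ik).
apply: H => [u su|z|j z y|z [p [a [pq pa ->]]]].
- apply: (singular_highest q_span C_bound (Xv i)) => p a pq pa; apply: su.
  by exists p, a.
- exact: linear_eta.
- by rewrite factor_act_slot.
- exact: sw pq pa.
Qed.

End HighestWeightFactors.
End FactorModules.

(** * Loop modules over the dual numbers *)

Section LoopModule.
Variables (F : numClosedFieldType) (G : simpleLie F) (k : nat) (I : finType).
Variables (W : lmodType F) (fo : I -> tor_gen G 1 -> {linear W -> W}).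
Hypothesis foP : forall i, tor_axioms (fo i).
Hypothesis foC : forall i j z z' w, i != j -> fo i z (fo j z' w) = fo j z' (fo i z w).
Variables (chi eta : I -> 'rV[int]_k -> F).
Hypothesis chiD : forall i m n, chi i (m + n) = chi i m * chi i n.
Hypothesis etaD : forall i m n, eta i (m + n) = eta i m + eta i n.
Implicit Types (m n g : 'rV[int]_k) (z : tor_gen G 1) (T : I -> W -> W).
Local Notation B := (@Defs.form F G).

(* [W * W] stands for [W] with scalars extended to the dual numbers [F[tau]],
   [tau (a, b) = (0, a)]; the monomial [t^m] acts on the factor [i] through the
   character [chi i m * (1 + tau * eta i m)]. *)
Definition twist m T (w : W * W) : W * W :=
  (\sum_i chi i m *: T i w.1,
   \sum_i chi i m *: T i w.2 + \sum_i (chi i m * eta i m) *: T i w.1).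

Lemma twist_linear m T : (forall i, linear (T i)) -> linear (twist m T).
Proof.
move=> lT; have l1 (f : I -> F) : linear (fun u => \sum_i f i *: T i u).
  by apply: linear_fun_sum => i; apply: linear_funZ.
move=> a u w; rewrite /twist; congr (_, _); first exact: l1.
rewrite /= (l1 (fun i => chi i m)) (l1 (fun i => chi i m * eta i m)).
by rewrite scalerDr addrACA.
Qed.

Lemma eq_twist T' m T w : (forall i u, T i u = T' i u) -> twist m T w = twist m T' w.
Proof.
by move=> e; rewrite /twist; congr (_, _ + _); apply: eq_bigr => i _; rewrite e.
Qed.

Lemma twistD m T T' w : twist m (fun i u => T i u + T' i u) w = twist m T w + twist m T' w.
Proof.
have e (c : I -> F) u : \sum_i c i *: (T i u + T' i u) =
    \sum_i c i *: T i u + \sum_i c i *: T' i u.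
  by rewrite -big_split; apply: eq_bigr => i _; rewrite scalerDr.
by rewrite /twist !e; congr (_, _); rewrite addrACA.
Qed.

Lemma twistZ c m T w : twist m (fun i u => c *: T i u) w = c *: twist m T w.
Proof.
rewrite /twist; congr (_, _) => /=; rewrite ?scalerDr !scaler_sumr.
  by apply: eq_bigr => i _; rewrite !scalerA mulrC.
by congr (_ + _); apply: eq_bigr => i _; rewrite !scalerA mulrC.
Qed.

Lemma twist0 m w : twist m (fun _ _ => 0) w = 0.
Proof.
by rewrite /twist !big1 ?addr0 // => i _; rewrite scaler0.
Qed.

Lemma sum_comm (a b : I -> F) z z' w :
  \sum_i a i *: fo i z (\sum_j b j *: fo j z' w) -
  \sum_j b j *: fo j z' (\sum_i a i *: fo i z w) =
  \sum_i (a i * b i) *: comm (fo i z) (fo i z') w.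
Proof.
have e (c d : I -> F) y y' : \sum_i c i *: fo i y (\sum_j d j *: fo j y' w) =
    \sum_i \sum_j (c i * d j) *: fo i y (fo j y' w).
  apply: eq_bigr => i _; rewrite linear_sum scaler_sumr; apply: eq_bigr => j _.
  by rewrite linearZ /= scalerA.
rewrite !e [X in _ - X]exchange_big -sumrB; apply: eq_bigr => i _.
rewrite -sumrB (bigD1 i) //= big1 ?addr0 => [|j ji].
  by rewrite (mulrC (b i)) -scalerBr.
by rewrite (mulrC (b j)) (foC _ _ _ (_ : i != j)) ?subrr // eq_sym.
Qed.

(** Operators in different positions commute, so only the diagonal terms survive; there [chi] times
    1 + tau [eta] is multiplicative in the exponent because [chi] is multiplicative, [eta] is
    additive and tau squares to 0. *)
Lemma twist_comm m n z z' w :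
  comm (twist m (fun i => fo i z)) (twist n (fun i => fo i z')) w =
  twist (m + n) (fun i => comm (fo i z) (fo i z')) w.
Proof.
have e (c : I -> F) y u u' : \sum_i c i *: fo i y (u + u') =
    \sum_i c i *: fo i y u + \sum_i c i *: fo i y u'.
  by rewrite -big_split; apply: eq_bigr => i _; rewrite linearD scalerDr.
rewrite /comm /twist /= !e; congr (_, _) => /=.
  rewrite sum_comm; apply: eq_bigr => i _.
  by rewrite chiD.
set A1 := \sum_i _; set A2 := \sum_i _; set A3 := \sum_i _.
set B1 := \sum_i _; set B2 := \sum_i _; set B3 := \sum_i _.
have -> : A1 + A2 + A3 - (B1 + B2 + B3) = (A1 - B1) + ((A2 - B3) + (A3 - B2)).
  rewrite !opprD -!addrA; congr (_ + _); rewrite [RHS]addrCA; congr (_ + _).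
  by rewrite [LHS]addrCA; congr (_ + _); rewrite [LHS]addrA [LHS]addrC.
rewrite !sum_comm; congr (_ + _).
  by apply: eq_bigr => i _; rewrite chiD.
rewrite -big_split; apply: eq_bigr => i _ /=.
rewrite -scalerDl chiD etaD; congr (_ *: _); ring.
Qed.

(** Arbitrary functions of the exponent, so that the action is given by pointwise formulas; finite
    support is imposed later, as a submodule. *)
Definition loop_space := 'rV[int]_k -> (W * W)%type.
HB.instance Definition _ := GRing.Lmodule.on loop_space.
Implicit Types f : loop_space.

Definition loop_act_fun (y : tor_gen G k.+1) (f : loop_space) : loop_space :=
  match y with
  | Loop x m => fun g =>
      twist (tail_exp m) (fun i => fo i (Loop x (const_mx (m 0 ord0)))) (f (g - tail_exp m))
  | Central m j => fun g =>
      if (j == ord0) && (m 0 ord0 == 0)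
      then twist (tail_exp m) (fun i => fo i (Central 0 ord0)) (f (g - tail_exp m)) else 0
  | Deg j => fun g =>
      if unlift ord0 j is Some i then (g 0 i)%:~R *: f g
      else twist 0 (fun i => fo i (Deg ord0)) (f g)
  end.

Lemma loop_act_linear y : linear (loop_act_fun y).
Proof.
have lt m z : linear (twist m (fun i => fo i z)).
  by apply: twist_linear => i; exact: linear_eta.
move=> a u v; apply: funext => g; case: y => [x m|m j|j] /=.
- exact: lt.
- by case: ifP => _; [exact: lt | rewrite /= scaler0 addr0].
- case: unliftP => [i _|_]; last exact: lt.
  by rewrite [LHS]scalerDr !scalerA mulrC -!scalerA.
Qed.

HB.instance Definition _ y := GRing.isLinear.Build F _ _ _
  (loop_act_fun y) (loop_act_linear y).

Definition loop_act y : {linear loop_space -> loop_space} := loop_act_fun y.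

Lemma tail_expD (m n : 'rV[int]_k.+1) : tail_exp (m + n) = tail_exp m + tail_exp n.
Proof. by apply/rowP => i; rewrite !mxE. Qed.

Lemma loop_actP : tor_axioms loop_act.
Proof.
have lt m z : linear (twist m (fun i => fo i z)).
  by apply: twist_linear => i; exact: linear_eta.
have eqsub g m n : g - m - n = g - (m + n) by rewrite opprD addrA.
have eqsub' g m n : g - n - m = g - (m + n) by rewrite opprD addrA addrAC.
split.
- move=> m v a x y; apply: funext => g /=.
  rewrite (@eq_twist (fun i u => a *: fo i (Loop x (const_mx (m 0 ord0))) u +
     fo i (Loop y (const_mx (m 0 ord0))) u)) ?twistD ?twistZ // => i u.
  exact: (act_loop_linear (foP i)).
- move=> r v; apply: funext => g; rewrite big_ord_recl big1 ?addr0 => [|i _].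
    rewrite -[LHS]/((r 0 ord0)%:~R *: loop_act_fun (Central r ord0) v g) /=.
    by case: eqP => [->|_]; rewrite ?scale0r ?scaler0.
  by apply: funext => h; rewrite -[LHS]/(_ *: _) /= scaler0.
- move=> x y m s v; apply: funext => g.
  rewrite -[LHS]/(loop_act_fun (Loop x m) (loop_act_fun (Loop y s) v) g -
     loop_act_fun (Loop y s) (loop_act_fun (Loop x m) v) g) /=.
  rewrite (eqsub g (tail_exp m) (tail_exp s)) (eqsub' g (tail_exp m) (tail_exp s))
    -tail_expD -/(comm _ _ _) twist_comm -tail_expD.
  set u := v _; rewrite (@eq_twist (fun i u =>
      fo i (Loop (lie x y) (const_mx ((m + s) 0 ord0))) u + B x y *: ((m 0 ord0)%:~R *:
      (if (m + s) 0 ord0 == 0 then fo i (Central 0 ord0) u else 0)))); last first.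
    move=> i u'; rewrite (act_loop_loop (foP i)) big_ord1 mxE.
    have -> : const_mx (m 0 ord0) + const_mx (s 0 ord0) =
       const_mx ((m + s) 0 ord0) :> 'rV[int]_1 by apply/rowP => j; rewrite !mxE.
    congr (_ + _ *: (_ *: _)); case: eqP => [->|/eqP ms0].
      by congr (fo i (Central _ _) _); apply/rowP => j; rewrite !mxE.
    (* For a nonzero power of t_1 the defining relation already kills the central term in the affine
       module, in accordance with the zero branch of the loop action. *)
    apply: (@affine_central_eq0 F G (TorModule (foP i))).
    by apply: contra ms0 => /eqP/rowP/(_ 0); rewrite !mxE => ->.
  rewrite twistD !twistZ; congr (_ + _ *: _).
  rewrite big_ord_recl big1 ?addr0 => [|j _].
    rewrite -[RHS]/((m 0 ord0)%:~R *: loop_act_fun (Central (m + s) ord0) v g) /=.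
    by congr (_ *: _); case: eqP => _ //; rewrite twist0.
  by apply: funext => h; rewrite -[LHS]/(_ *: _) /= scaler0.
- move=> r j x m v; apply: funext => g.
  rewrite -[LHS]/(loop_act_fun (Central r j) (loop_act_fun (Loop x m) v) g -
     loop_act_fun (Loop x m) (loop_act_fun (Central r j) v) g) /=.
  case: ifP => _; last
    by have [h ->] := linear_pack (lt (tail_exp m) (Loop x (const_mx (m 0 ord0))));
      rewrite linear0 subrr.
  rewrite (eqsub g (tail_exp r) (tail_exp m)) (eqsub' g (tail_exp r) (tail_exp m))
    -/(comm _ _ _) twist_comm -[RHS](twist0 (tail_exp r + tail_exp m)
    (v (g - (tail_exp r + tail_exp m)))).
  by apply: eq_twist => i u; exact: act_central_loop (foP i) _ _ _ _ _.
- move=> r j s l v; apply: funext => g.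
  rewrite -[LHS]/(loop_act_fun (Central r j) (loop_act_fun (Central s l) v) g -
     loop_act_fun (Central s l) (loop_act_fun (Central r j) v) g) /=.
  have l0 m z : twist m (fun i => fo i z) 0 = 0.
    by have [h ->] := linear_pack (lt m z); rewrite linear0.
  case: ifP => _; case: ifP => _; rewrite ?l0 ?subrr //.
  rewrite (eqsub g (tail_exp r) (tail_exp s)) (eqsub' g (tail_exp r) (tail_exp s))
    -/(comm _ _ _) twist_comm -[RHS](twist0 (tail_exp r + tail_exp s)
    (v (g - (tail_exp r + tail_exp s)))).
  by apply: eq_twist => i u; exact: act_central_central (foP i) _ _ _ _ _.
- move=> j x m v; apply: funext => g.
  rewrite -[LHS]/(loop_act_fun (Deg j) (loop_act_fun (Loop x m) v) g -
     loop_act_fun (Loop x m) (loop_act_fun (Deg j) v) g).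
  rewrite -[RHS]/((m 0 j)%:~R *: loop_act_fun (Loop x m) v g) /=.
  case: unliftP => [i ->|->].
    have [h ->] := linear_pack (lt (tail_exp m) (Loop x (const_mx (m 0 ord0)))).
    rewrite linearZ /= -scalerBl -rmorphB /=; congr (_%:~R *: _).
    by rewrite !mxE opprB addrC subrK.
  rewrite -/(comm _ _ _) twist_comm add0r -twistZ; apply: eq_twist => i u.
  by rewrite (act_deg_loop (foP i)) mxE.
- move=> j m l v; apply: funext => g.
  rewrite -[LHS]/(loop_act_fun (Deg j) (loop_act_fun (Central m l) v) g -
     loop_act_fun (Central m l) (loop_act_fun (Deg j) v) g).
  rewrite -[RHS]/((m 0 j)%:~R *: loop_act_fun (Central m l) v g) /=.
  have l0 z : twist 0 (fun i => fo i z) 0 = 0.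
    by have [h ->] := linear_pack (lt 0 z); rewrite linear0.
  case: (unliftP ord0 j) => [i ->|->]; case: ifP => [/andP[_ /eqP m0]|_];
    rewrite ?scaler0 ?l0 ?subrr //.
    have [h ->] := linear_pack (lt (tail_exp m) (Central 0 ord0)).
    rewrite linearZ /= -scalerBl -rmorphB /=; congr (_%:~R *: _).
    by rewrite !mxE opprB addrC subrK.
  rewrite -/(comm _ _ _) twist_comm add0r m0 scale0r -[RHS](twist0 (tail_exp m)
    (v (g - tail_exp m))).
  by apply: eq_twist => i u; rewrite (act_deg_central (foP i)) mxE scale0r.
- move=> j l v; apply: funext => g.
  rewrite -[LHS]/(loop_act_fun (Deg j) (loop_act_fun (Deg l) v) g -
     loop_act_fun (Deg l) (loop_act_fun (Deg j) v) g) /=.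
  have [h hE] := linear_pack (lt 0 (Deg ord0)).
  rewrite hE; case: unliftP => [i _|_]; case: unliftP => [i' _|_] /=.
  - by rewrite !scalerA mulrC subrr.
  - by rewrite [h (_ *: _)]linearZ subrr.
  - by rewrite [h (_ *: _)]linearZ subrr.
  - by rewrite subrr.
Qed.

Definition loop_module : torModule G k.+1 := TorModule loop_actP.

End LoopModule.

(** * Homomorphisms, cyclic modules and a criterion of indecomposability *)

Section Homomorphisms.
Variables (F : numClosedFieldType) (G : simpleLie F) (k : nat).
Implicit Types U V E : torModule G k.

Definition image_set U E (f : U -> E) (N : set U) : set E :=
  fun e => exists2 u, N u & e = f u.

Lemma image_submodule U E (f : {linear U -> E}) (N : set U) :
  is_hom f -> submodule N -> submodule (image_set f N).
Proof.
move=> hf [N0 Nl Na]; split.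
- by exists 0; rewrite ?linear0.
- move=> a _ _ [u Nu ->] [v Nv ->]; exists (a *: u + v); first exact: Nl.
  by rewrite linearP.
- by move=> y _ [u Nu ->]; exists (act y u); [apply: Na | rewrite hf].
Qed.

Lemma preimage_submodule U E (f : {linear U -> E}) (N : set E) :
  is_hom f -> submodule N -> submodule (fun u => N (f u)).
Proof.
move=> hf [N0 Nl Na]; split.
- by rewrite linear0.
- by move=> a u v Nu Nv; rewrite linearP; apply: Nl.
- by move=> y u Nu; rewrite hf; apply: Na.
Qed.

Lemma setI_submodule E (N N' : set E) : submodule N -> submodule N' ->
  submodule (fun x => N x /\ N' x).
Proof.
move=> [N0 Nl Na] [M0 Ml Ma]; split=> [//|a u v [Nu Mu] [Nv Mv]|y u [Nu Mu]].
  by split; [apply: Nl | apply: Ml].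
by split; [apply: Na | apply: Ma].
Qed.

Lemma add_submodule E (N N' : set E) : submodule N -> submodule N' ->
  submodule (fun x => exists u v, [/\ N u, N' v & x = u + v]).
Proof.
move=> [N0 Nl Na] [M0 Ml Ma]; split.
- by exists 0, 0; rewrite addr0.
- move=> a _ _ [u [v [Nu Mv ->]]] [u' [v' [Nu' Mv' ->]]].
  exists (a *: u + u'), (a *: v + v'); rewrite scalerDr addrACA.
  by split=> //; [apply: Nl | apply: Ml].
- by move=> y _ [u [v [Nu Mv ->]]]; exists (act y u), (act y v); rewrite linearD;
    split=> //; [apply: Na | apply: Ma].
Qed.

Lemma zero_submodule E : submodule (fun x : E => x = 0).
Proof.
split=> // [a u v -> ->|y u ->]; first by rewrite scaler0 addr0.
by rewrite linear0.
Qed.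

Lemma hom_factor U V E (f : {linear U -> E}) (g : {linear V -> E}) :
  injective f -> is_hom f -> is_hom g -> (forall v, exists u, g v = f u) ->
  exists2 h : {linear V -> U}, is_hom h & forall v, f (h v) = g v.
Proof.
move=> injf hf hg gf; pose h v := projT1 (cid (gf v)).
have hE v : f (h v) = g v by rewrite /h; case: cid.
have lh : linear h by move=> a u v; apply: injf; rewrite linearP !hE linearP.
have [h' h'E] := linear_pack lh; exists h' => [y v|v]; rewrite -h'E //.
by apply: injf; rewrite hf !hE hg.
Qed.

Definition cyclic_incl V (v : V) : {linear cyclic_module v -> V} :=
  (val : cyclic_sort v -> V).

Lemma cyclic_incl_inj V (v : V) : injective (cyclic_incl v).
Proof. exact: val_inj. Qed.

Lemma cyclic_incl_hom V (v : V) : is_hom (cyclic_incl v).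
Proof. by []. Qed.

Lemma cyclic_inclP V (v : V) u : cyclic v u <-> exists w, u = cyclic_incl v w.
Proof.
split=> [vu|[[w wP] ->]]; last exact/asboolP.
by exists (CyclicElt (introT (asboolP _) vu)).
Qed.

Definition cyclic_gen V (v : V) : cyclic_module v :=
  CyclicElt (introT (asboolP _) (@cyclic_id F G k V v)).

Lemma cyclic_genE V (v : V) : cyclic_incl v (cyclic_gen v) = v.
Proof. by []. Qed.

Lemma cyclic_gen_generates V (v : V) : cyclic (cyclic_gen v) = setT.
Proof.
apply/seteqP; split=> // w _ N sN Ngen.
have [x xN xw] : image_set (cyclic_incl v) N (cyclic_incl v w).
  have vw : cyclic v (cyclic_incl v w) by apply/cyclic_inclP; exists w.
  apply: vw; last by exists (cyclic_gen v).
  by apply: image_submodule; first exact: cyclic_incl_hom.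
by rewrite (cyclic_incl_inj xw).
Qed.

Lemma in_Jint_plusI (l : nat) (U : torModule G l.+1) m : (0 < m)%N -> in_Jint m U -> in_Jint_plus U.
Proof.
move=> m0 JU; exists 1%N, (fun=> m), (fun=> U), (fun=> idfun); split=> //.
- by move=> v; exists (fun=> v); rewrite big_ord1.
- by move=> w; rewrite big_ord1 => w0 j; rewrite (ord1 j).
Qed.

(* The projections of a decomposition act as [c + c' tau], which is invertible
   unless [c = 0]. *)
Lemma indecomposable_dual U E (u0 : U) (f : {linear U -> E}) (tau : {linear E -> E}) mu :
  cyclic u0 = setT -> u0 != 0 -> injective f -> is_hom f -> is_hom tau ->
  (forall e, tau (tau e) = 0) -> in_weight_space mu u0 ->
  (forall u, in_weight_space mu u -> exists c c', f u = c *: f u0 + c' *: tau (f u0)) ->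
  indecomposable U.
Proof.
move=> gen u00 injf hf ht tt0 wu0 wE; split; first by exists u0.
move=> N1 N2 s1 s2 N12 dec.
have [n1 [n2 [N1n1 N2n2 u0E]]] := dec u0.
(* The defects of [n1] and [n2] from being weight vectors are opposite, hence lie in the zero
   intersection of [N1] and [N2]. *)
have w1 : in_weight_space mu n1.
  move=> H; apply/eqP; rewrite -subr_eq0; apply/eqP.
  have cl1 := submodule_lin_closed s1; have cl2 := submodule_lin_closed s2.
  have := wu0 H; rewrite u0E.
  have [h hE] := linear_pack (@hact_linear F G k U H); rewrite hE linearD scalerDr -hE.
  move=> e; have e' : hact H n1 - mu H *: n1 = mu H *: n2 - hact H n2.
    by apply/eqP; rewrite subr_eq addrC addrA -subr_eq opprK e addrC.
  have : (N1 `&` N2)%classic (hact H n1 - mu H *: n1).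
    split; first by apply: lin_closedB => //; [exact: hact_submodule | exact: lin_closedZ].
    by rewrite e'; apply: lin_closedB => //; [exact: lin_closedZ | exact: hact_submodule].
  by rewrite N12.
have [c [c' n1E]] := wE _ w1.
pose A (e : E) := c *: e + c' *: tau e.
have lA : linear A.
  by apply: linear_funD; apply: linear_funZ; [move=> a u v | exact: linear_eta].
have hA y e : A (act y e) = act y (A e).
  by rewrite /A ht [in RHS]linearD; congr (_ + _); rewrite [RHS]linearZ.
have A1 u : exists2 x, N1 x & f x = A (f u).
  have : cyclic u0 u by rewrite gen.
  apply: (cyclic_min (N := fun u => exists2 x, N1 x & f x = A (f u))); last by exists n1.
  have [N0 Nl Na] := s1; split.
  - by exists 0 => //; rewrite /A !linear0 ?scaler0 addr0.
  - move=> a x y [x' Nx ex] [y' Ny ey]; exists (a *: x' + y'); first exact: Nl.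
    by rewrite [f _]linearP ex ey [in RHS](linearP f) lA.
  - move=> y x [x' Nx ex]; exists (act y x'); first exact: Na.
    by rewrite !hf ex hA.
have A2 u : exists2 x, N2 x & f x = f u - A (f u).
  have : cyclic u0 u by rewrite gen.
  apply: (cyclic_min (N := fun u => exists2 x, N2 x & f x = f u - A (f u))); last first.
    by exists n2 => //; rewrite -[n2](addKr n1) -u0E addrC linearB n1E.
  have [N0 Nl Na] := s2; split.
  - by exists 0 => //; rewrite /A !linear0 ?scaler0 addr0 subr0.
  - move=> a x y [x' Nx ex] [y' Ny ey]; exists (a *: x' + y'); first exact: Nl.
    rewrite [f _]linearP ex ey [in RHS](linearP f) lA scalerBr.
    by rewrite [LHS]addrACA; congr (_ + _); rewrite [RHS]opprD.
  - move=> y x [x' Nx ex]; exists (act y x'); first exact: Na.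
    by rewrite !hf ex hA linearB.
have both x : N1 x -> N2 x -> x = 0.
  by move=> Nx Mx; have : (N1 `&` N2)%classic x by []; rewrite N12.
(* [A] is the projection to [N1] along [N2]. If c = 0 it has square zero and is the identity on
   [N1], so [N1] = 0; otherwise it is injective and vanishes on [N2], so [N2] = 0. *)
have [c0|c0] := eqVneq c 0.
  left; apply/seteqP; split=> [x Nx|x ->]; last by have [] := s1.
  have [y Ny yE] := A2 x; have [z Nz zE] := A1 x.
  have yx : y = x - z by apply: injf; rewrite linearB zE yE.
  have y0 : y = 0.
    by apply: both => //; rewrite yx; apply: lin_closedB => //; exact: submodule_lin_closed s1.
  move: yE; rewrite y0 linear0 /A c0 scale0r add0r => /esym/eqP; rewrite subr_eq0 => /eqP e.
  have t0 : tau (f x) = 0 by rewrite e linearZ /= tt0 scaler0.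
  by apply: injf; rewrite e t0 scaler0 linear0.
right; apply/seteqP; split=> [x Nx|x ->]; last by have [] := s2.
have [z Nz zE] := A1 x; have [y Ny yE] := A2 x.
have zx : z = x - y by apply: injf; rewrite linearB zE yE opprB addrC subrK.
have z0 : z = 0.
  by apply: both => //; rewrite zx; apply: lin_closedB => //; exact: submodule_lin_closed s2.
move: zE; rewrite z0 linear0 /A => /esym e.
have := congr1 tau e; rewrite linearD !linearZ /= tt0 scaler0 addr0 linear0 => /eqP.
rewrite scaler_eq0 (negPf c0) => /eqP t0; move: e; rewrite t0 scaler0 addr0 => /eqP.
by rewrite scaler_eq0 (negPf c0) => /eqP fx0; apply: injf; rewrite fx0 linear0.
Qed.

End Homomorphisms.

(** * Finite length through rank functions *)

Section FiniteLength.
Variables (F : numClosedFieldType) (G : simpleLie F) (k : nat).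
Implicit Types U V E : torModule G k.

(* A strictly monotone bounded rank function on the submodules of [B]. *)
Definition bounded_length E (B : set E) := exists (d : set E -> nat) (b : nat),
  (forall N, submodule N -> (forall x, N x -> B x) -> (d N <= b)%N) /\
  (forall N N', submodule N -> submodule N' -> (forall x, N x -> N' x) ->
     (forall x, N' x -> B x) -> (d N' <= d N)%N -> forall x, N' x -> N x).

Lemma rank_mono E (B : set E) (d : set E -> nat) :
  (forall N N', submodule N -> submodule N' -> (forall x, N x -> N' x) ->
     (forall x, N' x -> B x) -> (d N' <= d N)%N -> forall x, N' x -> N x) ->
  forall N N', submodule N -> submodule N' -> (forall x, N x -> N' x) ->
     (forall x, N' x -> B x) -> (d N <= d N')%N.
Proof.
move=> dS N N' sN sN' NN' N'B; rewrite leqNgt; apply/negP => lt.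
have N'N := dS N N' sN sN' NN' N'B (ltnW lt).
have e : N = N' by apply/seteqP; split.
by rewrite e ltnn in lt.
Qed.

Lemma bounded_length0 E : bounded_length (fun x : E => x = 0).
Proof.
exists (fun=> 0%N), 0%N; split=> // N N' [N0 _ _] _ _ N'0 _ x /N'0 ->.
exact: N0.
Qed.

Lemma bounded_length_sub E (B B' : set E) : (forall x, B x -> B' x) ->
  bounded_length B' -> bounded_length B.
Proof.
move=> BB' [d [b [db dS]]]; exists d, b; split.
  by move=> N sN NB; apply: db => // x /NB /BB'.
by move=> N N' sN sN' NN' N'B; apply: dS => // x /N'B /BB'.
Qed.

(** [C] has no proper nonzero submodule, so adding it raises the length by at most 1: the rank of N
    is that of its intersection with [B], plus 1 if N is not contained in [B]. *)
Lemma bounded_length_add E (B C : set E) : submodule B -> submodule C ->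
  bounded_length B ->
  (forall N, submodule N -> (forall x, N x -> C x) -> (exists2 x, N x & x != 0) ->
     forall x, C x -> N x) ->
  bounded_length (fun x => exists u v, [/\ B u, C v & x = u + v]).
Proof.
move=> sB sC [d [b [db dS]]] simC.
pose NB (N : set E) : set E := fun x => N x /\ B x.
have sNB N : submodule N -> submodule (NB N) by move=> sN; apply: setI_submodule.
pose fl (N : set E) : bool := `[< exists2 x, N x & ~ B x >].
exists (fun N => d (NB N) + fl N)%N, (b + 1)%N; split.
  move=> N sN NBC; apply: leq_add; last by case: (fl N).
  by apply: db; [exact: sNB | move=> x []].
move=> N N' sN sN' NN' N'BC le.
have dle : (d (NB N) <= d (NB N'))%N.
  apply: (rank_mono dS); [exact: sNB | exact: sNB | | by move=> x []].
  by move=> x [Nx Bx]; split=> //; apply: NN'.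
have fle : (fl N <= fl N')%N.
  rewrite /fl; case: asboolP => [[x Nx Bx]|_] //; case: asboolP => // nh.
  by case: nh; exists x => //; exact: (NN' _ Nx).
have dle' : (d (NB N') <= d (NB N))%N by lia.
have fle' : (fl N' <= fl N)%N by lia.
have N'N x : N' x -> B x -> N x.
  move=> N'x Bx; have := dS (NB N) (NB N') (sNB _ sN) (sNB _ sN') _ _ dle' x.
  by case=> //; [move=> y [Ny By]; split=> //; apply: NN' | move=> y []].
have [f1|f0] := boolP (fl N'); last first.
  move=> x N'x; apply: N'N => //; apply: contrapT => nB.
  by move/asboolP: f0; apply; exists x.
have /asboolP[x Nx nBx] : fl N by move: fle'; rewrite f1; case: (fl N).
have [u [c [Bu Cc xE]]] := N'BC x (NN' _ Nx).
(* The part of [C] reached by [N] modulo [B]; it is nonzero, hence all of [C]. *)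
pose S (y : E) := C y /\ exists2 z, B z & N (z + y).
have sS : submodule S.
  have [B0 Bl Ba] := sB; have [C0 Cl Ca] := sC; have [N0 Nl Na] := sN; split.
  - by split=> //; exists 0; rewrite ?addr0.
  - move=> a y y' [Cy [z Bz Nz]] [Cy' [z' Bz' Nz']]; split; first exact: Cl.
    exists (a *: z + z'); first exact: Bl.
    by have := Nl a _ _ Nz Nz'; rewrite scalerDr addrACA.
  - move=> g y [Cy [z Bz Nz]]; split; first exact: Ca.
    by exists (act g z); [exact: Ba | rewrite -linearD; apply: Na].
have CS : forall y, C y -> S y.
  apply: simC => //; first by move=> y [].
  exists c; last by apply/eqP => c0; apply: nBx; rewrite xE c0 addr0.
  by split=> //; exists u; rewrite -?xE.
move=> y N'y; have [w [c' [Bw Cc' yE]]] := N'BC y N'y.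
have [_ [z Bz Nz]] := CS c' Cc'.
have clN := submodule_lin_closed sN; have clN' := submodule_lin_closed sN'.
have clB := submodule_lin_closed sB.
have wz : N (w - z).
  apply: N'N; last exact: lin_closedB.
  have -> : w - z = y - (z + c') by rewrite yE opprD addrACA subrr addr0.
  by apply: lin_closedB clN' N'y (NN' _ Nz).
have -> : y = (w - z) + (z + c') by rewrite addrA subrK.
exact: lin_closedD.
Qed.

(** Ranks add up along the exact sequence given by [tau]: a submodule is controlled by its kernel
    part and by its image. *)
Lemma bounded_length_ext E (tau : {linear E -> E}) (B : set E) : is_hom tau -> submodule B ->
  bounded_length (fun x => B x /\ tau x = 0) -> bounded_length (image_set tau B) ->
  bounded_length B.
Proof.
move=> ht sB [d [b [db dS]]] [d' [b' [db' dS']]].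
pose Nk (N : set E) : set E := fun x => N x /\ tau x = 0.
have sk : submodule (fun x => tau x = 0).
  exact: (preimage_submodule ht (zero_submodule E)).
have sNk N : submodule N -> submodule (Nk N) by move=> sN; apply: setI_submodule.
have sNi N : submodule N -> submodule (image_set tau N) by apply: image_submodule.
exists (fun N => d (Nk N) + d' (image_set tau N))%N, (b + b')%N; split.
  move=> N sN NB; apply: leq_add.
    by apply: db; [exact: sNk | move=> x [Nx t0]; split=> //; apply: NB].
  by apply: db'; [exact: sNi | move=> _ [x Nx ->]; exists x => //; apply: NB].
move=> N N' sN sN' NN' N'B le.
have dle : (d (Nk N) <= d (Nk N'))%N.
  apply: (rank_mono dS); [exact: sNk | exact: sNk | | ].
    by move=> x [Nx t0]; split=> //; apply: NN'.
  by move=> x [N'x t0]; split=> //; apply: N'B.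
have dle' : (d' (image_set tau N) <= d' (image_set tau N'))%N.
  apply: (rank_mono dS'); [exact: sNi | exact: sNi | | ].
    by move=> _ [x Nx ->]; exists x => //; apply: NN'.
  by move=> _ [x Nx ->]; exists x => //; apply: N'B.
move=> x N'x.
have [y Ny txy] : image_set tau N (tau x).
  apply: (dS' (image_set tau N) (image_set tau N')); [exact: sNi | exact: sNi | | | | ].
  - by move=> _ [y Ny ->]; exists y => //; apply: NN'.
  - by move=> _ [y Ny ->]; exists y => //; apply: N'B.
  - by lia.
  - by exists x.
have [Nxy _] : Nk N (x - y).
  apply: (dS (Nk N) (Nk N')); [exact: sNk | exact: sNk | | | | ].
  - by move=> z [Nz t0]; split=> //; apply: NN'.
  - by move=> z [Nz t0]; split=> //; apply: N'B.
  - by lia.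
  - split; last by rewrite linearB txy subrr.
    by apply: lin_closedB; [exact: submodule_lin_closed | | exact: NN'].
by rewrite -[x](subrK y); apply: lin_closedD => //; exact: submodule_lin_closed.
Qed.

Lemma nat_minimum (P : nat -> Prop) : (exists n, P n) ->
  exists2 n, P n & forall m, P m -> (n <= m)%N.
Proof.
move=> [n Pn]; have ex : exists n, `[< P n >] by exists n; apply/asboolP.
case: (ex_minnP ex) => m /asboolP Pm min; exists m => // l Pl.
by apply: min; apply/asboolP.
Qed.

(** A strictly larger submodule of minimal rank covers the given one, since anything strictly
    between would have strictly smaller rank. Iterating from 0 raises the rank at each step, so the
    bound stops the chain at the whole module. *)
Lemma bounded_finite_length U E (f : {linear U -> E}) (B : set E) :
  injective f -> is_hom f -> (forall u, B (f u)) -> bounded_length B -> finite_length U.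
Proof.
move=> injf hf fB [d [b [db dS]]].
pose d' (N : set U) := d (image_set f N).
have d'b N : submodule N -> (d' N <= b)%N.
  by move=> sN; apply: db; [exact: image_submodule | move=> _ [x _ ->]].
have d'S N N' : submodule N -> submodule N' -> (forall x, N x -> N' x) ->
    (d' N' <= d' N)%N -> forall x, N' x -> N x.
  move=> sN sN' NN' le x N'x.
  have [|||y Ny /injf -> //] := dS _ _ (image_submodule hf sN) (image_submodule hf sN') _ _ le (f x).
  - by move=> _ [y Ny ->]; exists y => //; apply: NN'.
  - by move=> _ [y _ ->].
  - by exists x.
pose step (N N' : set U) := [/\ submodule N', (N `<=` N')%classic, N <> N' &
  forall N'', submodule N'' -> (N `<=` N'')%classic -> (N'' `<=` N')%classic ->
     N'' = N \/ N'' = N'].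
have stepE N : submodule N -> N <> setT -> exists N', step N N'.
  move=> sN NT.
  have [|n [N' [sN' NN' neN nE]] min] := nat_minimum (P := fun n => exists N' : set U,
      [/\ submodule N', (N `<=` N')%classic, N <> N' & d' N' = n]).
    by exists (d' setT), setT; split.
  exists N'; split=> // N'' sN'' NN'' N''N'.
  have [->|ne] := pselect (N'' = N); first by left.
  right; apply/seteqP; split=> // x; apply: d'S => //.
  by rewrite nE; apply: min; exists N''; split=> // e; apply: ne.
pose succ (N : set U) : set U :=
  if pselect (exists N', step N N') is left ex then projT1 (cid ex) else N.
have succP N : submodule N -> N <> setT -> step N (succ N).
  move=> sN NT; rewrite /succ; case: pselect => [ex|[]]; last exact: stepE.
  by case: cid.
have succ_sub N : submodule N -> submodule (succ N).
  by move=> sN; rewrite /succ; case: pselect => // ex; case: cid => N' [].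
pose ch i := iter i succ (fun x : U => x = 0).
have chS i : submodule (ch i).
  by elim: i => [|i IH] /=; [exact: zero_submodule | exact: succ_sub].
have [l chl lmin] : exists2 l, ch l = setT & forall m, ch m = setT -> (l <= m)%N.
  apply: nat_minimum; apply: contrapT => nex.
  have chT i : ch i <> setT by move=> e; apply: nex; exists i.
  have grow i : (i <= d' (ch i))%N.
    elim: i => // i IH; apply: leq_ltn_trans IH _; rewrite ltnNge; apply/negP => le.
    have [s1 s2 s3 _] := succP _ (chS i) (chT i); apply: s3; apply/seteqP; split=> //.
    by apply: d'S => //; exact: chS.
  by have := leq_trans (grow b.+1) (d'b _ (chS b.+1)); rewrite ltnn.
exists l, ch; split=> // i il.
have iT : ch i <> setT by move=> e; have := lmin _ e; rewrite leqNgt il.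
by have [s1 s2 s3 s4] := succP _ (chS i) iT; split.
Qed.

End FiniteLength.

(** * Monomials, the operator tau and shifts *)

Section LoopModuleBasics.
Variables (F : numClosedFieldType) (G : simpleLie F) (k : nat) (I : finType).
Variables (W : lmodType F) (fo : I -> tor_gen G 1 -> {linear W -> W}).
Hypothesis foP : forall i, tor_axioms (fo i).
Hypothesis foC : forall i j z z' w, i != j -> fo i z (fo j z' w) = fo j z' (fo i z w).
Variables (chi eta : I -> 'rV[int]_k -> F).
Hypothesis chiD : forall i m n, chi i (m + n) = chi i m * chi i n.
Hypothesis etaD : forall i m n, eta i (m + n) = eta i m + eta i n.
Hypothesis chi0 : forall i, chi i 0 = 1.
Implicit Types (m n g h : 'rV[int]_k) (z : tor_gen G 1).

Local Notation E := (loop_module foP foC chiD etaD).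
Local Notation ltwist m z := (twist chi eta m (fun i => fo i z)).

Lemma eta0 i : eta i 0 = 0.
Proof. by apply: (addrI (eta i 0)); rewrite -etaD !addr0. Qed.

Definition cons_exp (a : int) m : 'rV[int]_k.+1 :=
  \row_j (if unlift ord0 j is Some i then m 0 i else a).

Lemma cons_exp_head a m : cons_exp a m 0 ord0 = a.
Proof. by rewrite mxE unlift_none. Qed.

Lemma cons_exp_tail a m : tail_exp (cons_exp a m) = m.
Proof. by apply/rowP => i; rewrite !mxE liftK. Qed.

Lemma ltwist_linear m z : linear (ltwist m z).
Proof. by apply: twist_linear => i; exact: linear_eta. Qed.

Lemma ltwist0 m z : ltwist m z 0 = 0.
Proof. by have [f ->] := linear_pack (ltwist_linear m z); rewrite linear0. Qed.

Definition delta_fun g (w : W * W) : E := fun h => if h == g then w else 0.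

Lemma delta_linear g : linear (delta_fun g).
Proof.
move=> a u w; apply: funext => h.
rewrite -[RHS]/(a *: delta_fun g u h + delta_fun g w h) /delta_fun.
by case: eqP => // _; rewrite scaler0 addr0.
Qed.

HB.instance Definition _ g := GRing.isLinear.Build F _ _ _ (delta_fun g) (delta_linear g).
Definition delta g : {linear (W * W)%type -> E} := delta_fun g.

Lemma deltaE g w h : delta g w h = if h == g then w else 0.
Proof. by []. Qed.

Lemma delta_inj g : injective (delta g).
Proof. by move=> u w /(congr1 (fun f : E => f g)); rewrite !deltaE eqxx. Qed.

Lemma act_loop_delta x (m : 'rV[int]_k.+1) g w :
  act (Loop x m) (delta g w) =
  delta (g + tail_exp m) (ltwist (tail_exp m) (Loop x (const_mx (m 0 ord0))) w).
Proof.
apply: funext => h; rewrite -[LHS]/(ltwist _ _ (delta g w (h - tail_exp m))) !deltaE.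
by rewrite subr_eq; case: eqP => // _; rewrite ltwist0.
Qed.

Lemma act_central_delta (m : 'rV[int]_k.+1) g w : m 0 ord0 = 0 ->
  act (Central m ord0) (delta g w) =
  delta (g + tail_exp m) (ltwist (tail_exp m) (Central 0 ord0) w).
Proof.
move=> m0; apply: funext => h.
rewrite -[LHS]/(if (ord0 == ord0 :> 'I_k.+1) && (m 0 ord0 == 0)
  then ltwist _ _ (delta g w (h - tail_exp m)) else 0) m0 !eqxx /= !deltaE.
by rewrite subr_eq; case: eqP => // _; rewrite ltwist0.
Qed.

Lemma act_central_eq0 (m : 'rV[int]_k.+1) j (f : E) : (j == ord0) && (m 0 ord0 == 0) = false ->
  act (Central m j) f = 0.
Proof.
move=> e; apply: funext => h.
rewrite -[LHS]/(if (j == ord0 :> 'I_k.+1) && (m 0 ord0 == 0)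
  then ltwist _ _ (f (h - tail_exp m)) else 0).
by rewrite e.
Qed.

Lemma act_deg1E (f : E) g : act (Deg ord0) f g = ltwist 0 (Deg ord0) (f g).
Proof.
by rewrite -[LHS]/(if unlift ord0 ord0 is Some i then (g 0 i)%:~R *: f g
      else ltwist 0 (Deg ord0) (f g)) unlift_none.
Qed.

Lemma act_degE (f : E) i g : act (Deg (lift ord0 i)) f g = (g 0 i)%:~R *: f g.
Proof.
by rewrite -[LHS]/(if unlift ord0 (lift ord0 i) is Some i then (g 0 i)%:~R *: f g
      else ltwist 0 (Deg ord0) (f g)) liftK.
Qed.

Lemma act_deg1_delta g w : act (Deg ord0) (delta g w) = delta g (ltwist 0 (Deg ord0) w).
Proof.
by apply: funext => h; rewrite act_deg1E !deltaE; case: eqP => // _; rewrite ltwist0.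
Qed.

Lemma act_deg_delta i g w : act (Deg (lift ord0 i)) (delta g w) = (g 0 i)%:~R *: delta g w.
Proof.
apply: funext => h; rewrite act_degE -[RHS]/((g 0 i)%:~R *: delta g w h) !deltaE.
by case: eqP => [->|_] //; rewrite !scaler0.
Qed.

Definition tau_fun (f : E) : E := fun g => (0, (f g).1).

Lemma tau_linear : linear tau_fun.
Proof.
move=> a f f'; apply: funext => g.
rewrite -[RHS]/(a *: tau_fun f g + tau_fun f' g) /tau_fun.
by congr (_, _) => /=; rewrite scaler0 addr0.
Qed.

HB.instance Definition _ := GRing.isLinear.Build F _ _ _ tau_fun tau_linear.
Definition tau : {linear E -> E} := tau_fun.

Lemma tauE (f : E) g : tau f g = (0, (f g).1). Proof. by []. Qed.

Lemma tau_tau f : tau (tau f) = 0.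
Proof. by apply: funext. Qed.

Lemma tau_delta g w : tau (delta g w) = delta g (0, w.1).
Proof. by apply: funext => h; rewrite tauE !deltaE; case: eqP. Qed.

Lemma ltwist_tau m z (w : W * W) : ltwist m z (0, w.1) = (0, (ltwist m z w).1).
Proof.
rewrite /twist /=; congr (_, _) => /=.
  by rewrite big1 // => i _; rewrite linear0 scaler0.
by rewrite [X in _ + X]big1 ?addr0 // => i _; rewrite linear0 scaler0.
Qed.

Lemma ltwist_top m z w : ltwist m z (0, w) = (0, \sum_i chi i m *: fo i z w).
Proof. exact: (ltwist_tau m z (w, 0)). Qed.

Lemma tau_hom : is_hom tau.
Proof.
move=> y f; apply: funext => g; rewrite tauE.
case: y => [x m|m j|j].
- by rewrite -[RHS]/(ltwist _ _ (tau f (g - tail_exp m))) tauE ltwist_tau.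
- rewrite -[RHS]/(if (j == ord0) && (m 0 ord0 == 0)
    then ltwist _ _ (tau f (g - tail_exp m)) else 0) tauE.
  rewrite -[act _ f g]/(if (j == ord0) && (m 0 ord0 == 0)
    then ltwist (tail_exp m) (Central 0 ord0) (f (g - tail_exp m)) else 0).
  by case: ifP => // _; rewrite ltwist_tau.
- case: (unliftP ord0 j) => [i ->|->].
    rewrite !act_degE tauE /=; congr (_, _) => /=.
    by rewrite scaler0.
  by rewrite !act_deg1E tauE ltwist_tau.
Qed.

Definition shift_fun m (f : E) : E := fun g => f (g - m).

Lemma shift_linear m : linear (shift_fun m).
Proof. by []. Qed.

HB.instance Definition _ m := GRing.isLinear.Build F _ _ _ (shift_fun m) (shift_linear m).
Definition shift m : {linear E -> E} := shift_fun m.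

Lemma shiftE m (f : E) g : shift m f g = f (g - m). Proof. by []. Qed.

Lemma shift_delta m g w : shift m (delta g w) = delta (g + m) w.
Proof. by apply: funext => h; rewrite shiftE !deltaE subr_eq. Qed.

(** A shift is not a module map, because it changes the eigenvalues of d_2, ..., d_k; but it
    commutes with these up to adding a scalar, which a submodule does not see. *)
Lemma shift_cyclic m (u f : E) : cyclic u f -> cyclic (shift m u) (shift m f).
Proof.
apply: (cyclic_min (N := fun f => cyclic (shift m u) (shift m f))); last exact: cyclic_id.
have [N0 Nl Na] := cyclic_submodule (shift m u); split.
- by rewrite linear0.
- by move=> a x y Nx Ny; rewrite linearP; apply: Nl.
have subac g n : g - m - n = g - n - m by rewrite addrAC.
move=> y x Nx; have Ny := Na y _ Nx.
case: y Ny => [a n|n j|j] Ny.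
- suff -> : shift m (act (Loop a n) x) = act (Loop a n) (shift m x) by [].
  apply: funext => g; rewrite shiftE.
  rewrite -[LHS]/(ltwist _ _ (x (g - m - tail_exp n))).
  by rewrite -[RHS]/(ltwist _ _ (x (g - tail_exp n - m))) subac.
- suff -> : shift m (act (Central n j) x) = act (Central n j) (shift m x) by [].
  apply: funext => g; rewrite shiftE.
  rewrite -[LHS]/(if (j == ord0) && (n 0 ord0 == 0)
    then ltwist _ _ (x (g - m - tail_exp n)) else 0) subac.
  by [].
- case: (unliftP ord0 j) Ny => [i ->|->] Ny.
    have -> : shift m (act (Deg (lift ord0 i)) x) =
        act (Deg (lift ord0 i)) (shift m x) - (m 0 i)%:~R *: shift m x.
      apply: funext => g; rewrite shiftE act_degE.
      rewrite -[RHS]/(act (Deg (lift ord0 i)) (shift m x) g - (m 0 i)%:~R *: shift m x g).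
      by rewrite act_degE shiftE !mxE -scalerBl -rmorphB.
    have cl := submodule_lin_closed (cyclic_submodule (shift m u)).
    by apply: (lin_closedB cl) => //; exact: (lin_closedZ _ cl).
  suff -> : shift m (act (Deg ord0) x) = act (Deg ord0) (shift m x) by [].
  by apply: funext => g; rewrite shiftE !act_deg1E shiftE.
Qed.

Definition finite_support (f : E) := exists s : seq 'rV[int]_k, forall g, g \notin s -> f g = 0.

Lemma finite_support_delta g w : finite_support (delta g w).
Proof. by exists [:: g] => h; rewrite inE deltaE => /negPf ->. Qed.

Lemma finite_support_submodule : submodule finite_support.
Proof.
split; first by exists [::].
- move=> a f f' [s sf] [s' sf']; exists (s ++ s') => g; rewrite mem_cat negb_or => /andP[gs gs'].
  by rewrite -[LHS]/(a *: f g + f' g) sf // sf' // scaler0 addr0.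
move=> y f [s sf]; case: y => [x m|m j|j].
- exists [seq h + tail_exp m | h <- s] => g gs.
  rewrite -[LHS]/(ltwist _ _ (f (g - tail_exp m))) sf ?ltwist0 //.
  by apply: contra gs => gs; apply/mapP; exists (g - tail_exp m); rewrite // subrK.
- exists [seq h + tail_exp m | h <- s] => g gs.
  rewrite -[LHS]/(if (j == ord0) && (m 0 ord0 == 0)
    then ltwist _ _ (f (g - tail_exp m)) else 0) sf ?ltwist0 ?if_same //.
  by apply: contra gs => gs; apply/mapP; exists (g - tail_exp m); rewrite // subrK.
- exists s => g gs; case: (unliftP ord0 j) => [i ->|->].
    by rewrite act_degE sf // scaler0.
  by rewrite act_deg1E sf // ltwist0.
Qed.

Lemma sum_loopE (J : Type) (r : seq J) (f : J -> E) g :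
  (\sum_(j <- r) f j : E) g = \sum_(j <- r) f j g.
Proof. by elim: r => [|j r IH]; rewrite ?big_nil // !big_cons -IH. Qed.

Lemma finite_support_sum (f : E) : finite_support f ->
  exists2 s, uniq s & f = \sum_(g <- s) delta g (f g).
Proof.
move=> [s sf]; exists (undup s); first exact: undup_uniq.
apply: funext => h; rewrite sum_loopE; have [hs|hs] := boolP (h \in undup s).
  rewrite (big_rem h) //= deltaE eqxx big_seq big1 ?addr0 // => g gs.
  rewrite deltaE; case: eqP => // hg; move: gs; rewrite hg mem_rem_uniqF //.
  exact: undup_uniq.
rewrite sf; last by rewrite -mem_undup.
rewrite big_seq big1 // => g gs; rewrite deltaE; case: eqP => // hg.
by rewrite hg gs in hs.
Qed.

End LoopModuleBasics.

(** Let p be the product of the X - z_i. If all power sums of positive exponent vanished, the sum of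
    the c_i p(z_i), which is 0, would equal p(0) times the sum of the c_i, which is not. The z_i may
    repeat. *)
Lemma power_sum_neq0 (F : fieldType) (I : finType) (z c : I -> F) :
  (forall i, z i != 0) -> \sum_i c i != 0 ->
  exists2 n, (0 < n)%N & \sum_i c i * z i ^+ n != 0.
Proof.
move=> z0 c0; apply: contrapT => hn.
have s0 n : (0 < n)%N -> \sum_i c i * z i ^+ n = 0.
  by move=> n0; apply/eqP/negPn/negP => h; apply: hn; exists n.
pose p : {poly F} := \prod_i ('X - (z i)%:P).
have pz i : p.[z i] = 0.
  by rewrite /p horner_prod (bigD1 i) //= hornerXsubC subrr mul0r.
have p0 : p`_0 != 0.
  rewrite -horner_coef0 /p horner_prod prodf_seq_neq0; apply/allP => i _ /=.
  by rewrite hornerXsubC sub0r oppr_eq0.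
have : \sum_i c i * p.[z i] = p`_0 * \sum_i c i.
  under eq_bigr do rewrite horner_coef mulr_sumr.
  rewrite exchange_big /=.
  case sp : (size p) p0 => [|n] p0.
    by rewrite nth_default ?sp // eqxx in p0.
  rewrite big_ord_recl [X in _ + X]big1 ?addr0 => [|j _].
    by rewrite mulr_sumr; apply: eq_bigr => i _; rewrite expr0 mulr1 mulrC.
  under eq_bigr do rewrite mulrCA.
  by rewrite -mulr_sumr s0 ?mulr0.
rewrite big1; last by move=> i _; rewrite pz mulr0.
by move/esym/eqP; rewrite mulf_eq0 (negPf p0) (negPf c0).
Qed.

(** * Interpolation by characters *)

Section Characters.
Variables (F : fieldType) (A : zmodType) (I : finType) (chi : I -> A -> F).
Hypothesis chiD : forall i m n, chi i (m + n) = chi i m * chi i n.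
Hypothesis chi0 : forall i, chi i 0 = 1.
Hypothesis chi_sep : forall i j, i != j -> exists m, chi i m != chi j m.

Definition character_span (e : I -> F) :=
  exists L : seq (F * A), forall j, e j = \sum_(p <- L) p.1 * chi j p.2.

Lemma character_spanM e e' : character_span e -> character_span e' ->
  character_span (fun j => e j * e' j).
Proof.
move=> [L LE] [L' LE']; exists [seq (p.1 * p'.1, p.2 + p'.2) | p <- L, p' <- L'] => j.
rewrite big_allpairs_dep /= LE LE' mulr_suml; apply: eq_bigr => p _.
rewrite mulr_sumr; apply: eq_bigr => p' _ /=.
by rewrite chiD mulrACA.
Qed.

(** Lagrange interpolation: for each other index l multiply by a factor that is 1 at i and 0 at l.
    The factors are combinations of characters, and products of characters are evaluations at a sum
    of exponents. *)
Lemma character_interpolation i : character_span (fun j => (j == i)%:R).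
Proof.
suff [e [Le ei ej]] : exists e, [/\ character_span e, e i = 1 &
    forall j, j \in enum I -> j != i -> e j = 0].
  have [L LE] := Le; exists L => j; rewrite -LE.
  by have [->|ji] := eqVneq j i; rewrite ?ei // ej ?mem_enum.
elim: (enum I) => [|l s [e [Le ei ej]]].
  exists (fun=> 1); split=> //; exists [:: (1, 0)] => j.
  by rewrite big_seq1 /= chi0 mulr1.
have [li|li] := eqVneq l i.
  exists e; split=> // j; rewrite in_cons => /predU1P[->|]; last exact: ej.
  by rewrite li eqxx.
have [m ml] := chi_sep li.
have d0 : chi i m - chi l m != 0 by rewrite subr_eq0 eq_sym.
pose e' j := (chi i m - chi l m)^-1 * (chi j m - chi l m).
exists (fun j => e' j * e j); split.
- apply: character_spanM => //.
  exists [:: ((chi i m - chi l m)^-1, m); (- (chi i m - chi l m)^-1 * chi l m, 0)] => j.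
  by rewrite big_cons big_seq1 /= chi0 mulr1 /e' mulrBr mulNr.
- by rewrite ei mulr1 /e' mulVf.
- move=> j; rewrite in_cons => /predU1P[->|js] ji; first by rewrite /e' subrr mulr0 mul0r.
  by rewrite ej // mulr0.
Qed.

Lemma character_neq0 i m : chi i m != 0.
Proof.
by apply/eqP => z; have := chiD i m (- m); rewrite subrr chi0 z mul0r => /eqP;
  rewrite oner_eq0.
Qed.

Lemma characterMn i m n : chi i (m *+ n) = chi i m ^+ n.
Proof.
elim: n => [|n IH]; first by rewrite mulr0n chi0 expr0.
by rewrite mulrS exprS chiD IH.
Qed.

End Characters.

(** * The deformed loop module built on highest weight modules *)

Section LoopHighest.
Variables (F : numClosedFieldType) (G : simpleLie F) (k : nat).
Variables (I : finType) (X : I -> torModule G 1) (W : lmodType F).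
Variables (t : (forall i, X i) -> W) (tP : is_tensor_product t).
Variables (q : seq (G * int)) (C : nat).
Hypothesis q_span : homogeneous_spanning q.
Hypothesis C_bound : forall p : G * int, p \in q -> `|p.2| < C%:Z.
Variables (lam : I -> affweight G) (v : forall i, X i).
Hypothesis Xv : forall i, is_Xlambda (lam i) (v i).
Variables (chi eta : I -> 'rV[int]_k -> F).
Hypothesis chiD : forall i m n, chi i (m + n) = chi i m * chi i n.
Hypothesis etaD : forall i m n, eta i (m + n) = eta i m + eta i n.
Hypothesis chi0 : forall i, chi i 0 = 1.
Hypothesis chi_sep : forall i j, i != j -> exists m, chi i m != chi j m.
Hypothesis level_neq0 : \sum_i lam i (hK1 G) != 0.
Implicit Types (g h : 'rV[int]_k) (z : tor_gen G 1).

Local Notation fo := (factor_act tP).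
Definition highest_loop_module : torModule G k.+1 :=
  loop_module (factor_actP tP) (@factor_act_comm F G I X W t tP) chiD etaD.
Local Notation E := highest_loop_module.
Local Notation dl := (@delta F G k I W fo (factor_actP tP) (@factor_act_comm F G I X W t tP)
   chi eta chiD etaD).
Local Notation tau := (@tau F G k I W fo (factor_actP tP) (@factor_act_comm F G I X W t tP)
   chi eta chiD etaD).
Local Notation fsupp := (@finite_support F G k I W fo (factor_actP tP)
   (@factor_act_comm F G I X W t tP) chi eta chiD etaD).
Local Notation P := (@total_grading F G I X W t tP C).
Local Notation Lam := (@total_weight F G I C lam).

(** Combining the relations for different exponents with the interpolation coefficients isolates one
    tensor factor. *)
Lemma factor_separate z w : (forall m : 'rV[int]_k, \sum_i chi i m *: fo i z w = 0) ->
  forall i, fo i z w = 0.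
Proof.
move=> h i; have [L LE] := character_interpolation chiD chi0 chi_sep i.
have : \sum_(p <- L) p.1 *: (\sum_j chi j p.2 *: fo j z w) = 0.
  by rewrite big1 // => p _; rewrite h scaler0.
under eq_bigr do rewrite scaler_sumr.
rewrite exchange_big (bigD1 i) //= [X in _ + X]big1 ?addr0 => [|j ji].
  under eq_bigr do rewrite scalerA.
  by rewrite -scaler_suml -LE eqxx scale1r.
under eq_bigr do rewrite scalerA.
by rewrite -scaler_suml -LE (negPf ji) scale0r.
Qed.

(** The pair (0, w) is tau times (w, 0), so these vectors span the undeformed loop module. *)
Definition bottom g (w : W) : E := dl g (0, w).

Lemma bottom_linear g : linear (bottom g).
Proof.
move=> a u w; rewrite /bottom -linearP; congr (dl g _).
by congr (_, _) => /=; rewrite scaler0 addr0.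
Qed.

Lemma bottom_inj g : injective (bottom g).
Proof. by move=> u w /delta_inj []. Qed.

Lemma act_loop_bottom x (m : 'rV[int]_k.+1) g w :
  act (Loop x m) (bottom g w) = bottom (g + tail_exp m)
    (\sum_i chi i (tail_exp m) *: fo i (Loop x (const_mx (m 0 ord0))) w).
Proof. by rewrite /bottom act_loop_delta ltwist_top. Qed.

Lemma act_deg1_bottom g w :
  act (Deg ord0) (bottom g w) = bottom g (\sum_i fo i (Deg ord0) w).
Proof.
rewrite /bottom act_deg1_delta ltwist_top; congr (dl g (0, _)).
by apply: eq_bigr => i _; rewrite chi0 scale1r.
Qed.

Definition loop_grading (f : E) : E :=
  act (Loop (vsval (rho_check G)) 0) f + C%:R *: act (Deg ord0) f.

Lemma loop_grading_linear : linear loop_grading.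
Proof.
apply: linear_funD; first exact: linear_eta.
by apply: linear_funZ; exact: linear_eta.
Qed.

Lemma loop_grading_bottom g w : loop_grading (bottom g w) = bottom g (P w).
Proof.
have [f fE] := linear_pack (bottom_linear g).
rewrite /loop_grading act_loop_bottom act_deg1_bottom.
have -> : tail_exp 0 = 0 :> 'rV[int]_k by apply/rowP => i; rewrite !mxE.
rewrite addr0 fE -linearZ -linearD; congr (f _); rewrite /total_grading scaler_sumr -big_split.
apply: eq_bigr => i _ /=; rewrite chi0 scale1r mxE; congr (fo i (Loop _ _) w + _).
Qed.

Lemma total_grading_letter (p : G * int) a i w : p \in q ->
  P (fo i (Loop p.1 (const_mx a)) w) =
  fo i (Loop p.1 (const_mx a)) (P w) +
    (letter_degree C p a)%:~R *: fo i (Loop p.1 (const_mx a)) w.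
Proof.
move=> pq; rewrite /total_grading linear_sum (bigD1 i) //= [in RHS](bigD1 i) //=.
have := @grading_op_letter F G q C q_span (factor_module tP i) p a w pq.
rewrite /letter_act /= => ->; rewrite -!addrA; congr (_ + _); rewrite addrC.
congr (_ + _); apply: eq_bigr => j ji; rewrite /grading_op /=.
rewrite (factor_act_comm tP _ _ _ ji) (factor_act_comm tP (Deg ord0) _ _ ji).
by rewrite [in RHS]linearD [fo i _ (_ *: _)]linearZ.
Qed.

Lemma bottom_support (f : E) : fsupp f -> tau f = 0 ->
  exists2 s, uniq s & f = \sum_(g <- s) bottom g (f g).2.
Proof.
move=> sf tf; have [s us fE] := finite_support_sum sf; exists s => //.
rewrite {1}fE; apply: eq_bigr => g _; rewrite /bottom; congr (dl g _).
have : (f g).1 = 0 := congr1 (fun f : E => (f g).2) tf.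
by case: (f g) => a b /= ->.
Qed.

Lemma bottom_component (N : set E) (f : E) g : submodule N -> fsupp f -> tau f = 0 ->
  N f -> N (bottom g (f g).2).
Proof.
move=> sN sf tf Nf; have [s us fE] := bottom_support sf tf.
have cN := submodule_lin_closed sN; have [N0 _ Na] := sN.
have [gs|gs] := boolP (g \in s); last first.
  have -> : (f g).2 = 0.
    rewrite fE sum_loopE big_seq big1 // => h hs; rewrite /bottom deltaE.
    by case: eqP => // gh; rewrite gh hs in gs.
  by have [b ->] := linear_pack (bottom_linear g); rewrite linear0.
apply: (@eigen_components F E _ 'I_k (fun j => @act F G k.+1 E (Deg (lift ord0 j))) N s
  (fun g => bottom g (f g).2) (fun g j => (g 0 j)%:~R)) gs => //.
- by move=> j; exact: linear_eta.
- by move=> j u Nu; apply: Na.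
- by move=> h j _; rewrite /bottom act_deg_delta.
- move=> h h' _ _ hh'; apply: contrapT => ne; case/eqP: hh'; apply/rowP => j.
  apply/eqP/negPn/negP => hj; apply: ne; exists j.
  by apply: contra hj; rewrite eqr_int.
- by rewrite -fE.
Qed.

(* A homogeneous element of minimal depth of a nonzero submodule is killed by
   all raising operators, hence is a multiple of the highest weight vector. *)
Lemma submodule_has_top (N : set E) (f : E) : submodule N -> fsupp f -> tau f = 0 ->
  N f -> f != 0 -> exists h, N (bottom h (t v)).
Proof.
move=> sN sf tf Nf f0; have cN := submodule_lin_closed sN; have [N0 Nl Na] := sN.
have lP := @total_grading_linear F G I X W t tP C.
have gr := total_depth_graded tP q_span C_bound Xv; have [U U0 sp] := gr.
have [g w0 Nw] : exists2 g, (f g).2 != 0 & N (bottom g (f g).2).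
  have [s us fE] := bottom_support sf tf.
  apply: contrapT => hn; case/eqP: f0; rewrite fE big1 // => g _.
  have [->|w0] := eqVneq (f g).2 0.
    by have [b ->] := linear_pack (bottom_linear g); rewrite linear0.
  by case: hn; exists g => //; exact: (bottom_component g sN sf tf Nf).
pose Q n := exists g w, [/\ N (bottom g w), P w = (Lam - n%:R) *: w & w != 0].
have [n [g' [w [Nw' Pw w'0]]] min] : exists2 n, Q n & forall m, Q m -> (n <= m)%N.
  apply: nat_minimum.
  have [r [w [ur wE uE]]] := graded_decomposition (depth_comp_closed Lam lP U) (sp (f g).2).
  have Nwn n : n \in r -> N (bottom g (w n)).
    move=> nr; have [b bE] := linear_pack (bottom_linear g).
    apply: (@eigen_components F E _ unit (fun _ => loop_grading) N r
      (fun n => bottom g (w n)) (fun n _ => Lam - n%:R)) nr => //.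
    - by move=> _; exact: loop_grading_linear.
    - move=> _ u Nu; apply: (lin_closedD cN); first exact: Na.
      by apply: (lin_closedZ _ cN); apply: Na.
    - by move=> m _ _; rewrite loop_grading_bottom; have [-> _] := wE m; rewrite bE linearZ.
    - move=> m l _ _ ml; exists tt; apply: contra ml => /eqP e.
      by apply/eqP; apply: depth_shift_inj e.
    - by rewrite bE -linear_sum -bE -uE.
  have [n nr wn0] : exists2 n, n \in r & w n != 0.
    apply: contrapT => hn; case/eqP: w0; rewrite uE big1_seq // => n /andP[_ nr].
    by apply/eqP/negPn/negP => h; apply: hn; exists n.
  by exists n, g, (w n); split=> //; [exact: Nwn | have [] := wE n].
have sing i : @singular F G q C (factor_module tP i) w.
  move=> p a pq pa; rewrite /letter_act /=; move: i; apply: factor_separate => m.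
  set w' := \sum_i _; apply/eqP/negPn/negP => w'n0.
  have Nw1 : N (bottom (g' + m) w').
    have := Na (Loop p.1 (cons_exp a m)) _ Nw'.
    by rewrite act_loop_bottom cons_exp_tail cons_exp_head.
  have Pw' : P w' = (Lam - n%:R + (letter_degree C p a)%:~R) *: w'.
    have [PP PE] := linear_pack lP.
    rewrite /w' PE linear_sum scaler_sumr; apply: eq_bigr => i _.
    rewrite linearZ /= -PE total_grading_letter // Pw linearZ /= -scalerDl !scalerA.
    by rewrite mulrC.
  have [n' nE _] := depth_eigen lP sp Pw' w'n0.
  have nn' : (n = n' + absz (letter_degree C p a))%N.
    apply/eqP; rewrite -(eqr_nat F) natrD -[(absz _)%:R]/((absz _)%:Z%:~R).
    rewrite gtz0_abs // -subr_eq0; apply/eqP.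
    have -> : n%:R = Lam + (letter_degree C p a)%:~R - (Lam - n'%:R) by rewrite -nE; ring.
    by ring.
  have := min n' _; rewrite nn' -[X in (_ <= X)%N]addn0 leq_add2l => /(_ _) le.
  have : (absz (letter_degree C p a) <= 0)%N.
    by apply: le; exists (g' + m), w'; split=> //; rewrite Pw' nE.
  by rewrite leqn0 absz_eq0 => /eqP z; rewrite z ltxx in pa.
have [c wE] := joint_singular q_span C_bound Xv sing.
have c0 : c != 0 by apply: contraNneq w'0 => z; rewrite wE z scale0r.
exists g'; have := lin_closedZ c^-1 cN Nw'.
have [b bE] := linear_pack (bottom_linear g').
by rewrite wE bE linearZ scalerA mulVf // scale1r.
Qed.

Definition top_cyclic h : set E := cyclic (bottom h (t v)).

Lemma bottom_set_submodule : submodule (fun f : E => fsupp f /\ tau f = 0).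
Proof.
apply: setI_submodule; first exact: finite_support_submodule.
exact: (preimage_submodule (@tau_hom F G k I W fo _ _ chi eta _ _) (zero_submodule E)).
Qed.

Lemma bottom_in g w : fsupp (bottom g w) /\ tau (bottom g w) = 0.
Proof.
split; first exact: finite_support_delta.
by rewrite /bottom tau_delta linear0.
Qed.

Lemma top_cyclic_bottom h f : top_cyclic h f -> fsupp f /\ tau f = 0.
Proof.
apply: (cyclic_min (N := fun f => fsupp f /\ tau f = 0)); last exact: bottom_in.
exact: bottom_set_submodule.
Qed.

Lemma top_cyclic_min h (N : set E) : submodule N -> N (bottom h (t v)) ->
  forall f, top_cyclic h f -> N f.
Proof. exact: cyclic_min. Qed.

Definition level_sum (m : 'rV[int]_k) : F := \sum_i lam i (hK1 G) * chi i m.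

Lemma act_central_bottom m g w :
  act (Central (cons_exp 0 m) ord0) (bottom g w) = bottom (g + m) (level_sum m *: w).
Proof.
rewrite /bottom act_central_delta ?cons_exp_head // cons_exp_tail ltwist_top.
congr (dl _ (0, _)); rewrite /level_sum scaler_suml; apply: eq_bigr => i _.
by rewrite (factor_level tP Xv) scalerA mulrC.
Qed.

(** One-sided on purpose: inclusions are what central elements provide, and they add up. The reverse
    inclusion, [period_sym], needs periods in all directions first. *)
Definition period (m : 'rV[int]_k) := forall h f, top_cyclic (h + m) f -> top_cyclic h f.

Lemma level_period m : level_sum m != 0 -> period m.
Proof.
move=> m0 h; apply: top_cyclic_min; first exact: cyclic_submodule.
have [_ _ Na] := cyclic_submodule (bottom h (t v)).
have := Na (Central (cons_exp 0 m) ord0) _ (@cyclic_id F G k.+1 E (bottom h (t v))).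
have [b bE] := linear_pack (bottom_linear (h + m)).
rewrite act_central_bottom bE linearZ -bE.
move/(lin_closedZ (level_sum m)^-1 (submodule_lin_closed (cyclic_submodule _))).
by rewrite scalerA mulVf // scale1r.
Qed.

Lemma period0 : period 0.
Proof. by move=> h f; rewrite addr0. Qed.

Lemma periodD m n : period m -> period n -> period (m + n).
Proof. by move=> pm pn h f; rewrite addrA => /pn /pm. Qed.

Lemma periodMn m (n : nat) : period m -> period (m *+ n).
Proof.
move=> pm; elim: n => [|n IH]; first exact: period0.
by rewrite mulrS; apply: periodD.
Qed.

Lemma period_top h h' : top_cyclic h (bottom h' (t v)) -> period (h' - h).
Proof.
move=> hh' g; apply: top_cyclic_min; first exact: cyclic_submodule.
have := @shift_cyclic F G k I W fo (factor_actP tP) (@factor_act_comm F G I X W t tP)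
  chi eta chiD etaD (g - h) _ _ hh'.
rewrite /bottom !shift_delta addrC subrK.
by have -> : h' + (g - h) = g + (h' - h) by rewrite addrCA.
Qed.

(** The level sum at [m *+ n] is the n-th power sum of the values [chi i m] weighted by the levels.
    The total level being nonzero, [power_sum_neq0] gives a positive n where it does not vanish;
    this is done for [m] and for [- m], and the product of the two exponents serves both. *)
Lemma unit_period (m : 'rV[int]_k) : exists n : nat, (0 < n)%N /\
  forall l : nat, (n %| l)%N -> period (m *+ l) /\ period (m *- l).
Proof.
have gen (m' : 'rV[int]_k) : exists2 n : nat, (0 < n)%N & period (m' *+ n).
  have [n n0 sn] := power_sum_neq0 (fun i => character_neq0 chiD chi0 i m') level_neq0.
  exists n => //; apply: level_period; rewrite /level_sum.
  by under eq_bigr do rewrite (characterMn chiD chi0).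
have [n n0 pn] := gen m; have [n' n'0 pn'] := gen (- m).
exists (n * n')%N; split; first by rewrite muln_gt0 n0.
move=> l /dvdnP[c ->]; split.
  by rewrite mulnA mulnAC mulnC mulrnA; apply: periodMn.
by rewrite -mulNrn mulnA mulnC mulrnA; apply: periodMn.
Qed.

Lemma lattice_period : exists N : nat, forall x : 'rV[int]_k, period (x *+ N.+1).
Proof.
pose e (j : 'I_k) : 'rV[int]_k := delta_mx 0 j.
pose n j := projT1 (cid (unit_period (e j))).
have n0 j : (0 < n j)%N by rewrite /n; case: cid => /= ? [].
have nP j l : (n j %| l)%N -> period (e j *+ l) /\ period (e j *- l).
  by rewrite /n; case: cid => /= ? [_]; apply.
exists (\prod_j n j).-1 => x; have N0 : (0 < \prod_j n j)%N by apply: prodn_gt0.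
rewrite prednK //; set N := (\prod_j n j)%N.
have -> : x *+ N = \sum_j (e j *+ N) *~ x 0 j.
  apply/rowP => l; rewrite summxE (bigD1 l) //= big1 ?addr0 => [|j jl].
    rewrite -!scaler_int -!scaler_nat !mxE !eqxx /= mulr1.
    by rewrite mulrC; congr (_ * _); rewrite intz.
  by rewrite -!scaler_int -!scaler_nat !mxE eq_sym (negPf jl) andbF !mulr0.
elim/big_ind: _ => [||j _]; [exact: period0 | exact: periodD |].
have jN : (n j %| N)%N by rewrite /N (bigD1 j) //= dvdn_mulr.
have [p1 p2] := nP j N jN.
case: (x 0 j) => l; first exact: periodMn.
by rewrite NegzE mulrNz -mulNrz; apply: periodMn.
Qed.

(** - m = N m + (N + 1) (- m), where the first term is a multiple of a period and the second a
    period of the whole lattice. *)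
Lemma period_sym m : period m -> period (- m).
Proof.
move=> pm; have [N pN] := lattice_period.
have -> : - m = m *+ N + (- m) *+ N.+1.
  by rewrite mulNrn mulrS opprD addrCA addrN addr0.
by apply: periodD; [exact: periodMn | exact: pN].
Qed.

(** A nonzero submodule contains the highest weight vector at some exponent h'; then h' - h is a
    period, and its symmetry leads back to the generator at h. *)
Lemma top_cyclic_simple h (N : set E) : submodule N -> (forall f, N f -> top_cyclic h f) ->
  (exists2 f, N f & f != 0) -> forall f, top_cyclic h f -> N f.
Proof.
move=> sN Nh [f Nf f0]; have [sf tf] := top_cyclic_bottom (Nh _ Nf).
have [h' Nh'] := submodule_has_top sN sf tf Nf f0.
have per := period_sym (period_top (Nh _ Nh')).
move=> u hu; apply: (top_cyclic_min sN Nh'); apply: per.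
by rewrite opprB addrCA subrr addr0.
Qed.

Fixpoint top_sum (s : seq 'rV[int]_k) : set E :=
  if s is h :: s' then fun f => exists u w, [/\ top_sum s' u, top_cyclic h w & f = u + w]
  else fun f => f = 0.

Lemma top_sum_submodule s : submodule (top_sum s).
Proof.
elim: s => [|h s IH]; first exact: zero_submodule.
by apply: add_submodule IH _; exact: cyclic_submodule.
Qed.

Lemma top_sum_bounded s : bounded_length (top_sum s).
Proof.
elim: s => [|h s IH]; first exact: bounded_length0.
apply: bounded_length_add => //; [exact: top_sum_submodule | exact: cyclic_submodule |].
by move=> N sN Nh ne; apply: top_cyclic_simple.
Qed.

Lemma top_sum_in s h f : h \in s -> top_cyclic h f -> top_sum s f.
Proof.
elim: s => // h' s IH; rewrite in_cons => /predU1P[<-|hs] hf.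
  by exists 0, f; rewrite add0r; split=> //; have [] := top_sum_submodule s.
exists f, 0; rewrite addr0; split=> //; first exact: IH.
by have [] := cyclic_submodule (bottom h' (t v)).
Qed.

(** With N + 1 a period in every direction, the cyclic submodules at exponents in a box of side N +
    1 contain the highest weight vectors at all exponents, and these generate everything. *)
Lemma bottom_set_bounded : bounded_length (fun f : E => fsupp f /\ tau f = 0).
Proof.
have [N pN] := lattice_period.
pose box : seq 'rV[int]_k := [seq \row_j (f j : nat)%:Z | f : {ffun 'I_k -> 'I_N.+1}].
apply: bounded_length_sub (top_sum_bounded box).
have sB := top_sum_submodule box; have cB := submodule_lin_closed sB.
have [B0 _ Ba] := sB.
have top h : top_sum box (bottom h (t v)).
  pose x : 'rV[int]_k := \row_j (divz (h 0 j) N.+1%:Z).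
  pose r : 'rV[int]_k := \row_j (modz (h 0 j) N.+1%:Z).
  have hE : h = r + x *+ N.+1.
    apply/rowP => j; rewrite -scaler_nat !mxE addrC mulrC.
    by rewrite natz -divz_eq.
  have rb : r \in box.
    have rj (j : 'I_k) : (absz (modz (h 0%R j) N.+1%:Z) < N.+1)%N.
      by rewrite -ltz_nat gez0_abs ?modz_ge0 // ltz_pmod.
    apply/mapP; exists [ffun j => Ordinal (rj j)]; rewrite ?mem_enum //.
    by apply/rowP => j; rewrite !mxE ffunE /= gez0_abs // modz_ge0.
  apply: (top_sum_in rb); apply: (pN x); rewrite -hE; exact: cyclic_id.
have all w : forall g, top_sum box (bottom g w).
  move: w; apply: (factor_generate (tP := tP) q_span C_bound Xv
    (N := fun w => forall g, top_sum box (bottom g w))).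
  - split=> [g|a u w hu hw g].
      by have [b ->] := linear_pack (bottom_linear g); rewrite linear0.
    rewrite bottom_linear; apply: (lin_closedD cB) => //; exact: (lin_closedZ _ cB).
  - exact: top.
  move=> i x m u hu g; have [L LE] := character_interpolation chiD chi0 chi_sep i.
  (* Interpolation turns the action on position i alone into a combination of toroidal elements;
     starting at [g - p.2] makes all terms end at the same exponent g. *)
  have -> : bottom g (fo i (Loop x m) u) =
      \sum_(p <- L) p.1 *: act (Loop x (cons_exp (m 0 0) p.2)) (bottom (g - p.2) u).
    under eq_bigr do rewrite act_loop_bottom cons_exp_tail cons_exp_head subrK.
    have [b ->] := linear_pack (bottom_linear g).
    under eq_bigr do rewrite -linearZ.
    rewrite -linear_sum; congr (b _); rewrite -const_mx1.
    under eq_bigr do rewrite scaler_sumr.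
    rewrite exchange_big (bigD1 i) //= [X in _ + X]big1 ?addr0 => [|j ji].
      under eq_bigr do rewrite scalerA.
      by rewrite -scaler_suml -LE eqxx scale1r.
    under eq_bigr do rewrite scalerA.
    by rewrite -scaler_suml -LE (negPf ji) scale0r.
  apply: (lin_closed_sum cB) => p _ _; apply: (lin_closedZ _ cB); apply: Ba.
  exact: hu.
move=> f [sf tf]; have [s us ->] := bottom_support sf tf.
by apply: (lin_closed_sum cB) => g _ _; exact: all.
Qed.

Lemma finite_support_bounded : bounded_length fsupp.
Proof.
apply: (bounded_length_ext (@tau_hom F G k I W fo _ _ chi eta _ _)).
- exact: finite_support_submodule.
- exact: bottom_set_bounded.
apply: bounded_length_sub bottom_set_bounded => _ [f sf ->]; split; last exact: tau_tau.
by have [s sE] := sf; exists s => g gs; rewrite tauE sE.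
Qed.

Lemma ltwist_at0 z w :
  twist chi eta 0 (fun i => fo i z) w = (\sum_i fo i z w.1, \sum_i fo i z w.2).
Proof.
rewrite /twist; congr (_, _); first by apply: eq_bigr => i _; rewrite chi0 scale1r.
rewrite [X in _ + X]big1 ?addr0 => [|i _].
  by apply: eq_bigr => i _; rewrite chi0 scale1r.
by rewrite (eta0 etaD) mulr0 scale0r.
Qed.

Lemma tail_exp0 : tail_exp 0 = 0 :> 'rV[int]_k.
Proof. by apply/rowP => i; rewrite !mxE. Qed.

Lemma act_loop0E x (f : E) g :
  act (Loop x 0) f g = (\sum_i fo i (Loop x 0) (f g).1, \sum_i fo i (Loop x 0) (f g).2).
Proof.
rewrite -[LHS]/(twist chi eta _ _ (f (g - tail_exp 0))) tail_exp0 subr0 mxE.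
have -> : const_mx 0 = 0 :> 'rV[int]_1 by apply/rowP => i; rewrite !mxE.
exact: ltwist_at0.
Qed.

Lemma act_central0E (f : E) g : act (Central 0 ord0) f g =
  (\sum_i fo i (Central 0 ord0) (f g).1, \sum_i fo i (Central 0 ord0) (f g).2).
Proof.
rewrite -[LHS]/(if (ord0 == ord0 :> 'I_k.+1) && ((0 : 'rV[int]_k.+1) 0 ord0 == 0)
  then twist chi eta _ _ (f (g - tail_exp 0)) else 0).
by rewrite mxE !eqxx /= tail_exp0 subr0 ltwist_at0.
Qed.

Lemma act_central0_lift (f : E) j : act (Central 0 (lift ord0 j)) f = 0.
Proof. by apply: act_central_eq0. Qed.

Lemma act_deg0E (f : E) g : act (Deg ord0) f g =
  (\sum_i fo i (Deg ord0) (f g).1, \sum_i fo i (Deg ord0) (f g).2).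
Proof. by rewrite act_deg1E ltwist_at0. Qed.

Definition affine_part (H : htor G k.+1) : htor G 1 :=
  (H.1.1, const_mx (H.1.2 0 ord0), const_mx (H.2 0 ord0)).

Definition degree_part (H : htor G k.+1) g : F :=
  \sum_j H.2 0 (lift ord0 j) * (g 0 j)%:~R.

Definition joint_hact (H : htor G k.+1) g (w : W) : W :=
  \sum_i (hact (V := factor_module tP i) (affine_part H) w : W) + degree_part H g *: w.

Lemma hact_loopE (H : htor G k.+1) (f : E) g :
  hact H f g = (joint_hact H g (f g).1, joint_hact H g (f g).2).
Proof.
have hE : hact H f = act (Loop (vsval H.1.1) 0) f +
    H.1.2 0 ord0 *: act (Central 0 ord0) f + (H.2 0 ord0 *: act (Deg ord0) f +
    \sum_j H.2 0 (lift ord0 j) *: act (Deg (lift ord0 j)) f).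
  rewrite /hact !big_ord_recl; congr (_ + _ + _).
  by rewrite big1 ?addr0 // => j _; rewrite act_central0_lift scaler0.
rewrite hE -[LHS]/(act (Loop (vsval H.1.1) 0) f g +
    H.1.2 0 ord0 *: act (Central 0 ord0) f g + (H.2 0 ord0 *: act (Deg ord0) f g +
    (\sum_j H.2 0 (lift ord0 j) *: act (Deg (lift ord0 j)) f : E) g)).
rewrite sum_loopE.
under [X in _ + (_ + X)]eq_bigr => j _ do
  rewrite -[_ g]/(H.2 0 (lift ord0 j) *: act (Deg (lift ord0 j)) f g) act_degE scalerA.
rewrite -scaler_suml act_loop0E act_central0E act_deg0E.
have jE (w : W) : joint_hact H g w = \sum_i fo i (Loop (vsval H.1.1) 0) w +
   H.1.2 0 ord0 *: (\sum_i fo i (Central 0 ord0) w) +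
   (H.2 0 ord0 *: (\sum_i fo i (Deg ord0) w) + degree_part H g *: w).
  rewrite addrA /joint_hact !scaler_sumr -!big_split; congr (_ + _).
  by apply: eq_bigr => i _; rewrite /hact /= !big_ord1 !mxE.
by rewrite !jE.
Qed.

Definition loop_weight (mu : I -> affweight G) g : weight G k.+1 :=
  linfun (fun H : htor G k.+1 => \sum_i (mu i (affine_part H) : F) + degree_part H g : F^o).

Lemma affine_part_linear : linear affine_part.
Proof.
move=> a H K; congr (_, _, _); by apply/rowP => i; rewrite !mxE.
Qed.

Lemma loop_weightE mu g (H : htor G k.+1) :
  loop_weight mu g H = \sum_i (mu i (affine_part H) : F) + degree_part H g.
Proof.
pose f (H : htor G k.+1) : F^o := \sum_i (mu i (affine_part H) : F) + degree_part H g.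
rewrite /loop_weight -/f -[RHS]/(f H).
have lf : linear f.
  move=> a K K'; rewrite /f.
  rewrite -[RHS]/(a * (\sum_i (mu i (affine_part K) : F) + degree_part K g) +
      (\sum_i (mu i (affine_part K') : F) + degree_part K' g)).
  rewrite mulrDr addrACA /degree_part !mulr_sumr -!big_split; congr (_ + _).
    by apply: eq_bigr => i _; rewrite affine_part_linear linearP.
  by apply: eq_bigr => j _ /=; rewrite !mxE mulrDl mulrA.
pose f' : {linear htor G k.+1 -> F^o} :=
  HB.pack_for {linear htor G k.+1 -> F^o} f (GRing.isLinear.Build F _ _ _ f lf).
by rewrite -[f]/(f' : _ -> _) lfunE.
Qed.

Definition joint_weight (mu : I -> affweight G) (w : W) :=
  forall i, in_weight_space (V := factor_module tP i) (mu i) w.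

Lemma joint_weight0 mu : joint_weight mu 0.
Proof.
move=> i H; have [h ->] := linear_pack (@hact_linear F G 1 (factor_module tP i) H).
by rewrite linear0 scaler0.
Qed.

Lemma delta_weight mu g a b : joint_weight mu a -> joint_weight mu b ->
  in_weight_space (loop_weight mu g) (dl g (a, b) : E).
Proof.
move=> ja jb H; apply: funext => g'; rewrite hact_loopE.
rewrite -[RHS]/(loop_weight mu g H *: dl g (a, b) g') !deltaE.
have jw w : joint_weight mu w -> joint_hact H g w = loop_weight mu g H *: w.
  move=> jw; rewrite /joint_hact loop_weightE scalerDl; congr (_ + _).
  by rewrite scaler_suml; apply: eq_bigr => i _; exact: jw.
case: eqP => [->|_]; first by rewrite /= !jw.
have j0 : joint_hact H g' 0 = 0.
  rewrite /joint_hact scaler0 addr0 big1 // => i _.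
  by have [h ->] := linear_pack (@hact_linear F G 1 (factor_module tP i)
    (affine_part H)); rewrite linear0.
by rewrite /= j0 scaler0.
Qed.

Lemma highest_joint_weight : joint_weight lam (t v).
Proof. by apply: tens_weight => i; have [_ _ [_ wv _ _] _] := Xv i. Qed.

Definition grading_element : htor G k.+1 :=
  (rho_check G, 0, \row_j (if j == ord0 then C%:R else 0)).

Lemma hact_grading_element (f : E) : hact grading_element f = loop_grading f.
Proof.
rewrite /hact /loop_grading /=; congr (_ + _).
  by rewrite big1 ?addr0 // => j _; rewrite mxE scale0r.
rewrite big_ord_recl big1 ?addr0 => [|j _]; first by rewrite mxE eqxx.
by rewrite mxE /= scale0r.
Qed.

Lemma loop_gradingE (f : E) g : loop_grading f g = (P (f g).1, P (f g).2).
Proof.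
rewrite /loop_grading -[LHS]/(act (Loop (vsval (rho_check G)) 0) f g +
  C%:R *: act (Deg ord0) f g) act_loop0E act_deg0E.
by congr (_, _) => /=; rewrite scaler_sumr -big_split.
Qed.

Definition degree_element (j : 'I_k) : htor G k.+1 := (0, 0, delta_mx 0 (lift ord0 j)).

Lemma hact_degree_element (V : torModule G k.+1) (f : V) j :
  hact (degree_element j) f = act (Deg (lift ord0 j)) f.
Proof.
rewrite /hact /= loop0 add0r big1 ?add0r => [|i _]; last by rewrite mxE scale0r.
rewrite (bigD1 (lift ord0 j)) //= mxE !eqxx scale1r big1 ?addr0 // => i /negPf ij.
by rewrite mxE ij andbF scale0r.
Qed.

Lemma loop_weight_degree mu g j : loop_weight mu g (degree_element j) = (g 0 j)%:~R.
Proof.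
rewrite loop_weightE big1 ?add0r => [|i _].
  rewrite /degree_part (bigD1 j) //= mxE !eqxx mul1r big1 ?addr0 // => i /negPf ij.
  by rewrite mxE (inj_eq (@lift_inj _ _)) ij andbF mul0r.
have -> : affine_part (degree_element j) = 0.
  by rewrite /affine_part /=; congr (_, _, _); apply/rowP => l; rewrite !mxE.
by rewrite linear0.
Qed.

Lemma weight_space_support (e : E) (mu : weight G k.+1) g j : in_weight_space mu e ->
  e g != 0 -> (g 0 j)%:~R = mu (degree_element j) :> F.
Proof.
move=> we eg0; have := congr1 (fun f : E => f g) (we (degree_element j)).
rewrite hact_degree_element act_degE -[RHS]/(mu (degree_element j) *: e g) => /eqP.
by rewrite -subr_eq0 -scalerBl scaler_eq0 (negPf eg0) orbF subr_eq0 => /eqP.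
Qed.

Lemma weight_space_delta (e : E) (mu : weight G k.+1) g :
  (forall j, (g 0 j)%:~R = mu (degree_element j) :> F) -> in_weight_space mu e ->
  e = dl g (e g).
Proof.
move=> gE we; apply: funext => h; rewrite deltaE; case: eqP => [->//|hg].
apply/eqP/negPn/negP => eh0; case: hg; apply/rowP => j; apply/eqP.
by rewrite -(eqr_int F) (weight_space_support j we eh0) gE.
Qed.

Lemma weight_space_grading (e : E) (mu : weight G k.+1) g : in_weight_space mu e ->
  P (e g).1 = mu grading_element *: (e g).1 /\ P (e g).2 = mu grading_element *: (e g).2.
Proof.
move=> we; have := congr1 (fun f : E => f g) (we grading_element).
rewrite hact_grading_element loop_gradingE.
by rewrite -[RHS]/(mu grading_element *: e g); case: (e g) => a b [].
Qed.

Definition top_vector h : E := dl h (t v, 0).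

Lemma tau_top h : tau (top_vector h) = bottom h (t v).
Proof. exact: tau_delta. Qed.

Lemma top_vector_weight h : in_weight_space (loop_weight lam h) (top_vector h).
Proof. by apply: delta_weight; [exact: highest_joint_weight | exact: joint_weight0]. Qed.

Lemma bottom_vector_weight h : in_weight_space (loop_weight lam h) (bottom h (t v)).
Proof. by apply: delta_weight; [exact: joint_weight0 | exact: highest_joint_weight]. Qed.

Lemma tv_neq0 : t v != 0.
Proof. exact: (tens_highest_neq0 tP q_span C_bound Xv). Qed.

Lemma total_grading_top : P (t v) = Lam *: t v.
Proof.
rewrite /total_weight scaler_suml; apply: eq_bigr => i _.
rewrite /grading_op /= !factor_act_tens -linearZ -linearD /= -/(grading_op C (v i)).
by rewrite (grading_op_highest C (Xv i)) linearZ /= slot_id.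
Qed.

(** The eigenvalues of d_2, ..., d_k pin the exponent to h, and the grading element has the top
    eigenvalue [Lam], which leaves multiples of [t v] in both components. *)
Lemma top_weight_space h (e : E) : in_weight_space (loop_weight lam h) e ->
  exists c c', e = c *: top_vector h + c' *: bottom h (t v).
Proof.
move=> we; have eE := weight_space_delta (fun j => esym (loop_weight_degree lam h j)) we.
have LE : loop_weight lam h grading_element = Lam.
  have [_] := weight_space_grading h (bottom_vector_weight h).
  rewrite /bottom deltaE eqxx /= total_grading_top => /eqP.
  rewrite -subr_eq0 -scalerBl scaler_eq0 (negPf tv_neq0) orbF subr_eq0.
  by move=> /eqP.
have [P1 P2] := weight_space_grading h we; rewrite LE in P1 P2.
have lP := @total_grading_linear F G I X W t tP C.
have gr := total_depth_graded tP q_span C_bound Xv.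
have [c cE] := depth_top lP gr P1; have [c' c'E] := depth_top lP gr P2.
exists c, c'; rewrite eE /top_vector /bottom -!linearZ -linearD; congr (dl h _).
rewrite [LHS]surjective_pairing cE c'E.
by congr (_, _) => /=; rewrite scaler0 ?addr0 ?add0r.
Qed.

(** First-order expansion of the level sum: the second coefficient is its derivative along the
    deformation [eta]. *)
Lemma act_central_top m h : act (Central (cons_exp 0 m) ord0) (top_vector h) =
  level_sum m *: top_vector (h + m) +
  (\sum_i lam i (hK1 G) * (chi i m * eta i m)) *: bottom (h + m) (t v).
Proof.
rewrite /top_vector act_central_delta ?cons_exp_head // cons_exp_tail.
rewrite /bottom -!linearZ -linearD; congr (dl _ _); rewrite /twist /=.
have e (c : I -> F) : \sum_i c i *: fo i (Central 0 ord0) (t v) =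
    (\sum_i lam i (hK1 G) * c i) *: t v.
  rewrite scaler_suml; apply: eq_bigr => i _.
  by rewrite (factor_level tP Xv) scalerA mulrC.
rewrite !e [X in (_, X + _)]big1 => [|i _]; last by rewrite linear0 scaler0.
by congr (_, _) => /=; rewrite scaler0 ?addr0 ?add0r.
Qed.

(** Operators in different positions commute. If p applications of one commuting operator and r of
    another kill a vector, then p + r applications of their sum do. *)
Lemma sum_locally_nilpotent (c : I -> F) z :
  (forall i, locally_nilpotent (@act F G 1 (X i) z)) ->
  locally_nilpotent (fun w : W => \sum_i c i *: fo i z w).
Proof.
move=> nilX; pose A (s : seq I) w := \sum_(i <- s) c i *: fo i z w.
have lA s : linear (A s).
  by apply: linear_fun_sum => i; apply: linear_funZ; exact: linear_eta.
suff nil s : uniq s -> locally_nilpotent (A s).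
  exact: nil (index_enum_uniq I).
elim: s => [_ w|i s IH /= /andP[ins us] w]; first by exists 1%N; rewrite /= /A big_nil.
pose T w := c i *: fo i z w.
have lT : linear T by apply: linear_funZ; exact: linear_eta.
have AE u : A (i :: s) u = T u + A s u by rewrite /A big_cons.
have TA u : T (A s u) = A s (T u).
  rewrite /T /A linear_sum scaler_sumr; apply: eq_big_seq => j js.
  have ij : i != j by apply: contraNneq ins => ->.
  by rewrite !linearZ /= (factor_act_comm tP _ _ _ ij) !scalerA mulrC.
have itl (B : W -> W) m : linear B -> linear (iter m B).
  by move=> lB; elim: m => [|m IHm] // a x y /=; rewrite IHm lB.
have it0 (B : W -> W) m : linear B -> iter m B 0 = 0.
  by move=> lB; have [g ->] := linear_pack (itl B m lB); rewrite linear0.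
have [p Tp] : exists p, iter p T w = 0.
  have [p hp] := factor_nilpotent tP (nilX i) w; exists p.
  have -> : iter p T w = c i ^+ p *: iter p (fo i z) w.
    elim: p {hp} => [|p IHp] /=; first by rewrite expr0 scale1r.
    by rewrite IHp /T linearZ /= scalerA exprS.
  by rewrite hp scaler0.
have [r Ar] := IH us w.
have lB := lA (i :: s).
suff nil2 m u p' r' : (p' + r' <= m)%N -> iter p' T u = 0 -> iter r' (A s) u = 0 ->
    iter m (A (i :: s)) u = 0 by exists (p + r)%N; apply: (nil2 _ _ p r).
elim: m u p' r' => [|m IHm] u p' r' le Tu Au.
  have p0 : p' = 0%N by lia.
  by move: Tu; rewrite p0 /= => ->.
have iT l x : iter l (A s) (T x) = T (iter l (A s) x).
  by elim: l => //= l ->; rewrite TA.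
have iA l x : iter l T (A s x) = A s (iter l T x).
  by elim: l => //= l ->; rewrite TA.
rewrite iterSr AE; have [g gE] := linear_pack (itl (A (i :: s)) m lB).
rewrite gE linearD -gE; have T0 : T 0 = 0 by rewrite /T linear0 scaler0.
have A0 : A s 0 = 0 by have [a ->] := linear_pack (lA s); rewrite linear0.
have [u0|u0] := eqVneq u 0; first by rewrite u0 T0 A0 !it0 // addr0.
case: p' r' le Tu Au => [|p'] [|r'] le Tu Au.
- by case/eqP: u0; exact: Tu.
- by case/eqP: u0; exact: Tu.
- by case/eqP: u0; exact: Au.
have -> : iter m (A (i :: s)) (T u) = 0.
  by apply: (IHm _ p' r'.+1); [lia | rewrite -iterSr | rewrite iT Au T0].
have -> : iter m (A (i :: s)) (A s u) = 0; last by rewrite addr0.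
by apply: (IHm _ p'.+1 r'); [lia | rewrite iA Tu A0 | rewrite -iterSr].
Qed.

(** The twist is triangular with the same diagonal entry twice: a first power kills the first
    component, a second one the remaining vector. *)
Lemma twist_locally_nilpotent m z :
  (forall i, locally_nilpotent (@act F G 1 (X i) z)) ->
  locally_nilpotent (twist chi eta m (fun i => fo i z)).
Proof.
move=> nilX; have nil := sum_locally_nilpotent (fun i => chi i m) nilX.
set A := fun w : W => _ in nil; pose T := twist chi eta m (fun i => fo i z).
have T1 n w : (iter n T w).1 = iter n A w.1.
  by elim: n => //= n IH; rewrite {1}/T /twist /= IH.
have Tt n w : iter n T (0, w) = (0, iter n A w).
  by elim: n => //= n ->; rewrite /T ltwist_top.
move=> w; have [n hn] := nil w.1.
have [l hl] := nil (iter n T w).2; exists (l + n)%N.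
rewrite iterD -/T; have -> : iter n T w = (0, (iter n T w).2).
  by rewrite [LHS]surjective_pairing T1 hn.
by rewrite Tt hl.
Qed.

(** * Submodules of the deformed loop module as objects of the category *)

Section IntegrableObjects.
Variables (U : torModule G k.+1) (f : {linear U -> E}) (level : nat).
Hypotheses (f_inj : injective f) (f_hom : is_hom f) (f_supp : forall u, fsupp (f u)).
Hypothesis total_level : \sum_i lam i (hK1 G) = level%:R.
Hypothesis deg_int : forall (c : F) (w : W), w != 0 -> \sum_i fo i (Deg ord0) w = c *: w ->
  exists n : int, c = n%:~R.

Lemma hact_hom H u : f (hact H u) = hact H (f u).
Proof.
rewrite /hact !linearD !linear_sum f_hom; congr (_ + _ + _);
  by apply: eq_bigr => i _; rewrite linearZ /= f_hom.
Qed.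

(** A finitely supported element is a finite sum of weight vectors of [E]; the image of [f] is a
    submodule, so it contains these components and they can be pulled back. *)
Lemma embedded_diagonalizable : Defs.diagonalizable U.
Proof.
have dX i : Defs.diagonalizable (X i) by have [_ [dX _] _ _] := Xv i.
move=> u.
have sp : lspan (fun e : E => exists mu : weight G k.+1, in_weight_space mu e) (f u).
  have cl := lspan_closed (fun e : E => exists mu : weight G k.+1, in_weight_space mu e).
  have [s _ ->] := finite_support_sum (f_supp u).
  apply: (lin_closed_sum cl) => g _ _; case: (f u g) => a b.
  have -> : dl g (a, b) = dl g (a, 0) + dl g (0, b).
    by rewrite -linearD; congr (dl g _); congr (_, _); rewrite /= ?addr0 ?add0r.
  have half (j : W -> W * W) : linear j ->
      (forall mu w, joint_weight mu w ->
        exists nu, in_weight_space (nu : weight G k.+1) (dl g (j w) : E)) ->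
      forall w, lspan (fun e : E => exists mu : weight G k.+1, in_weight_space mu e) (dl g (j w)).
    move=> lj jw; have [j' jE] := linear_pack lj.
    move=> w; have := factor_weights tP dX w; elim=> [|c x y [mu xw] _ IH].
      by rewrite jE linear0 linear0; apply: lspan0.
    by rewrite jE linearP linearP -jE; apply: lspanD => //; apply: jw xw.
  apply: (lin_closedD cl).
    apply: (half (fun w => (w, 0))) => [c x y|mu w xw].
      by congr (_, _) => /=; rewrite scaler0 addr0.
    by exists (loop_weight mu g); apply: delta_weight => //; exact: joint_weight0.
  apply: (half (fun w => (0, w))) => [c x y|mu w xw].
    by congr (_, _) => /=; rewrite scaler0 addr0.
  by exists (loop_weight mu g); apply: delta_weight => //; exact: joint_weight0.
have cE (mu : weight G k.+1) : lin_closed (fun e : E => in_weight_space mu e).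
  split=> [H|c x y hx hy H].
    by have [h ->] := linear_pack (@hact_linear F G k.+1 E H); rewrite linear0 scaler0.
  by rewrite hact_linear hx hy scalerDr !scalerA mulrC.
have [r [w [ur wE uE]]] := graded_decomposition cE sp.
have [N0 Nl Na] : submodule (image_set f setT).
  by apply: image_submodule.
have img mu : mu \in r -> exists2 x, True & w mu = f x.
  move=> mr; apply: (@eigen_components F E _ (htor G k.+1) (fun H => @hact F G k.+1 E H)
    (image_set f setT) r w (fun mu H => mu H)) mr => //.
  - by move=> H; exact: hact_linear.
  - by move=> H e; apply: hact_submodule; split.
  - by move=> mu' H _; exact: wE.
  - move=> mu1 mu2 _ _ ne; apply: contrapT => hn; case/eqP: ne; apply/lfunP => H.
    by apply/eqP/negPn/negP => hH; apply: hn; exists H.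
  - by exists u.
pose x mu := if pselect (mu \in r) is left mr then projT1 (cid2 (img mu mr)) else 0.
have xE mu : mu \in r -> w mu = f (x mu).
  by rewrite /x => mr; case: pselect => // mr'; case: cid2.
exists [seq x mu | mu <- r].
  apply: f_inj; rewrite big_map linear_sum uE; apply: eq_big_seq => mu mr.
  exact: xE.
move=> _ /mapP[mu mr ->]; exists mu => H; apply: f_inj.
by rewrite hact_hom linearZ /= -(xE _ mr); exact: wE.
Qed.

Lemma embedded_integrable : integrable U.
Proof.
split; first exact: embedded_diagonalizable.
move=> a x m ra xa; pose A := @act F G k.+1 E (Loop x m).
have itf n u : f (iter n (act (Loop x m)) u) = iter n A (f u).
  by elim: n => //= n IH; rewrite f_hom IH.
suff nil e : fsupp e -> exists n, iter n A e = 0.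
  move=> u; have [n hn] := nil _ (f_supp u); exists n; apply: f_inj.
  by rewrite itf hn linear0.
have lA : linear A by exact: linear_eta.
have itl n : linear (iter n A).
  by elim: n => [|n IH] //; exact: (linear_comp lA IH).
have it0 n : iter n A 0 = 0 by have [h ->] := linear_pack (itl n); rewrite linear0.
have cN : lin_closed (fun e => exists n, iter n A e = 0).
  split; first by exists 0%N.
  move=> c u w [n hn] [l hl]; exists (n + l)%N.
  by rewrite itl [in X in X + _]addnC !iterD hn hl !it0 scaler0 addr0.
move=> /finite_support_sum[s _ ->].
apply: (lin_closed_sum cN) => g _ _.
have nilX i : locally_nilpotent (@act F G 1 (X i) (Loop x (const_mx (m 0 ord0)))).
  by have [_ [_ nX] _ _] := Xv i; exact: nX ra xa.
have [n hn] := twist_locally_nilpotent (tail_exp m) nilX (e g); exists n.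
have -> : iter n A (dl g (e g)) = dl (g + tail_exp m *+ n)
    (iter n (twist chi eta (tail_exp m) (fun i => fo i (Loop x (const_mx (m 0 ord0))))) (e g)).
  elim: n {hn} => [|n IH]; first by rewrite mulr0n addr0.
  by rewrite iterS IH /A act_loop_delta -addrA -mulrSr.
by rewrite hn linear0.
Qed.

(** A weight determines the exponent g through d_2, ..., d_k and the depth n through the grading
    element, so its space lies in two copies of the span of [T n] placed at g. *)
Lemma embedded_weight_spaces : finite_weight_spaces U.
Proof.
move=> mu.
have lP := @total_grading_linear F G I X W t tP C.
have [T T0 sp] := total_depth_graded tP q_span C_bound Xv.
have [s sE] : exists s : seq E, forall e, fsupp e -> in_weight_space mu e -> spanby s e.
  have [[g gE]|ng] := pselect (exists g, forall j, (g 0 j)%:~R = mu (degree_element j) :> F); last first.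
    exists [::] => e _ we; suff -> : e = 0 by exact: lspan0.
    apply: funext => g; apply/eqP/negPn/negP => eg0; apply: ng; exists g => j.
    exact: weight_space_support we eg0.
  have [[n nE]|nn] := pselect (exists n : nat, mu grading_element = Lam - n%:R); last first.
    exists [::] => e _ we; rewrite (weight_space_delta gE we).
    have z w : P w = mu grading_element *: w -> w = 0.
      move=> Pw; apply/eqP/negPn/negP => w0.
      by have [n nE _] := depth_eigen lP sp Pw w0; apply: nn; exists n.
    have [P1 P2] := weight_space_grading g we.
    rewrite [e g]surjective_pairing (z _ P1) (z _ P2).
    have -> : dl g (0, 0) = 0 by exact: (linear0 (dl g)).
    exact: lspan0.
  exists ([seq dl g (x, 0) | x <- T n] ++ [seq dl g (0, x) | x <- T n]) => e _ we.
  have Tn w : P w = mu grading_element *: w -> spanby (T n) w.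
    move=> Pw; have [->|w0] := eqVneq w 0; first exact: lspan0.
    have [l lE sl] := depth_eigen lP sp Pw w0.
    by have -> : n = l by apply: (@depth_shift_inj F Lam); rewrite -nE.
  have [P1 P2] := weight_space_grading g we.
  rewrite (weight_space_delta gE we) [e g]surjective_pairing.
  have -> : dl g ((e g).1, (e g).2) = dl g ((e g).1, 0) + dl g (0, (e g).2).
    by rewrite -linearD; congr (dl g _); congr (_, _); rewrite /= ?addr0 ?add0r.
  have half (j : W -> W * W) w : linear j -> spanby (T n) w ->
      spanby [seq dl g (j x) | x <- T n] (dl g (j w)).
    move=> lj; have [j' jE] := linear_pack lj; elim=> [|c x y xT _ IH].
      have -> : j 0 = 0 by rewrite jE linear0.
      by rewrite linear0; apply: lspan0.
    by rewrite (lj c x y) linearP; apply: lspanD => //; apply: map_f.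
  apply: lin_closedD; first exact: lspan_closed.
    apply: (lspan_mono (B := fun e => e \in [seq dl g (x, 0) | x <- T n])) => [x xs|].
      by rewrite mem_cat xs.
    apply: (half (fun w => (w, 0))) (Tn _ P1) => c x y.
    by congr (_, _) => /=; rewrite scaler0 addr0.
  apply: (lspan_mono (B := fun e => e \in [seq dl g (0, x) | x <- T n])) => [x xs|].
    by rewrite mem_cat xs orbT.
  apply: (half (fun w => (0, w))) (Tn _ P2) => c x y.
  by congr (_, _) => /=; rewrite scaler0 addr0.
have [||s' s'E] := spanby_preim (P := fun u : U => in_weight_space mu u) f_inj _ (s := s).
- split=> [H|c x y hx hy H].
    by have [h ->] := linear_pack (@hact_linear F G k.+1 U H); rewrite linear0 scaler0.
  by rewrite hact_linear hx hy scalerDr !scalerA mulrC.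
- move=> u wu; apply: sE => // H.
  by rewrite -hact_hom wu linearZ.
by exists s' => u /s'E /spanby_coef.
Qed.

Lemma embedded_in_Jint : in_Jint level U.
Proof.
split.
- exact: embedded_integrable.
- exact: (bounded_finite_length f_inj f_hom f_supp finite_support_bounded).
- exact: embedded_weight_spaces.
- move=> j c u u0 uE.
  have fu0 : f u != 0 by apply: contra u0 => /eqP e; apply/eqP/f_inj; rewrite e linear0.
  have [g fg0] : exists g, f u g != 0.
    apply: contrapT => hn; case/eqP: fu0; apply: funext => g.
    by apply/eqP/negPn/negP => h; apply: hn; exists g.
  have fE : act (Deg j) (f u) g = c *: f u g by rewrite -f_hom uE linearZ.
  case: (unliftP ord0 j) fE => [i ->|->].
    rewrite act_degE => /eqP; rewrite -subr_eq0 -scalerBl scaler_eq0 (negPf fg0) orbF.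
    by rewrite subr_eq0 => /eqP <-; exists (g 0 i).
  rewrite act_deg0E; case: (f u g) fg0 => a b ab [e1 e2].
  have [a0|a0] := eqVneq a 0; last exact: deg_int a0 e1.
  by apply: (deg_int _ e2); apply: contra ab => /eqP b0; rewrite a0 b0.
- move=> j u; apply: f_inj; rewrite f_hom linearZ; apply: funext => g.
  rewrite -[RHS]/((if j == ord0 then level%:R else 0) *: f u g).
  case: (unliftP ord0 j) => [i ->|->].
    by rewrite act_central0_lift scale0r.
  rewrite eqxx act_central0E [f u g in RHS]surjective_pairing -total_level.
  by congr (_, _) => /=; rewrite scaler_suml; apply: eq_bigr => i _;
    rewrite (factor_level tP Xv).
Qed.

End IntegrableObjects.

End LoopHighest.

(** * Linkage *)

Section Realization.
Variables (F : numClosedFieldType) (G : simpleLie F) (k : nat).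
Variables (pi : weight_map G k) (D : realization pi).
Local Notation I := (finsupp pi).
Local Notation W := (Xtens D).
Local Notation tP := (tensP D).
Local Notation v := (vfac D).
Local Notation fo := (factor_act tP).
Local Notation lam := (fun i : I => pi (val i)).
Local Notation chi := (fun (i : I) (m : 'rV[int]_k) => ev (val i) m).

Lemma ev_D (M : torus F k) m n : ev M (m + n) = ev M m * ev M n.
Proof.
rewrite /ev -big_split; apply: eq_bigr => i _ /=; rewrite mxE expfzDr //.
by have /forallP := valP M; apply.
Qed.

Lemma ev_0 (M : torus F k) : ev M 0 = 1.
Proof. by rewrite /ev big1 // => i _; rewrite mxE expr0z. Qed.

Lemma ev_separates (M M' : torus F k) : M != M' -> exists m, ev M m != ev M' m.
Proof.
move=> MM'.
have [l lne] : exists l, val M 0 l != val M' 0 l.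
  apply: contrapT => hn; case/eqP: MM'; apply: val_inj; apply/rowP => l.
  by apply/eqP/negPn/negP => h; apply: hn; exists l.
have evE (N : torus F k) : ev N (delta_mx 0 l) = val N 0 l.
  rewrite /ev (bigD1 l) //= mxE !eqxx expr1z big1 ?mulr1 // => i /negPf il.
  by rewrite mxE il andbF expr0z.
by exists (delta_mx 0 l); rewrite !evE.
Qed.

Lemma xactE Y m w : xact D Y m w = \sum_(i : I) ev (val i) m *: fo i Y w.
Proof.
move: w; apply: (tens_eq tP) => [||x]; first exact: linear_eta.
  by apply: linear_fun_sum => i; apply: linear_funZ; exact: linear_eta.
rewrite xactP; apply: eq_bigr => i _; congr (_ *: _).
by rewrite factor_act_tens slotE.
Qed.

Lemma monomials_group (V : lmodType F) (phi : 'rV[int]_k -> {linear W -> V})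
    (L : seq ('rV[int]_k * W)) :
  \sum_(p <- L) phi p.1 p.2 =
  \sum_(g <- undup [seq p.1 | p <- L]) phi g (\sum_(p <- L | p.1 == g) p.2).
Proof.
under [RHS]eq_bigr do rewrite linear_sum.
rewrite (exchange_big_dep xpredT) //=; apply: eq_big_seq => p pL.
have pin : p.1 \in undup [seq p.1 | p <- L] by rewrite mem_undup map_f.
rewrite big_mkcond (big_rem p.1) //= eqxx big_seq big1 ?addr0 // => g gs.
by case: eqP => // pg; move: gs; rewrite -pg mem_rem_uniqF ?undup_uniq.
Qed.

Lemma mono_sum (y : Lmod D) : exists L : seq ('rV[int]_k * W), y = \sum_(p <- L) mono D p.1 p.2.
Proof.
have [s [w ->]] := mono_span y; exists [seq (g, w g) | g <- s].
by rewrite big_map.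
Qed.

Lemma mono_sum_eq0 (L : seq ('rV[int]_k * W)) :
  \sum_(p <- L) mono D p.1 p.2 = 0 -> forall g, \sum_(p <- L | p.1 == g) p.2 = 0.
Proof.
rewrite monomials_group => s0 g.
have [gs|gs] := boolP (g \in undup [seq p.1 | p <- L]).
  exact: (mono_free (w := fun g => \sum_(p <- L | p.1 == g) p.2) (undup_uniq _) s0 gs).
rewrite big_seq_cond big1 // => p /andP[pL /eqP pg]; case/negP: gs.
by rewrite mem_undup -pg map_f.
Qed.

Section Embedding.
Variables (eta : I -> 'rV[int]_k -> F).
Hypothesis etaD : forall i m n, eta i (m + n) = eta i m + eta i n.

Let chiD : forall i m n, chi i (m + n) = chi i m * chi i n := fun i => ev_D (val i).
Let chi0 : forall i, chi i 0 = 1 := fun i => ev_0 (val i).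
Local Notation E := (highest_loop_module tP chiD etaD).
Local Notation bot := (bottom tP chiD etaD).
Local Notation tau := (@tau F G k I W fo (factor_actP tP) (@factor_act_comm F G I (Xfac D) W _ tP)
   chi eta chiD etaD).
Local Notation fsupp := (@finite_support F G k I W fo (factor_actP tP)
   (@factor_act_comm F G I (Xfac D) W _ tP) chi eta chiD etaD).

(** L(X_pi) is only known through spanning and freeness of its monomials, so a presentation is
    chosen; freeness makes the result independent of it. The deformation [eta] is arbitrary: the
    undeformed module sits at the bottom of each of them. *)
Definition embed_fun (y : Lmod D) : E :=
  \sum_(p <- projT1 (cid (mono_sum y))) bot p.1 p.2.

Let botL g : {linear W -> E} := projT1 (linear_pack (bottom_linear tP chiD etaD g)).
Let botLE g w : botL g w = bot g w.
Proof. by rewrite /botL; case: linear_pack => /= b <-. Qed.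

Let bot_sum_eq0 (L : seq ('rV[int]_k * W)) :
  \sum_(p <- L) mono D p.1 p.2 = 0 -> \sum_(p <- L) bot p.1 p.2 = 0.
Proof.
move=> /mono_sum_eq0 s0; under eq_bigr do rewrite -botLE.
by rewrite monomials_group big1 // => g _; rewrite s0 linear0.
Qed.

Lemma embed_sumE (L : seq ('rV[int]_k * W)) :
  embed_fun (\sum_(p <- L) mono D p.1 p.2) = \sum_(p <- L) bot p.1 p.2.
Proof.
rewrite /embed_fun; case: cid => /= L' e; apply/eqP; rewrite -subr_eq0; apply/eqP.
have := @bot_sum_eq0 (L' ++ [seq (p.1, - p.2) | p <- L]).
rewrite !big_cat !big_map /= -e.
have -> : \sum_(p <- L) mono D p.1 (- p.2) = - \sum_(p <- L) mono D p.1 p.2.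
  by rewrite -sumrN; apply: eq_bigr => p _; rewrite linearN.
have -> : \sum_(p <- L) bot p.1 (- p.2) = - \sum_(p <- L) bot p.1 p.2.
  by rewrite -sumrN; apply: eq_bigr => p _; rewrite -!botLE linearN.
by apply; rewrite subrr.
Qed.

Lemma embed_linear : linear embed_fun.
Proof.
move=> a y z; have [L ->] := mono_sum y; have [L' ->] := mono_sum z.
have -> : a *: (\sum_(p <- L) mono D p.1 p.2) + \sum_(p <- L') mono D p.1 p.2 =
    \sum_(p <- [seq (p.1, a *: p.2) | p <- L] ++ L') mono D p.1 p.2.
  rewrite big_cat big_map scaler_sumr; congr (_ + _); apply: eq_bigr => p _.
  by rewrite linearZ.
rewrite !embed_sumE big_cat big_map scaler_sumr; congr (_ + _); apply: eq_bigr => p _.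
by rewrite -!botLE linearZ.
Qed.

HB.instance Definition _ := GRing.isLinear.Build F (Lmod D) E _ embed_fun embed_linear.
Definition embed : {linear Lmod D -> E} := embed_fun.

Lemma embed_mono g w : embed (mono D g w) = bot g w.
Proof. by have := embed_sumE [:: (g, w)]; rewrite !big_seq1. Qed.

Lemma embed_inj : injective embed.
Proof.
move=> y z e; apply/eqP; rewrite -subr_eq0; apply/eqP.
have : embed (y - z) = 0 by rewrite linearB e subrr.
have [L ->] := mono_sum (y - z).
rewrite -[embed _]/(embed_fun _) embed_sumE => b0.
rewrite monomials_group big1 // => g _.
suff -> : \sum_(p <- L | p.1 == g) p.2 = 0 by rewrite linear0.
have := congr1 (fun f : E => (f g).2) b0; rewrite sum_loopE => e'; apply: etrans e'.
rewrite (big_morph (fun u : W * W => u.2) (id1 := 0) (op1 := +%R)) // big_mkcond.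
apply: eq_bigr => p _; rewrite /bottom deltaE eq_sym.
by case: eqP.
Qed.

Lemma embed_hom : is_hom embed.
Proof.
move=> z y; move: y.
have lin1 : linear (fun y => embed (act z y)) by apply: linear_comp; exact: linear_eta.
have lin2 : linear (fun y => act z (embed y)) by apply: linear_comp; exact: linear_eta.
have cl := eq_linear_closed lin1 lin2.
move=> y; have [L ->] := mono_sum y.
apply: (lin_closed_sum cl) => -[g w] _ _ /=; rewrite embed_mono.
case: z {lin1 lin2 cl} => [x m|m j|j].
- rewrite Lmod_loop embed_mono act_loop_bottom xactE.
  by [].
- case: (unliftP ord0 j) => [i ->|->].
    by rewrite Lmod_central linear0 act_central_eq0.
  rewrite Lmod_central1; case: eqP => [m0|/eqP m0]; last first.
    by rewrite linear0 act_central_eq0 // (negPf m0) andbF.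
  by rewrite embed_mono xactE /bottom act_central_delta // ltwist_top.
- case: (unliftP ord0 j) => [i ->|->].
    by rewrite Lmod_deg linearZ embed_mono; apply: esym; exact: act_deg_delta.
  rewrite Lmod_deg1 embed_mono act_deg1_bottom //; congr (bot g _).
  by rewrite xactE; apply: eq_bigr => i _; rewrite ev_0 scale1r.
Qed.

Lemma embed_bottom y : fsupp (embed y) /\ tau (embed y) = 0.
Proof.
have [L ->] := mono_sum y; have := bottom_set_submodule tP chiD etaD.
move=> /submodule_lin_closed cl; rewrite linear_sum.
apply: (lin_closed_sum cl) => p _ _; rewrite embed_mono; exact: bottom_in.
Qed.

End Embedding.
End Realization.

Section Linkage.
Variables (F : numClosedFieldType) (G : simpleLie F) (k : nat).
Variables (pi : weight_map G k) (D : realization pi).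
Variables (q : seq (G * int)) (C level : nat).
Hypothesis q_span : homogeneous_spanning q.
Hypothesis C_bound : forall p : G * int, p \in q -> `|p.2| < C%:Z.
Hypothesis pi_integral : integer_degrees (Lmod D).
Local Notation I := (finsupp pi).
Local Notation W := (Xtens D).
Local Notation tP := (tensP D).
Local Notation t := (tens (vfac D)).
Local Notation fo := (factor_act tP).
Local Notation lam := (fun i : I => pi (val i)).
Local Notation chi := (fun (i : I) (m : 'rV[int]_k) => ev (val i) m).
Hypothesis total_level : \sum_i lam i (hK1 G) = level%:R.
Hypothesis level_gt0 : (0 < level)%N.
Implicit Types (g h m : 'rV[int]_k).

Let Xv : forall i : I, is_Xlambda (lam i) (vfac D i) := @XfacP F G k pi D.

Let chi_sep (i j : I) : i != j -> exists m, chi i m != chi j m.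
Proof. by move=> ij; apply: ev_separates; apply: contra ij => /eqP /val_inj ->. Qed.

Let level_neq0 : \sum_i lam i (hK1 G) != 0.
Proof. by rewrite total_level pnatr_eq0 -lt0n. Qed.

Lemma mono_neq0 g w : w != 0 -> mono D g w != 0.
Proof.
apply: contra => /eqP e; apply/eqP.
apply: (@mono_free F G k pi D [:: g] (fun=> w)) (mem_head g [::]) => //.
by rewrite big_seq1.
Qed.

(** Integrality of the d_1 eigenvalues passes from L(X_pi) to [W] through the monomials of exponent
    0, and from there to the deformed module. *)
Lemma tensor_degree_int (c : F) (w : W) : w != 0 ->
  \sum_i fo i (Deg ord0) w = c *: w -> exists n : int, c = n%:~R.
Proof.
move=> w0 e; apply: (pi_integral (i := ord0) (mono_neq0 0 w0)).
rewrite Lmod_deg1 xactE -linearZ -e; congr (mono D 0 _).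
by apply: eq_bigr => i _; rewrite ev_0 scale1r.
Qed.

Lemma level_sum0 : level_sum lam chi 0 = level%:R.
Proof. by rewrite -total_level; apply: eq_bigr => i _; rewrite ev_0 mulr1. Qed.

Section Objects.
Variable eta : I -> 'rV[int]_k -> F.
Hypothesis etaD : forall i m n, eta i (m + n) = eta i m + eta i n.

Let chiD : forall i m n, chi i (m + n) = chi i m * chi i n := fun i => ev_D (val i).
Let chi0 : forall i, chi i 0 = 1 := fun i => ev_0 (val i).
Local Notation E := (highest_loop_module tP chiD etaD).
Local Notation bot := (bottom tP chiD etaD).
Local Notation top := (top_vector tP (vfac D) chiD etaD).
Local Notation tau := (@tau F G k I W fo (factor_actP tP) (@factor_act_comm F G I (Xfac D) W _ tP)
   chi eta chiD etaD).
Local Notation fsupp := (@finite_support F G k I W fo (factor_actP tP)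
   (@factor_act_comm F G I (Xfac D) W _ tP) chi eta chiD etaD).
Local Notation Xm g := (cyclic_module (mono D g t)).

Definition lowest_embed g : {linear Xm g -> E} := embed D etaD \o cyclic_incl (mono D g t).

Lemma lowest_embed_inj g : injective (lowest_embed g).
Proof. by move=> u w /embed_inj /cyclic_incl_inj. Qed.

Lemma lowest_embed_hom g : is_hom (lowest_embed g).
Proof. by move=> y u; rewrite /= embed_hom. Qed.

Lemma lowest_embed_gen g : lowest_embed g (cyclic_gen (mono D g t)) = bot g t.
Proof. by rewrite /= embed_mono. Qed.

Lemma lowest_in_Jint g : in_Jint level (Xm g).
Proof.
apply: (embedded_in_Jint q_span C_bound Xv chi0 chi_sep level_neq0
  (@lowest_embed_inj g) (@lowest_embed_hom g) _ total_level tensor_degree_int).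
by move=> u; have [] := embed_bottom etaD (cyclic_incl (mono D g t) u).
Qed.

Lemma tens_neq0 : t != 0.
Proof. by have := tv_neq0 tP q_span C_bound Xv. Qed.

Lemma lowest_indecomposable g : indecomposable (Xm g).
Proof.
have gE := lowest_embed_gen g; have inj := @lowest_embed_inj g.
have hm := @lowest_embed_hom g.
apply: (@indecomposable_dual F G k.+1 _ E (cyclic_gen (mono D g t)) (lowest_embed g) tau
  (loop_weight lam g)) => //.
- exact: cyclic_gen_generates.
- apply: contra_neq tens_neq0 => e; apply: (@bottom_inj F G k I _ W _ tP chi eta chiD etaD g).
  rewrite -gE e linear0.
  by have [b ->] := linear_pack (bottom_linear tP chiD etaD g); rewrite linear0.
- exact: tau_hom.
- move=> H; apply: inj; rewrite [RHS]linearZ [in RHS]gE.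
  rewrite hact_hom // gE; exact: (bottom_vector_weight tP Xv chiD etaD chi0 g H).
- move=> u wu; rewrite gE.
  have wf : in_weight_space (loop_weight lam g) (lowest_embed g u).
    by move=> H; rewrite -hact_hom // wu linearZ.
  have [c [c' e]] := top_weight_space q_span C_bound Xv chi0 wf.
  have [_ t0] := embed_bottom etaD (cyclic_incl (mono D g t) u).
  exists c', 0; rewrite scale0r addr0 e.
  (* The embedded module lies in the kernel of tau, which excludes a top component. *)
  move: t0; rewrite -[embed _ _ _]/(lowest_embed g u) e linearD !linearZ /= tau_top.
  have [_ ->] := bottom_in tP chiD etaD g t; rewrite scaler0 addr0 => e0.
  suff -> : c = 0 by rewrite scale0r add0r.
  apply/eqP; have [b bE] := linear_pack (bottom_linear tP chiD etaD g).
  have : bot g (c *: t) = bot g 0 by rewrite bE linearZ linear0 -bE.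
  by move/bottom_inj/eqP; rewrite scaler_eq0 (negPf tens_neq0) orbF.
Qed.

Definition extension g : torModule G k.+1 := cyclic_module (top g).

Lemma extension_supported g (u : extension g) : fsupp (cyclic_incl (top g) u).
Proof.
apply: (cyclic_min (N := fsupp) (v := top g)).
- exact: finite_support_submodule.
- exact: finite_support_delta.
- by apply/cyclic_inclP; exists u.
Qed.

Lemma extension_in_Jint g : in_Jint level (extension g).
Proof.
exact: (embedded_in_Jint q_span C_bound Xv chi0 chi_sep level_neq0
  (@cyclic_incl_inj F G k.+1 E (top g)) (@cyclic_incl_hom F G k.+1 E (top g))
  (@extension_supported g) total_level tensor_degree_int).
Qed.

Lemma top_neq0 g : top g != 0.
Proof.
apply: contra_neq tens_neq0 => e; have := tau_top tP (vfac D) chiD etaD g.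
rewrite e linear0 => /esym e'; apply: (@bottom_inj F G k I _ W _ tP chi eta chiD etaD g).
by rewrite e'; have [b ->] := linear_pack (bottom_linear tP chiD etaD g); rewrite linear0.
Qed.

Lemma extension_indecomposable g : indecomposable (extension g).
Proof.
have inj := @cyclic_incl_inj F G k.+1 E (top g).
have hm := @cyclic_incl_hom F G k.+1 E (top g).
apply: (@indecomposable_dual F G k.+1 _ E (cyclic_gen (top g)) (cyclic_incl (top g)) tau
  (loop_weight lam g)) => //.
- exact: cyclic_gen_generates.
- by apply: contra_neq (top_neq0 g) => e; rewrite -[top g]cyclic_genE e linear0.
- exact: tau_hom.
- move=> H; apply: inj; rewrite [RHS]linearZ.
  rewrite hact_hom // cyclic_genE; exact: (top_vector_weight tP Xv chiD etaD chi0 g H).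
- move=> u wu.
  have wf : in_weight_space (loop_weight lam g) (cyclic_incl (top g) u).
    by move=> H; rewrite -hact_hom // wu linearZ.
  rewrite cyclic_genE tau_top; exact: (top_weight_space q_span C_bound Xv chi0 wf).
Qed.

Lemma extension_quotient g : hom_nonzero (extension g) (Xm g).
Proof.
have [|||u|h hh hE] := @hom_factor F G k.+1 (Xm g) (extension g) E (lowest_embed g)
    (tau \o cyclic_incl (top g)).
- exact: lowest_embed_inj.
- exact: lowest_embed_hom.
- by move=> y u; rewrite /= (@tau_hom F G k I W fo _ _ chi eta _ _).
- have [w _ e] : image_set (lowest_embed g) setT (tau (cyclic_incl (top g) u)).
    apply: (cyclic_min (N := fun e : E => image_set (lowest_embed g) setT (tau e)) (v := top g)).
    + apply: (preimage_submodule (@tau_hom F G k I W fo _ _ chi eta _ _)).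
      by apply: image_submodule; [exact: lowest_embed_hom | split].
    + by exists (cyclic_gen (mono D g t)); rewrite // tau_top lowest_embed_gen.
    + by apply/cyclic_inclP; exists u.
  by exists w.
exists h => //; exists (cyclic_gen (top g)).
apply: contra_neq tens_neq0 => e; apply: (@bottom_inj F G k I _ W _ tP chi eta chiD etaD g).
have := hE (cyclic_gen (top g)); rewrite e linear0 /= tau_top => <-.
by have [b ->] := linear_pack (bottom_linear tP chiD etaD g); rewrite linear0.
Qed.

(** When the level sum at m vanishes, t^m K_1 sends the top vector at g to a nonzero multiple of the
    bottom vector at g + m. *)
Lemma extension_sub g m : level_sum lam chi m = 0 ->
  \sum_i lam i (hK1 G) * (chi i m * eta i m) != 0 ->
  hom_nonzero (Xm (g + m)) (extension g).
Proof.
move=> m0; set c := \sum_i _ => c0.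
have top_in : cyclic (top g) (bot (g + m) t).
  have [_ _ Na] := cyclic_submodule (top g).
  have := Na (Central (cons_exp 0 m) ord0) _ (@cyclic_id F G k.+1 E (top g)).
  rewrite (act_central_top tP Xv) m0 scale0r add0r.
  move/(lin_closedZ c^-1 (submodule_lin_closed (cyclic_submodule _))).
  by rewrite scalerA mulVf // scale1r.
have [|||u|h hh hE] := @hom_factor F G k.+1 (extension g) (Xm (g + m)) E
    (cyclic_incl (top g)) (lowest_embed (g + m)).
- exact: cyclic_incl_inj.
- exact: cyclic_incl_hom.
- exact: lowest_embed_hom.
- apply/cyclic_inclP.
  have : cyclic (mono D (g + m) t) (cyclic_incl (mono D (g + m) t) u).
    by apply/cyclic_inclP; exists u.
  apply: (cyclic_min (N := fun y => cyclic (top g) (embed D etaD y))).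
    by apply: preimage_submodule; [exact: embed_hom | exact: cyclic_submodule].
  by rewrite embed_mono.
exists h => //; exists (cyclic_gen (mono D (g + m) t)).
apply: contra_neq tens_neq0 => e.
apply: (@bottom_inj F G k I _ W _ tP chi eta chiD etaD (g + m)).
have := hE (cyclic_gen (mono D (g + m) t)); rewrite e linear0 lowest_embed_gen => <-.
by have [b ->] := linear_pack (bottom_linear tP chiD etaD (g + m)); rewrite linear0.
Qed.

End Objects.

Lemma lowest_sub g m : level_sum lam chi m != 0 ->
  hom_nonzero (cyclic_module (mono D (g + m) t)) (cyclic_module (mono D g t)).
Proof.
move=> m0; set u := mono D g t; set u' := mono D (g + m) t.
have uu' : cyclic u u'.
  have [_ _ Na] := cyclic_submodule u.
  have := Na (Central (cons_exp 0 m) ord0) _ (@cyclic_id F G k.+1 _ u).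
  rewrite Lmod_central1 cons_exp_head eqxx cons_exp_tail xactE.
  have -> : \sum_(i : I) ev (val i) m *: fo i (Central 0 ord0) t = level_sum lam chi m *: t.
    rewrite scaler_suml; apply: eq_bigr => i _.
    by rewrite (factor_level tP Xv) scalerA mulrC.
  rewrite linearZ; move/(lin_closedZ (level_sum lam chi m)^-1
    (submodule_lin_closed (cyclic_submodule _))).
  by rewrite scalerA mulVf // scale1r.
have [|||w|h hh hE] := @hom_factor F G k.+1 (cyclic_module u) (cyclic_module u') (Lmod D)
    (cyclic_incl u) (cyclic_incl u').
- exact: cyclic_incl_inj.
- exact: cyclic_incl_hom.
- exact: cyclic_incl_hom.
- apply/cyclic_inclP; apply: (cyclic_min (N := cyclic u) (v := u')) => //.
    exact: cyclic_submodule.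
  by apply/cyclic_inclP; exists w.
exists h => //; exists (cyclic_gen u'); apply: contra_neq (mono_neq0 (g + m) tens_neq0) => e.
by rewrite -/u' -[u']cyclic_genE -hE e linear0.
Qed.

(* If the total central charge of [t^m] vanishes, it is restored to first
   order by deforming the evaluation point of [i0] in the direction [m]. *)
Lemma lowest_linked (i0 : I) g g' : lam i0 (hK1 G) != 0 ->
  linked (cyclic_module (mono D g t)) (cyclic_module (mono D g' t)).
Proof.
move=> l0; have [m g'E] : exists m, g' = g + m by exists (g' - g); rewrite addrC subrK.
(* Only [i0] is deformed, along [m]; at n = m the pairing is a sum of squares of integers. *)
pose eta (i : I) (n : 'rV[int]_k) : F := (i == i0)%:R * \sum_j (m 0 j * n 0 j)%:~R.
have etaD i n n' : eta i (n + n') = eta i n + eta i n'.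
  rewrite /eta -mulrDr -big_split; congr (_ * _); apply: eq_bigr => j _ /=.
  by rewrite mxE mulrDr rmorphD.
have lowestP h := conj (lowest_indecomposable etaD h)
  (in_Jint_plusI level_gt0 (lowest_in_Jint etaD h)).
rewrite g'E; have [m0|m0] := eqVneq (level_sum lam chi m) 0; last first.
  exists 1%N, (fun n => if n is 0%N then cyclic_module (mono D g t)
    else cyclic_module (mono D (g + m) t)).
  split=> // [[|n] _|[|n] //]; [exact: lowestP | exact: lowestP | right; exact: lowest_sub].
exists 2%N, (fun n => match n with 0%N => cyclic_module (mono D g t) | 1%N => extension etaD g
  | _ => cyclic_module (mono D (g + m) t) end).
split=> // [[|[|n]] _|[|[|n]] //]; first exact: lowestP.
- split; first exact: extension_indecomposable.
  exact: in_Jint_plusI level_gt0 (extension_in_Jint etaD g).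
- exact: lowestP.
- by move=> _; right; exact: extension_quotient.
move=> _; right; apply: extension_sub => //.
rewrite (bigD1 i0) //= big1 ?addr0 => [|i /negPf ii0]; last by rewrite /eta ii0 mul0r !mulr0.
rewrite /eta eqxx mul1r !mulf_neq0 //.
  exact: (character_neq0 (chi := chi) (fun i => ev_D (val i)) (fun i => ev_0 (val i))).
rewrite -rmorph_sum /= intr_eq0 psumr_eq0 => [|j _]; last exact: sqr_ge0.
(* If all squares vanished, m would be 0, and the level sum at 0 is the nonzero total level. *)
apply/negP => /allP mm0; case/eqP: level_neq0; rewrite total_level -level_sum0 -m0.
suff -> : m = 0 by [].
apply/rowP => j; rewrite mxE; apply/eqP; have := mm0 j (mem_index_enum j).
by rewrite mulf_eq0 orbb.
Qed.

End Linkage.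

Theorem typeII_linked (F : numClosedFieldType) (G : simpleLie F) (k : nat)
    (pi : weight_map G k) (D : realization pi) (r s : 'rV[int]_k.+1) :
  in_Pi pi -> integer_degrees (Lmod D) -> typeII pi -> type_ADE G ->
  linked (Xpi D s) (Xpi D r).
Proof.
move=> pi_in_Pi pi_integral [M0 M0pi tle] G_ADE.
have tt0 := theta_form_gt0 G_ADE; pose i0 : finsupp pi := FSetSub M0pi.
(* Positivity of (theta|theta) turns the lower bound of the type condition into a nonzero level. *)
have l0 : pi (val i0) (hK1 G) != 0 by apply: lt0r_neq0; exact: lt_le_trans tle.
(* Semisimplicity of the Cartan action on [G] comes from the module at M_0, where K_1 acts by a
   nonzero scalar. *)
have [q q_span] : exists q : seq (G * int), homogeneous_spanning q.
  apply: homogeneous_exists; have Xv := XfacP D i0; have [_ [dX _] _ _] := Xv.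
  apply: (affine_semisimple (v0 := vfac D i0) dX).
  by rewrite (highest_central Xv) scaler_eq0 negb_or l0 (highest_neq0 Xv).
have [C C_bound] : exists C : nat, forall p : G * int, p \in q -> `|p.2| < C%:Z.
  exists (\sum_(p <- q) `|p.2|%N).+1 => p pq.
  by rewrite (big_rem p) //= ltz_nat ltnS leq_addr.
have [n nE] : exists n : finsupp pi -> nat, forall i, pi (val i) (hK1 G) = (n i)%:R.
  have lev (i : finsupp pi) : exists n : nat, pi (val i) (hK1 G) = n%:R.
    exact: level_nat q_span (lt0r_neq0 tt0) (pi_in_Pi _) (XfacP D i).
  by exists (fun i => projT1 (cid (lev i))) => i; case: cid.
have levelE : \sum_(i : finsupp pi) pi (val i) (hK1 G) = (\sum_i n i)%:R :> F.
  by rewrite natr_sum; apply: eq_bigr.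
apply: (lowest_linked q_span C_bound pi_integral levelE _ (i0 := i0)) => //.
(* The total level is positive: its terms are natural numbers, and the one at M_0 is nonzero. *)
rewrite (bigD1 i0) //= ltn_addr // lt0n; apply: contra_neq l0.
by rewrite nE => ->.
Qed.

Theorem proposition7p3 (R : realType) (G : simpleLie R[i]) (k : nat)
    (pi : weight_map G k) (D : realization pi)
    (pi_in_Pi : in_Pi pi) (pi_integral : integer_degrees (Lmod D))
    (pi_typeII : typeII pi) (G_ADE : type_ADE G)
    (r s : 'rV[int]_k.+1) (r1_eq0 : r 0 ord0 = 0) (s1_eq0 : s 0 ord0 = 0) :
  linked (Xpi D s) (Xpi D r).
Proof. exact: typeII_linked. Qed.
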